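(* Let $(\mathcal{G},\mu)$ be a discrete measured groupoid. Then $(\mathcal{G},\mu)$ is Choquet--Deny if and only if the following two conditions hold: (1) The countable Borel equivalence relation $\mathcal{R}=\{(t(g),s(g)) : g\in\mathcal{G}\}$ on $\mathcal{G}^{(0)}$ associated with $(\mathcal{G},\mu)$ has finite orbits $\mu$-almost everywhere (that is, $\#s(\mathcal{G}^x)<\infty$ for $\mu$-almost every $x\in\mathcal{G}^{(0)}$). (2) For $\mu$-almost every $x\in\mathcal{G}^{(0)}$ the isotropy group $\mathcal{G}_x^x$ is a Choquet--Deny group.
   Context: Groupoids. A groupoid $\mathcal{G}$ has unit space $\mathcal{G}^{(0)}$, source map $s$ and target map $t$; the product $gh$ is defined iff $s(g)=t(h)$. For $x\in\mathcal{G}^{(0)}$ put $\mathcal{G}_x=s^{-1}(x)$, $\mathcal{G}^x=t^{-1}(x)$, and let $\mathcal{G}_x^x=\mathcal{G}_x\cap\mathcal{G}^x$ be the isotropy group at $x$. A discrete Borel groupoid is a groupoid that is a standard Borel space, with $\mathcal{G}^{(0)}$ Borel, all structure maps Borel, and all sets $\mathcal{G}_x,\mathcal{G}^x$ countable. Given a Borel probability measure $\mu$ on $\mathcal{G}^{(0)}$, put $\mu_s(A)=\int \#(s^{-1}(x)\cap A)\,d\mu(x)$ and $\mu_t(A)=\int\#(t^{-1}(x)\cap A)\,d\mu(x)$ for Borel $A\subseteq\mathcal{G}$. The pair $(\mathcal{G},\mu)$ is a discrete measured groupoid if $(\mathcal{G}^{(0)},\mu)$ is a standard probability space and $\mu_s,\mu_t$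 have the same null sets. Markov operators. An invariant Markov operator $P$ on $\mathcal{G}$ is given by probability measures $d_xP$ on $\mathcal{G}^x$ ($x\in\mathcal{G}^{(0)}$) such that for each non-negative Borel function $f$ on $\mathcal{G}$ the map $g\mapsto\sum_{h\in\mathcal{G}^{s(g)}}d_{s(g)}P(h)f(gh)$ is Borel. For each $x$, $P_x$ acts on $\ell^\infty(\mathcal{G}^x)$ by $P_xf(g)=\sum_{h\in\mathcal{G}^{s(g)}}d_{s(g)}P(h)f(gh)$. Powers $P^n$ ($n\ge 1$) correspond to $d_xP^n(g)=\sum_{h\in\mathcal{G}^x}d_xP(h)\,d_{s(h)}P^{n-1}(h^{-1}g)$ (with $P^1=P$ for $n=1$). $P$ is non-degenerate if $\bigcup_{n\ge1}\{g\in\mathcal{G}^x: d_xP^n(g)>0\}=\mathcal{G}^x$ for all $x\in\mathcal{G}^{(0)}$. $P_x$ is Liouville if every $f\in\ell^\infty(\mathcal{G}^x)$ with $P_xf=f$ is constant; $P$ is fiberwise Liouville if $P_x$ is Liouville for $\mu$-almost every $x$. $(\mathcal{G},\mu)$ is Choquet--Deny if every non-degenerate invariant Markov operator on it is fiberwise Liouville. Groups. A countable discrete group $\Gamma$ is Choquet--Deny if for every probability measure $\nu$ on $\Gamma$ whose support generates $\Gamma$ as a semigroup, every bounded $f:\Gamma\to\mathbb{C}$ with $f(g)=\sum_{h\in\Gamma}\nu(h)f(gh)$ for all $g\in\Gamma$ is constant. *)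

(* Defs.v *)
From HB Require Import structures.
From mathcomp Require Import all_boot all_order all_algebra.
From mathcomp Require Import all_classical all_reals all_analysis.
From mathcomp Require Import measurable_realfun complex.

Set Implicit Arguments.
Unset Strict Implicit.
Unset Printing Implicit Defensive.
Import Order.TTheory GRing.Theory Num.Theory.
Import numFieldNormedType.Exports.

Local Open Scope classical_set_scope.
Local Open Scope ring_scope.

(* In the MathComp-Analysis hierarchy a complete pseudometric space which is
   Hausdorff is a complete metric space; for such spaces separability and
   second countability agree. *)
Definition standard_borel (R : realType) (d : measure_display)
    (T : measurableType d) : Prop :=
  exists (Y : completePseudoMetricType R) (f : T -> Y),
    [/\ hausdorff_space Y, @second_countable Y, bijective f &
        forall A : set T, measurable A <-> <<s @open Y >> (f @` A)].

(* Units form a separate type [X], included among the arrows by [unit_at].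
   [gmul g h] is a junk value unless [src g = tgt h]. *)
Record groupoid (X : Type) (G : choiceType) := Groupoid {
  src : G -> X;
  tgt : G -> X;
  unit_at : X -> G;
  gmul : G -> G -> G;
  ginv : G -> G;
  src_unit : forall x, src (unit_at x) = x;
  tgt_unit : forall x, tgt (unit_at x) = x;
  src_mul : forall g h, src g = tgt h -> src (gmul g h) = src h;
  tgt_mul : forall g h, src g = tgt h -> tgt (gmul g h) = tgt g;
  gmulA : forall g h k, src g = tgt h -> src h = tgt k ->
    gmul g (gmul h k) = gmul (gmul g h) k;
  gmul1l : forall g, gmul (unit_at (tgt g)) g = g;
  gmul1r : forall g, gmul g (unit_at (src g)) = g;
  src_inv : forall g, src (ginv g) = tgt g;
  tgt_inv : forall g, tgt (ginv g) = src g;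
  gmulVl : forall g, gmul (ginv g) g = unit_at (src g);
  gmulVr : forall g, gmul g (ginv g) = unit_at (tgt g)
}.

Section Groupoid.
Context (X : Type) (G : choiceType) (GG : groupoid X G).

Definition src_fiber (x : X) : set G := [set g | src GG g = x].

Definition tgt_fiber (x : X) : set G := [set g | tgt GG g = x].

Definition orbit_relation : set (X * X) := range (fun g => (tgt GG g, src GG g)).

Definition isotropy_pred (x : X) : pred G :=
  fun g => `[< (src_fiber x `&` tgt_fiber x) g >].

Definition isotropy (x : X) := {g : G | isotropy_pred x g}.

HB.instance Definition _ (x : X) := Choice.on (isotropy x).

Section IsotropyGroup.
Context (x : X).
Implicit Types a b c : isotropy x.

Lemma isotropy_src a : src GG (sval a) = x.
Proof. by have /asboolP[] := svalP a. Qed.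

Lemma isotropy_tgt a : tgt GG (sval a) = x.
Proof. by have /asboolP[] := svalP a. Qed.

Lemma isotropy_composable a b : src GG (sval a) = tgt GG (sval b).
Proof. by rewrite isotropy_src isotropy_tgt. Qed.

Lemma isotropy_one_subproof : isotropy_pred x (unit_at GG x).
Proof. by apply/asboolP; split; [exact: src_unit|exact: tgt_unit]. Qed.

Lemma isotropy_mul_subproof a b : isotropy_pred x (gmul GG (sval a) (sval b)).
Proof.
have ab := isotropy_composable a b.
apply/asboolP; split; rewrite /src_fiber /tgt_fiber/=.
  by rewrite src_mul// isotropy_src.
by rewrite tgt_mul// isotropy_tgt.
Qed.

Lemma isotropy_inv_subproof a : isotropy_pred x (ginv GG (sval a)).
Proof.
apply/asboolP; split; rewrite /src_fiber /tgt_fiber/=.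
  by rewrite src_inv isotropy_tgt.
by rewrite tgt_inv isotropy_src.
Qed.

Definition isotropy_one : isotropy x :=
  exist (fun g => isotropy_pred x g) _ isotropy_one_subproof.

Definition isotropy_mul a b : isotropy x :=
  exist (fun g => isotropy_pred x g) _ (isotropy_mul_subproof a b).

Definition isotropy_inv a : isotropy x :=
  exist (fun g => isotropy_pred x g) _ (isotropy_inv_subproof a).

Lemma isotropy_mulA : associative isotropy_mul.
Proof.
by move=> a b c; apply: val_inj; apply: gmulA; exact: isotropy_composable.
Qed.

Lemma isotropy_mul1l : left_id isotropy_one isotropy_mul.
Proof.
by move=> a; apply: val_inj; have := gmul1l GG (sval a); rewrite isotropy_tgt.
Qed.

Lemma isotropy_mul1r : right_id isotropy_one isotropy_mul.
Proof.
by move=> a; apply: val_inj; have := gmul1r GG (sval a); rewrite isotropy_src.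
Qed.

Lemma isotropy_mulVl : left_inverse isotropy_one isotropy_inv isotropy_mul.
Proof.
by move=> a; apply: val_inj; have := gmulVl GG (sval a); rewrite isotropy_src.
Qed.

Lemma isotropy_mulVr : right_inverse isotropy_one isotropy_inv isotropy_mul.
Proof.
by move=> a; apply: val_inj; have := gmulVr GG (sval a); rewrite isotropy_tgt.
Qed.

HB.instance Definition _ := isGroup.Build (isotropy x)
  isotropy_mulA isotropy_mul1l isotropy_mul1r isotropy_mulVl isotropy_mulVr.

End IsotropyGroup.
End Groupoid.

(* The unordered sum of an absolutely summable real, resp. complex, family. *)
Definition rsum (R : realType) (T : choiceType) (A : set T) (u : T -> R) : R :=
  fine (\esum_(i in A) ((EFin \o u)^\+ i) - \esum_(i in A) ((EFin \o u)^\- i))%E.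

Definition csum (R : realType) (T : choiceType) (A : set T) (u : T -> R[i]) :
    R[i] :=
  Complex (rsum A (fun i => complex.Re (u i))) (rsum A (fun i => complex.Im (u i))).

(* Boundedness is with respect to the order of [R[i]], in which [`|z| <= M]
   forces [M] to be real. *)
Definition bounded_on (R : realType) (T : Type) (A : set T) (f : T -> R[i]) :
    Prop :=
  exists M : R[i], forall t, A t -> `|f t| <= M.

Definition constant_on (T U : Type) (A : set T) (f : T -> U) : Prop :=
  exists c : U, forall t, A t -> f t = c.

Section ChoquetDenyGroup.
Context (R : realType) (Gamma : groupType).

Definition prob_weight (nu : Gamma -> R) : Prop :=
  (forall g, 0 <= nu g) /\ \esum_(g in [set: Gamma]) (nu g)%:E = 1%E.

Definition support_generates_semigroup (nu : Gamma -> R) : Prop :=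
  smallest [set S : set Gamma | forall a b, S a -> S b -> S (a * b)%g]
    [set g | 0 < nu g] = [set: Gamma].

Definition choquet_deny_group : Prop :=
  countable [set: Gamma] /\
  forall nu : Gamma -> R, prob_weight nu -> support_generates_semigroup nu ->
  forall f : Gamma -> R[i], bounded_on [set: Gamma] f ->
    (forall g, f g = csum [set: Gamma] (fun h => (nu h)%:C%C * f (g * h)%g)) ->
    constant_on [set: Gamma] f.

End ChoquetDenyGroup.

Section MeasuredGroupoid.
Context (R : realType) (dX dG : measure_display).
Context (X : measurableType dX) (G : measurableType dG) (GG : groupoid X G).

(* [units_borel] says both that the set of units is Borel in [G] (take
   [A = setT]) and that [X] carries the induced Borel structure. *)
Record discrete_borel_groupoid : Prop := DiscreteBorelGroupoid {
  arrows_standard_borel : standard_borel R G;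
  units_borel : forall A : set X, measurable A <-> measurable (unit_at GG @` A);
  measurable_src : measurable_fun setT (src GG);
  measurable_tgt : measurable_fun setT (tgt GG);
  measurable_gmul : measurable_fun [set gh : G * G | src GG gh.1 = tgt GG gh.2]
    (fun gh => gmul GG gh.1 gh.2);
  measurable_ginv : measurable_fun setT (ginv GG);
  countable_src_fiber : forall x, countable (src_fiber GG x);
  countable_tgt_fiber : forall x, countable (tgt_fiber GG x)
}.

Definition mu_src (mu : probability X R) (A : set G) : \bar R :=
  (\int[mu]_x counting (src_fiber GG x `&` A))%E.

Definition mu_tgt (mu : probability X R) (A : set G) : \bar R :=
  (\int[mu]_x counting (tgt_fiber GG x `&` A))%E.

Definition discrete_measured_groupoid (mu : probability X R) : Prop :=
  discrete_borel_groupoid /\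
  forall A : set G, measurable A -> mu_src mu A = 0%E <-> mu_tgt mu A = 0%E.

(* A family of probability measures on the countable target fibers is encoded
   by a single weight function: [p h] is the mass of [h] under the measure on
   the fiber of [tgt h]. On non-negative functions the operator may take the
   value [+oo]. *)
Definition markov_ge0_op (p f : G -> R) (g : G) : \bar R :=
  \esum_(h in tgt_fiber GG (src GG g)) (p h * f (gmul GG g h))%:E.

Record invariant_markov (p : G -> R) : Prop := InvariantMarkov {
  markov_ge0 : forall g, 0 <= p g;
  markov_sum1 : forall x, \esum_(h in tgt_fiber GG x) (p h)%:E = 1%E;
  markov_measurable : forall f : G -> R, measurable_fun setT f ->
    (forall g, 0 <= f g) ->
    measurable_fun setT (markov_ge0_op p f)
}.

(* On the target fiber of [x] this depends only on the restriction of [f] to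
   that fiber, and is the operator attached to [x]. *)
Definition markov_op (p : G -> R) (f : G -> R[i]) (g : G) : R[i] :=
  csum (tgt_fiber GG (src GG g)) (fun h => (p h)%:C%C * f (gmul GG g h)).

(* [markov_pow p n] gives the weights of the (n+1)-st power. *)
Fixpoint markov_pow (p : G -> R) (n : nat) (g : G) : \bar R :=
  match n with
  | 0%N => (p g)%:E
  | m.+1 => \esum_(h in tgt_fiber GG (tgt GG g))
      ((p h)%:E * markov_pow p m (gmul GG (ginv GG h) g))%E
  end.

Definition nondegenerate_markov (p : G -> R) : Prop :=
  forall x, \bigcup_n [set g | tgt_fiber GG x g /\ (0 < markov_pow p n g)%E] =
            tgt_fiber GG x.

Definition liouville_at (p : G -> R) (x : X) : Prop :=
  forall f : G -> R[i], bounded_on (tgt_fiber GG x) f ->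
    (forall g, tgt_fiber GG x g -> markov_op p f g = f g) ->
    constant_on (tgt_fiber GG x) f.

Definition fiberwise_liouville (mu : probability X R) (p : G -> R) : Prop :=
  {ae mu, forall x, liouville_at p x}.

Definition choquet_deny_groupoid (mu : probability X R) : Prop :=
  forall p : G -> R, invariant_markov p -> nondegenerate_markov p ->
    fiberwise_liouville mu p.

End MeasuredGroupoid.

(* Main.v *)
(* If the orbit of [x] is finite, a non-degenerate chain returns to [x] almost
   surely, and the first-return distribution is a non-degenerate probability on
   the isotropy group at [x]; a bounded harmonic function restricted to this
   group is harmonic for it, hence constant, and the same holds from every point
   of the orbit.
   Conversely, an infinite orbit carries a measurable rank with values in the
   natural numbers: code its points by binary sequences and count how long a code
   agrees with the leftmost cluster point. A chain that jumps from rank [n] to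
   rank [n + 2], except with small probabilities of finite total sum, keeps
   the parity of its rank with positive probability, so it is not Liouville.
   When almost all orbits are finite, choose a base point in each orbit and, when
   its isotropy group is not Choquet-Deny, measurably a measure and a harmonic
   function witnessing this; a chain which is sent back to the base point and
   there makes an isotropy step according to the chosen measure is not Liouville.
   The Lusin-Novikov, Lusin-Souslin and measurable selection theorems that this
   requires all come from schemes of measurable pieces whose branches converge. *)

Require Import Defs.
From HB Require Import structures.
From mathcomp Require Import all_boot all_order all_algebra.
From mathcomp Require Import all_classical all_reals all_analysis measurable_realfun.
From mathcomp Require Import complex.
From mathcomp Require Import ring lra.
From Stdlib Require List.

Set Implicit Arguments.
Unset Strict Implicit.
Unset Printing Implicit Defensive.
Import Order.TTheory GRing.Theory Num.Theory.
Import numFieldNormedType.Exports.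

Local Open Scope classical_set_scope.
Local Open Scope ring_scope.

(** * Convergent schemes of measurable sets *)

Section Branch.

(** Standard Borel spaces enter only through a countable separating family of sets with countable
    covers whose coherent choices converge. Countably many Borel sets may be adjoined to the family
    without losing this property; that replaces the passage to a finer Polish topology in which
    given Borel sets become clopen and a given Borel map continuous. The obstacle in the isotropy
    condition is measurability: the points with a bad isotropy group are only known as the
    projection of a Borel set of pairs (point, witness). Selection therefore works off a null set,
    and with respect to the law of the base point instead of [mu], so that the exceptional base
    points pull back to a [mu]-null set. No measure on path space is built. On infinite orbits the
    event of keeping an even rank is replaced by a harmonic function squeezed between an explicit
    subharmonic and an explicit superharmonic function; on finite orbits the first return is a
    series of iterates of a killed step. The kernels constructed are laws of Borel sections of the
    target map with a random index in the natural numbers, so that their measurability is that of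
    countable sums. *)

Lemma branch (I : Type) (Pr : seq I -> Prop) : Pr [::] ->
  (forall s, Pr s -> exists i, Pr (rcons s i)) ->
  exists a : nat -> I, forall n, Pr (mkseq a n).
Proof.
move=> P0 Pn.
have [i0 _] := Pn _ P0.
have step s : exists i, Pr s -> Pr (rcons s i).
  have [Ps|ns] := pselect (Pr s); last by exists i0.
  by have [i Pi] := Pn _ Ps; exists i.
have [g gP] := choice step.
pose u n := iter n (fun s => rcons s (g s)) [::].
exists (fun n => g (u n)) => n.
have -> : mkseq (fun n => g (u n)) n = u n.
  by elim: n => // n IH; rewrite mkseqS IH.
by elim: n => // n IH; exact: gP.
Qed.

Lemma mkseq_mono (I : Type) (Pr : seq I -> Prop) (a : nat -> I) m n :
  (forall s i, Pr (rcons s i) -> Pr s) -> (m <= n)%N ->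
  Pr (mkseq a n) -> Pr (mkseq a m).
Proof.
move=> H /subnK <-; elim: (n - m)%N => // k IH.
by rewrite addSn mkseqS => /H.
Qed.

End Branch.

Section Covers.
Context (T : Type).
Implicit Types (Q : nat -> nat -> set T) (W : set (set T)).

Definition cell Q (s : seq nat) : set T :=
  [set z | forall k, (k < size s)%N -> Q k (nth 0%N s k) z].

Definition covers Q := forall k z, exists i, Q k i z.

(* A sequence of countable covers resolves [W] when every coherent choice of
   cells converges to a point whose membership in each [E] of [W] is eventually
   that of the cells. *)
Definition resolves Q W := forall a : nat -> nat,
  (forall n, cell Q (mkseq a n) !=set0) ->
  exists z, forall E, W E -> exists n, forall y, cell Q (mkseq a n) y ->
    (E y <-> E z).

Definition separating W := forall y z, (forall E, W E -> (E y <-> E z)) -> y = z.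

Lemma cell_mkseq Q a n z :
  cell Q (mkseq a n) z <-> forall k, (k < n)%N -> Q k (a k) z.
Proof.
by split=> H k; have := H k; rewrite size_mkseq => Hk kn; have := Hk kn;
  rewrite nth_mkseq.
Qed.

Lemma cell_rcons Q s i z :
  cell Q (rcons s i) z <-> cell Q s z /\ Q (size s) i z.
Proof.
split=> [H|[H Qi] k].
  split=> [k ks|].
    by have := H k; rewrite size_rcons nth_rcons ks; apply; exact: ltnW.
  by have := H (size s); rewrite size_rcons nth_rcons ltnn eqxx; exact.
rewrite size_rcons ltnS leq_eqVlt => /predU1P[->|ks].
  by rewrite nth_rcons ltnn eqxx.
by rewrite nth_rcons ks; exact: H.
Qed.

Lemma cell_le Q a m n z : (m <= n)%N ->
  cell Q (mkseq a n) z -> cell Q (mkseq a m) z.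
Proof. by move=> mn /cell_mkseq H; apply/cell_mkseq => k km; apply: H; exact: leq_trans mn. Qed.

Lemma resolves_sub Q W W' : W `<=` W' -> resolves Q W' -> resolves Q W.
Proof. by move=> WW' H a /H[z zP]; exists z => E /WW'/zP. Qed.

End Covers.

Section Resolvable.
Context d (T : measurableType d).
Implicit Types (W : set (set T)) (E : set T).

Definition resolvable W := exists Q,
  [/\ covers Q, forall k i, measurable (Q k i) & resolves Q W].

Lemma resolvable_sub W W' : W `<=` W' -> resolvable W' -> resolvable W.
Proof. by move=> WW' [Q [c m r]]; exists Q; split => //; exact: resolves_sub r. Qed.

(** The covers for the various [m] are interleaved by a pairing function, so a branch has one limit
    for each [m]. These limits agree, because [W] is contained in every [W' m] and separates
    points. *)
Lemma resolvable_bigcup W (W' : nat -> set (set T)) : separating W ->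
  (forall m, W `<=` W' m) -> (forall m, resolvable (W' m)) ->
  resolvable (\bigcup_m W' m).
Proof.
move=> sepW sW /(_ _)/cid-/all_tag[Q /all_and3[cQ mQ rQ]].
pose dec k := odflt (0, 0)%N (@unpickle (nat * nat)%type k).
have decK p : dec (pickle p) = p by rewrite /dec pickleK.
exists (fun k => Q (dec k).1 (dec k).2); split => [k|k i|a ane]; first exact: cQ.
  exact: mQ.
pose am (m n : nat) := a (pickle (m, n)).
have sub m N : exists M, forall z, cell (fun k => Q (dec k).1 (dec k).2) (mkseq a M) z ->
    cell (Q m) (mkseq (am m) N) z.
  exists (\max_(n < N) (pickle (m, n : nat)).+1)%N => z /cell_mkseq H.
  apply/cell_mkseq => n nN; rewrite /am.
  have := H (pickle (m, n)); rewrite decK; apply.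
  exact: (@leq_bigmax _ (fun n : 'I_N => (pickle (m, n : nat)).+1) (Ordinal nN)).
have amne m n : cell (Q m) (mkseq (am m) n) !=set0.
  have [M MP] := sub m n; have [z /MP ?] := ane M; by exists z.
have lim m : exists z, forall E, W' m E -> exists n, forall y,
    cell (fun k => Q (dec k).1 (dec k).2) (mkseq a n) y -> (E y <-> E z).
  have [z zP] := rQ m _ (amne m); exists z => E /zP[n nP].
  by have [M MP] := sub m n; exists M => y /MP/nP.
have {lim}[z zP] := choice lim.
have zE m : z m = z 0%N.
  apply: sepW => E WE.
  have [n nP] := zP m _ (sW m _ WE); have [n' n'P] := zP 0%N _ (sW 0%N _ WE).
  have [y yP] := ane (maxn n n').
  by rewrite -(nP y) ?(n'P y) //; apply: cell_le yP; rewrite ?leq_maxl ?leq_maxr.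
by exists (z 0%N) => E [m _ WmE]; have := zP m _ WmE; rewrite zE.
Qed.

(** One extra cover records either some [E m] containing the point or the complement of the union. A
    branch then fixes membership in the union, and the limit follows suit because each [E m] is
    already resolved. *)
Lemma resolvable_addU W (E : nat -> set T) : (forall m, W (E m)) ->
  (forall m, measurable (E m)) -> resolvable W ->
  resolvable (W `|` [set \bigcup_m E m]).
Proof.
move=> WE mE [Q [cQ mQ rQ]].
pose Q0 i := if i is m.+1 then E m else ~` \bigcup_m E m.
exists (fun k => if k is k'.+1 then Q k' else Q0); split.
- move=> [z|k z]; last exact: cQ.
  by have [[m _ Em]|nE] := pselect ((\bigcup_m E m) z); [exists m.+1|exists 0%N].
- move=> [[|i]|k i] //=.
  by apply: measurableC; exact: bigcup_measurable.
move=> a ane.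
have sub n z : cell (fun k => if k is k'.+1 then Q k' else Q0) (mkseq a n.+1) z ->
    Q0 (a 0%N) z /\ cell Q (mkseq (fun k => a k.+1) n) z.
  move=> /cell_mkseq H; split; first exact: (H 0%N).
  by apply/cell_mkseq => k kn; exact: (H k.+1).
have [|z zP] := rQ (fun k => a k.+1).
  by move=> n; have [y /sub[_ ?]] := ane n.+1; exists y.
exists z => F [WF|->].
  by have [n nP] := zP _ WF; exists n.+1 => y /sub[_ /nP].
case a0 : (a 0%N) => [|m].
  exists 1%N => y /sub[]; rewrite a0 => yE _; split => // -[m _ Emz].
  have [n nP] := zP _ (WE m); have [x /sub[]] := ane n.+1.
  by rewrite a0 => xE /nP [_ /(_ Emz) Ex]; exfalso; apply: xE; exists m.
exists 1%N => y /sub[]; rewrite a0 => yE _; split => _; last by exists m.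
have [n nP] := zP _ (WE m); have [x /sub[]] := ane n.+1.
by rewrite a0 => Ex /nP [/(_ Ex)]; exists m.
Qed.

Lemma resolvable_addC W E : resolvable (W `|` [set E]) ->
  resolvable (W `|` [set ~` E]).
Proof.
move=> [Q [cQ mQ rQ]]; exists Q; split => // a /rQ[z zP]; exists z => F [WF|->].
  by apply: zP; left.
by have [|n nP] := zP E; [right|exists n => y /nP[H1 H2]; split=> nE; [move/H2|move/H1]].
Qed.

(** The measurable sets that can be adjoined to [W] form a sigma-algebra. This is the counterpart of
    making a Borel set clopen in a finer Polish topology. *)
Theorem resolvable_measurable W : separating W -> W `<=` measurable ->
  resolvable W -> forall E, <<s W >> E -> resolvable (W `|` [set E]).
Proof.
move=> sW mW rW.
suff: <<s W >> `<=` [set E | measurable E /\ resolvable (W `|` [set E])].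
  by move=> H E /H[].
apply: smallest_sub; last first.
  by move=> E WE; split; [exact: mW|rewrite setUidl// => _ ->].
split.
- split=> //; apply: (@resolvable_sub _ (W `|` [set \bigcup_(m : nat) (set0 : set T)])).
    by rewrite bigcup0.
  have [Q [cQ mQ rQ]] := rW.
  exists Q; split => // a /rQ[z zP]; exists z => F [/zP//|->].
  by exists 0%N => y _; rewrite bigcup0.
- move=> E [mE rE]; rewrite setTD; split; [exact: measurableC|exact: resolvable_addC].
move=> E EP; have mE m : measurable (E m) by have [] := EP m.
split; first exact: bigcup_measurable.
apply: (@resolvable_sub _ ((\bigcup_m (W `|` [set E m])) `|` [set \bigcup_m E m])).
  by move=> F [WF|->]; [left; exists 0%N => //; left|right].
apply: resolvable_addU => // [m|]; first by exists m => //; right.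
apply: (resolvable_bigcup sW) => m; first exact: subsetUl.
by have [] := EP m.
Qed.

End Resolvable.

(** The substitute for a countable base of a Polish topology: it generates the Borel sets, separates
    points and carries a form of completeness. *)
Definition resolving_base d (T : measurableType d) (W : nat -> set T) :=
  [/\ separating (range W), forall k, measurable (W k),
      resolvable (range W) & measurable `<=` <<s range W >>].

Lemma resolvable_seq d (T : measurableType d) (W E : nat -> set T) :
  resolving_base W -> (forall m, measurable (E m)) ->
  resolvable (range W `|` range E).
Proof.
move=> [sW mW rW gW] mE.
apply: (@resolvable_sub _ _ _ (\bigcup_m (range W `|` [set E m]))).
  by move=> F [WF|[m _ <-]]; [exists 0%N => //; left|exists m => //; right].
apply: (resolvable_bigcup sW) => m; first exact: subsetUl.
apply: resolvable_measurable => //; last by apply: gW.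
by move=> _ [k _ <-].
Qed.

Lemma countable_enum (U : Type) (B : set U) (b0 : U) : countable B ->
  exists e : nat -> U, (forall k, B (e k) \/ e k = b0) /\ B `<=` range e.
Proof.
move=> /countable_injP[f finj].
have H k : exists u, (B u /\ f u = k) \/ ((forall v, B v -> f v <> k) /\ u = b0).
  have [[u uP]|nu] := pselect (exists u, B u /\ f u = k); first by exists u; left.
  by exists b0; right; split => // v Bv fv; apply: nu; exists v.
have [e eP] := choice H; exists e; split=> [k|u Bu].
  by case: (eP k) => [[]|[_ ->]]; [left|right].
exists (f u) => //; case: (eP (f u)) => [[Be]|[/(_ _ Bu)//]].
by apply: finj; rewrite ?inE //; exact/mem_set.
Qed.

Section Polish.
Context (R : realType) (Y : completePseudoMetricType R).

(** The [k]-th cover combines two demands. Pieces inside balls of radius [1/(k+1)] make a branch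
    Cauchy, so that completeness supplies its limit; closed pieces deciding membership in [W k]
    ensure that the limit decides as its cells do. *)
Lemma complete_resolving : hausdorff_space Y -> @second_countable Y ->
  exists W : nat -> set Y,
  [/\ forall k, open (W k), separating (range W), basis (range W) &
   exists Q, [/\ covers Q, forall k i, <<s @open Y >> (Q k i) & resolves Q (range W)]].
Proof.
move=> hY [B cB [Bo Bb]].
have [W [WB BW]] := countable_enum set0 cB.
have Wo k : open (W k) by case: (WB k) => [/Bo//|->]; exact: open0.
have Wbasis y A : nbhs y A -> exists k, W k y /\ W k `<=` A.
  move=> /(Bb y)[V [BV Vy] VA].
  by have [k _ WkV] := BW _ BV; exists k; rewrite WkV.
have sgo (A : set Y) : open A -> <<s @open Y >> A by apply: sub_sigma_algebra.
have sgc (A : set Y) : closed A -> <<s @open Y >> A.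
  by move=> /closed_openC/sgo/sigma_algebraC; rewrite setCK.
have sg0 : <<s @open Y >> set0 by exact: sigma_algebra0.
exists W; split => //.
- move=> y z H; apply: hY => A C nA nC.
  have [k [Wky WkA]] := Wbasis _ _ nA.
  have /(_ (ex_intro2 _ _ k I erefl)) := H (W k); move=> [/(_ Wky) Wkz _].
  by exists z; split; [exact: WkA|exact: nbhs_singleton].
- split; first by move=> _ [k _ <-].
  move=> y A nA; have [k [Wky WkA]] := Wbasis _ _ nA.
  by exists (W k) => //; split => //; exists k.
pose sm k i := exists z, W i `<=` ball z (k.+1%:R^-1 : R).
pose dec c := odflt (0, 0)%N (@unpickle (nat * nat)%type c).
pose Q1 k i := if `[< sm k i >] then W i else set0.
(* Index 0 is the complement of [W k]; the other indices give closures lying inside [W k], which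
   cover it by regularity. All are closed, hence contain the limit of a branch running through
   them. *)
pose Q2 k j := if j is j'.+1 then
  (if `[< closure (W j') `<=` W k >] then closure (W j') else set0) else ~` W k.
have cQ2 k j : closed (Q2 k j).
  rewrite /Q2; case: j => [|j]; first exact: open_closedC.
  by case: asboolP => _; [exact: closed_closure|exact: closed0].
exists (fun k c => Q1 k (dec c).1 `&` Q2 k (dec c).2); split.
- move=> k y.
  have [i [Wiy Wib]] : exists i, W i y /\ W i `<=` ball y (k.+1%:R^-1 : R).
    by apply: Wbasis; exact: nbhsx_ballx.
  have Q1y : Q1 k i y by rewrite /Q1; case: asboolP => // -[]; exists y.
  have [j Q2y] : exists j, Q2 k j y.
    have [Wky|] := pselect (W k y); last by exists 0%N.
    have [C nC CW] := @uniform_regular Y y _ (open_nbhs_nbhs (conj (Wo k) Wky)).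
    have [j [Wjy WjC]] := Wbasis _ _ nC.
    exists j.+1; rewrite /Q2; case: asboolP => [_|]; first exact: subset_closure.
    by case; apply: subset_trans CW; exact: closureS.
  by exists (pickle (i, j)); rewrite /dec pickleK.
- move=> k c; rewrite -[X in <<s _ >> X]setCK setCI; apply: sigma_algebraC.
  rewrite -bigcup2E; apply: sigma_algebra_bigcup => -[|[|n]] /=; last exact: sg0.
    by apply: sigma_algebraC; rewrite /Q1; case: asboolP => _; [exact: sgo|].
  by apply: sigma_algebraC; exact: sgc.
set Q := (Q in resolves Q _) => a ane.
pose F := filter_from [set: nat] (fun n => cell Q (mkseq a n)).
have FF : ProperFilter F.
  apply: filter_from_proper; last by move=> n _; exact: ane.
  apply: filter_from_filter; first by exists 0%N.
  move=> m n _ _; exists (maxn m n) => // z Hz.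
  by split; apply: cell_le Hz; rewrite ?leq_maxl ?leq_maxr.
have FQ k : F (Q1 k (dec (a k)).1 `&` Q2 k (dec (a k)).2).
  by exists k.+1 => // z /cell_mkseq; apply.
have /cauchy_exP/cauchy_cvg Fcvg : cauchy_ex F.
  move=> e e0; pose k := Num.truncn (e^-1).
  have ke : (k.+1%:R^-1 : R) <= e.
    rewrite -[leRHS]invrK lef_pV2 ?posrE ?invr_gt0//.
    by rewrite ltW// truncnS_gt.
  have [z zP] : sm k (dec (a k)).1.
    have [z [+ _]] := filter_ex (FQ k).
    by rewrite /Q1; case: asboolP.
  exists z; apply: (filterS _ (FQ k)) => y [+ _]; rewrite /Q1.
  by case: asboolP => // _ /zP; exact: le_ball.
have Fc (K : set Y) : closed K -> F K -> K (lim F).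
  move=> cK FK; apply: cK => A /Fcvg FA.
  by have [z [Kz Az]] := filter_ex (filterI FK FA); exists z.
exists (lim F) => _ [k _ <-]; exists k.+1 => y /cell_mkseq/(_ k (ltnSn k))[_ Qy].
have : F (Q2 k (dec (a k)).2) by apply: (filterS _ (FQ k)) => z [].
move=> /(Fc _ (cQ2 _ _)); move: Qy; rewrite /Q2.
case: (dec (a k)).2 => [|j]; first by move=> nWy nWl; split.
by case: asboolP => // jk Wy Wl; split => _; exact: jk.
Qed.

End Polish.

Theorem standard_borel_base (R : realType) d (T : measurableType d) :
  standard_borel R T -> exists W : nat -> set T, resolving_base W.
Proof.
move=> [Y [f [hY sY [g fK gK] mf]]].
have [W [Wo sepW [_ Wb] [Q [cQ mQ rQ]]]] := complete_resolving hY sY.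
have imf A : f @` (f @^-1` A) = A.
  by apply/seteqP; split => [_ [x Ax <-]//|y Ay]; exists (g y); rewrite /= gK.
have pif A : f @^-1` (f @` A) = A.
  apply/seteqP; split => [x [y Ay /(can_inj fK) <-]//|x Ax]; by exists x.
have mpre A : <<s @open Y >> A -> measurable (f @^-1` A).
  by move=> sA; apply/mf; rewrite imf.
have cellf s z : cell (fun k i => f @^-1` Q k i) s z <-> cell Q s (f z) by [].
exists (fun k => f @^-1` W k); split.
- move=> y z H; apply: (can_inj fK); apply: sepW => _ [k _ <-].
  by apply: (H (f @^-1` W k)); exists k.
- by move=> k; apply: mpre; exact: sub_sigma_algebra.
- exists (fun k i => f @^-1` Q k i); split => [k z|k i|a ane].
  + by have [i ?] := cQ k (f z); exists i.
  + exact: mpre.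
  + have [|z zP] := rQ a; first by move=> n; have [y ?] := ane n; exists (f y).
    exists (g z) => _ [k _ <-]; have [|n nP] := zP (W k); first by exists k.
    by exists n => y /nP; rewrite /= gK.
move=> A /mf; rewrite -{2}[A]pif.
have sW : <<s @open Y >> `<=` [set B | <<s range (fun k => f @^-1` W k) >> (f @^-1` B)].
  apply: smallest_sub; last first.
    move=> U oU.
    have -> : U = \bigcup_k (if `[< W k `<=` U >] then W k else set0).
      apply/seteqP; split => [y Uy|y [k _]]; last by case: asboolP => // kU /kU.
      have [V [[k _ <-] Wky] kU] := Wb y U (open_nbhs_nbhs (conj oU Uy)).
      by exists k => //; case: asboolP.
    rewrite /= preimage_bigcup; apply: sigma_algebra_bigcup => k.
    case: asboolP => _; last by rewrite preimage_set0; exact: sigma_algebra0.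
    by apply: sub_sigma_algebra; exists k.
  split => [|B sB|B sB] /=.
  - by rewrite preimage_set0; exact: sigma_algebra0.
  - by rewrite setTD; exact: sigma_algebraC.
  - by rewrite preimage_bigcup; exact: sigma_algebra_bigcup.
exact: sW.
Qed.

(** * Lusin-Novikov and Lusin-Souslin theorems *)

Section Souslin.
Context d (G : measurableType d) (U : nat -> set G).
Context (sepU : separating (range U)) (mU : forall k, measurable (U k)).
Context (resU : forall E : nat -> set G, (forall m, measurable (E m)) ->
  resolvable (range U `|` range E)).

(* [A] is the result of the Souslin operation along a tree of pieces whose
   branches converge inside [A] for the topology generated by the [U k]. *)
Definition souslin (A : set G) := exists P : seq nat -> set G,
  [/\ P [::] = A,
      forall s z, P s z <-> exists i, P (rcons s i) z &
      forall a : nat -> nat, (forall n, P (mkseq a n) !=set0) ->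
        exists2 z, A z & forall k, exists n, forall y, P (mkseq a n) y ->
          (U k y <-> U k z)].

Lemma piece_le (P : seq nat -> set G) a m n z :
  (forall s z, P s z <-> exists i, P (rcons s i) z) -> (m <= n)%N ->
  P (mkseq a n) z -> P (mkseq a m) z.
Proof.
move=> Pc; apply: (@mkseq_mono _ (P^~ z)) => s i Pi.
by apply/Pc; exists i.
Qed.

(** [resU] is applied with [D] itself adjoined: the limit of a branch then belongs to [D] because
    the cells of the branch meet [D]. *)
Lemma souslin_measurable D : measurable D -> souslin D.
Proof.
move=> mD; have [Q [cQ mQ rQ]] := resU (fun=> mD).
exists (fun s => D `&` cell Q s); split.
- by apply/seteqP; split => z // [].
- move=> s z; split=> [[Dz Qz]|[i [Dz /cell_rcons[Qz _]]]//].
  by have [i Qi] := cQ (size s) z; exists i; split => //; apply/cell_rcons.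
move=> a ane; have [|z zP] := rQ a.
  by move=> n; have [y [_ ?]] := ane n; exists y.
exists z.
  have [|n nP] := zP D; first by right; exists 0%N.
  by have [y [Dy Qy]] := ane n; exact/(nP _ Qy).
move=> k; have [|n nP] := zP (U k); first by left; exists k.
by exists n => y [_ /nP].
Qed.

(** The hypothesis on [f] is continuity for the topology generated by the [U k], so [f] carries
    limits of branches to limits of branches. *)
Lemma souslin_image f A : (forall k, range U (f @^-1` U k)) ->
  souslin A -> souslin (f @` A).
Proof.
move=> fU [P [P0 Pc Pl]]; exists (fun s => f @` P s); split; first by rewrite P0.
- move=> s z; split => [[y /Pc[i Py] <-]|[i [y Py <-]]].
    by exists i; exists y.
  by exists y => //; apply/Pc; exists i.
move=> a ane; have [|z Az zP] := Pl a.
  by move=> n; have [_ [y ? _]] := ane n; exists y.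
exists (f z); first by exists z.
move=> k; have [j _ jk] := fU k; have [n nP] := zP j.
exists n => _ [y /nP yP <-]; move: yP; rewrite jk; exact.
Qed.

(** A branch encodes one branch for [A] and one for [A']. Continuity of [f] shows that the limit of
    the second is the image of the limit of the first, since no [U k] separates them. *)
Lemma souslin_preimage f A A' : (forall k, range U (f @^-1` U k)) ->
  souslin A -> souslin A' -> souslin (A `&` f @^-1` A').
Proof.
move=> fU [P [P0 Pc Pl]] [P' [P'0 P'c P'l]].
pose dec c := odflt (0, 0)%N (@unpickle (nat * nat)%type c).
have decK p : dec (pickle p) = p by rewrite /dec pickleK.
pose fs s := [seq (dec c).1 | c <- s]; pose sn s := [seq (dec c).2 | c <- s].
exists (fun s => P (fs s) `&` f @^-1` P' (sn s)); split; first by rewrite P0 P'0.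
- move=> s z; split.
    move=> [/Pc[i Pi] /P'c[j P'j]]; exists (pickle (i, j)).
    by rewrite /fs /sn !map_rcons decK.
  move=> [c]; rewrite /fs /sn !map_rcons => -[Pi P'j].
  by split; [apply/Pc|apply/P'c]; eexists; eassumption.
move=> a ane.
have fsa n : fs (mkseq a n) = mkseq (fun k => (dec (a k)).1) n.
  by rewrite /fs /mkseq -map_comp.
have sna n : sn (mkseq a n) = mkseq (fun k => (dec (a k)).2) n.
  by rewrite /sn /mkseq -map_comp.
have [|z Az zP] := Pl (fun k => (dec (a k)).1).
  by move=> n; rewrite -fsa; have [y []] := ane n; exists y.
have [|z' Az' z'P] := P'l (fun k => (dec (a k)).2).
  by move=> n; rewrite -sna; have [y []] := ane n; exists (f y).
have fzz' : f z = z'.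
  apply: sepU => _ [k _ <-]; have [j _ jk] := fU k.
  have [n nP] := zP j; have [n' n'P] := z'P k.
  have [y [+ +]] := ane (maxn n n'); rewrite fsa sna => Py P'y.
  have /nP : P (mkseq (fun k => (dec (a k)).1) n) y.
    by apply: piece_le Py => //; exact: leq_maxl.
  have /n'P : P' (mkseq (fun k => (dec (a k)).2) n') (f y).
    by apply: piece_le P'y => //; exact: leq_maxr.
  by rewrite jk => <- /= ->.
exists z; first by split => //=; rewrite fzz'.
by move=> k; have [n nP] := zP k; exists n => y []; rewrite fsa => /nP.
Qed.

Lemma range_id k : range U (id @^-1` U k). Proof. by exists k. Qed.

Lemma souslinI A A' : souslin A -> souslin A' -> souslin (A `&` A').
Proof. exact: (souslin_preimage range_id). Qed.

Lemma souslin_bigcup (A : nat -> set G) : (forall i, souslin (A i)) ->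
  souslin (\bigcup_i A i).
Proof.
move=> /(_ _)/cid-/all_tag[P /all_and3[P0 Pc Pl]].
exists (fun s => if s is i :: s' then P i s' else \bigcup_i A i); split => //.
- move=> [|i s] z /=; last exact: Pc.
  by split=> [[i _ Az]|[i Az]]; exists i => //; move: Az; rewrite P0.
move=> a ane.
have aS n : mkseq a n.+1 = a 0%N :: mkseq (fun k => a k.+1) n.
  by rewrite /mkseq /= -[1%N]addn0 iotaDl -map_comp.
have [|z Az zP] := Pl (a 0%N) (fun k => a k.+1).
  by move=> n; have := ane n.+1; rewrite aS.
exists z; first by exists (a 0%N).
by move=> k; have [n nP] := zP k; exists n.+1; rewrite aS.
Qed.

(* Lusin's separation theorem: were [A] and [A'] inseparable, so would be their
   pieces along two branches, whose limits are distinct and hence separated by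
   some [U k]. *)
Theorem souslin_separation A A' : souslin A -> souslin A' -> A `&` A' = set0 ->
  exists B, [/\ measurable B, A `<=` B & A' `<=` ~` B].
Proof.
move=> [P [P0 Pc Pl]] [P' [P'0 P'c P'l]] AA'.
pose sep A A' := exists B : set G, [/\ measurable B, A `<=` B & A' `<=` ~` B].
change (sep A A'); apply: contrapT => nsep.
pose nse (s : seq (nat * nat)) := ~ sep (P (map fst s)) (P' (map snd s)).
have [|s ns|a aP] := @branch _ nse; first by rewrite /nse /= P0 P'0.
  apply: contrapT => /forallNP H; apply: ns.
  have H' ij : sep (P (rcons (map fst s) ij.1)) (P' (rcons (map snd s) ij.2)).
    by have /contrapT := H ij; rewrite !map_rcons.
  have [B BP] := choice H'.
  (* If every pair of subpieces could be separated, this combination of the separating sets would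
     separate the two unions. *)
  exists (\bigcup_i \bigcap_j B (i, j)); split.
  - apply: bigcup_measurable => i _; apply: bigcapT_measurable => j.
    by have [] := BP (i, j).
  - move=> z /Pc[i Pz]; exists i => // j _.
    by have [_ + _] := BP (i, j); exact.
  - move=> z /P'c[j P'z] [i _ /(_ j I)].
    by have [_ _ + Bz] := BP (i, j) => /(_ z P'z); exact.
have fsta n : map fst (mkseq a n) = mkseq (fun k => (a k).1) n.
  by rewrite /mkseq -map_comp.
have snda n : map snd (mkseq a n) = mkseq (fun k => (a k).2) n.
  by rewrite /mkseq -map_comp.
have [n|z Az zP] := Pl (fun k => (a k).1).
  apply: contrapT => H; apply: (aP n); rewrite fsta.
  exists set0; split => // z Pz; first by apply: H; exists z.
  by rewrite setC0.
have [n|z' Az' z'P] := P'l (fun k => (a k).2).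
  apply: contrapT => H; apply: (aP n); rewrite snda.
  by exists setT; split => // y Py _; apply: H; exists y.
have zz' : z = z'.
  apply: sepU => _ [k _ <-]; apply: contrapT => kz.
  have [n nP] := zP k; have [n' n'P] := z'P k.
  apply: (aP (maxn n n')); rewrite fsta snda.
  have zU y : P (mkseq (fun k => (a k).1) (maxn n n')) y -> (U k y <-> U k z).
    move=> Py; by apply: nP; apply: piece_le Py => //; exact: leq_maxl.
  have z'U y : P' (mkseq (fun k => (a k).2) (maxn n n')) y -> (U k y <-> U k z').
    move=> Py; by apply: n'P; apply: piece_le Py => //; exact: leq_maxr.
  have [Uz|nUz] := pselect (U k z).
    exists (U k); split => // y; first by move/zU => [_]; exact.
    by move/z'U => yz' Uy; apply: kz; split => // _; apply/yz'.
  exists (~` U k); split; first exact: measurableC.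
    by move=> y /zU[yz _] /yz.
  move=> y /z'U yz'; rewrite setCK; apply: contrapT => nUy; apply: kz.
  by split=> // /yz'.
have : (A `&` A') z by split => //; rewrite zz'.
by rewrite AA'.
Qed.

(* Two successive separations turn injectivity on [A] into injectivity on a
   Borel set containing [A]. *)
Lemma souslin_injective_hull f A : (forall k, range U (f @^-1` U k)) ->
  souslin A -> {in A &, injective f} ->
  exists B, [/\ measurable B, A `<=` B & {in B &, injective f}].
Proof.
move=> fU sA fA.
(* [tw D] collects the points sharing their image with a different point of [D]; [f] is injective on
   [D] exactly when [D] and [tw D] are disjoint. *)
pose tw D := [set g | exists a, [/\ D a, f a = f g & a <> g]].
have twE D : tw D = \bigcup_k ((~` U k `&` f @^-1` (f @` (D `&` U k))) `|`
                               (U k `&` f @^-1` (f @` (D `&` ~` U k)))).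
  apply/seteqP; split => [g [a [Da fag ag]]|g [k _ [[nUg]|[Ug]] [a [Da Ua] fag]]].
  - have [k kag] : exists k, ~ (U k a <-> U k g).
      apply/existsNP => H; apply: ag; apply: sepU => _ [k _ <-]; exact: H.
    exists k => //; have [Ua|nUa] := pselect (U k a).
      left; split; last by exists a.
      by move=> Ug; apply: kag.
    right; split; last by exists a.
    by apply: contrapT => nUg; apply: kag.
  - by exists a; split => // ag; apply: nUg; rewrite -ag.
  - by exists a; split => // ag; apply: Ua; rewrite ag.
have stw D : souslin D -> souslin (tw D).
  move=> sD; rewrite twE; apply: souslin_bigcup => k.
  pose H b := if b is 0%N then ~` U k `&` f @^-1` (f @` (D `&` U k))
    else (U k `&` f @^-1` (f @` (D `&` ~` U k))).
  have -> : (~` U k `&` f @^-1` (f @` (D `&` U k))) `|`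
            (U k `&` f @^-1` (f @` (D `&` ~` U k))) = \bigcup_i H i.
    apply/seteqP; split => [g [Hg|Hg]|g [[|i] _ Hg]]; [|exists 1%N|left|right] => //.
    by exists 0%N.
  have sU := souslin_measurable (mU k).
  have sUC := souslin_measurable (measurableC (mU k)).
  by apply: souslin_bigcup => -[|i] /=; apply: souslin_preimage => //;
    apply: souslin_image => //; exact: souslinI.
have [|B0 [mB0 AB0 B0A]] := souslin_separation sA (stw _ sA).
  apply/seteqP; split => // g [Ag [a [Aa fag]]]; apply.
  by apply: fA => //; exact/mem_set.
have [|B1 [mB1 AB1 B1A]] := souslin_separation sA (stw _ (souslin_measurable mB0)).
  apply/seteqP; split => // g [Ag [b [Bb fbg bg]]]; apply: (B0A b) => //.
  by exists g; split => // gb; exact: bg.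
exists (B0 `&` B1); split; first exact: measurableI.
  by move=> g Ag; split; [exact: AB0|exact: AB1].
move=> b b'; rewrite !inE => -[B0b _] [B0b' B1b'] fbb'.
by apply: contrapT => bb'; apply: (B1A b') => //; exists b.
Qed.

End Souslin.

(** Cantor's diagonal argument on the codes [e (h s)]. *)
Lemma uncountable_cantor (T : Type) (A : set T) (h : (nat -> bool) -> T) :
  injective h -> (forall s, A (h s)) -> ~ countable A.
Proof.
move=> hinj hA /countable_injP[e einj].
have hI s t : e (h s) = e (h t) -> s = t.
  by move=> /einj; rewrite !inE => /(_ (hA s) (hA t)) /hinj.
pose D n := ~~ `[< exists2 s, e (h s) = n & s n >].
have nD : ~ D (e (h D)).
  by move=> Dk; move: (Dk) => /negP; apply; apply/asboolP; exists D.
by apply: (nD); apply/negP => /asboolP[s /hI ->].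
Qed.

Lemma In_cat (T : Type) (x : T) s1 s2 :
  List.In x (s1 ++ s2) <-> List.In x s1 \/ List.In x s2.
Proof. by elim: s1 => [|y s1 IH] /=; [tauto|rewrite IH; tauto]. Qed.

Section LusinNovikov.
Context d (G : measurableType d) (U : nat -> set G).
Context (sepU : separating (range U)) (mU : forall k, measurable (U k)).
Context (resU : forall E : nat -> set G, (forall m, measurable (E m)) ->
  resolvable (range U `|` range E)).
Context (f : G -> G) (fU : forall k, range U (f @^-1` U k)).

Definition borel_section (B : set G) := measurable B /\ {in B &, injective f}.

(** The notion of smallness for the splitting argument: such sets are stable under countable unions,
    and the goal is that the whole space is one of them. *)
Definition sigma_section (B : set G) := exists Bn : nat -> set G,
  (forall n, borel_section (Bn n)) /\ B = \bigcup_n Bn n.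

Lemma sigma_section_measurable B : sigma_section B -> measurable B.
Proof. by move=> [Bn [sB ->]]; apply: bigcup_measurable => n _; case: (sB n). Qed.

Lemma sigma_section1 B : borel_section B -> sigma_section B.
Proof.
move=> sB; exists (fun=> B); split => //.
by apply/seteqP; split => [z Bz|z [_ _]//]; exists 0%N.
Qed.

Lemma sigma_section_bigcup (B : nat -> set G) :
  (forall i, sigma_section (B i)) -> sigma_section (\bigcup_i B i).
Proof.
move=> /(_ _)/cid-/all_tag[Bn /all_and2[sB BE]].
pose dec c := odflt (0, 0)%N (@unpickle (nat * nat)%type c).
exists (fun c => Bn (dec c).1 (dec c).2); split => [c|]; first exact: sB.
apply/seteqP; split => [z [i _]|z [c _ Bz]].
  rewrite BE => -[n _ Bz]; exists (pickle (i, n)) => //.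
  by rewrite /dec pickleK.
by exists (dec c).1 => //; rewrite BE; exists (dec c).2.
Qed.

Lemma sigma_sectionU B B' : sigma_section B -> sigma_section B' ->
  sigma_section (B `|` B').
Proof.
move=> sB sB'; rewrite -bigcup2E; apply: sigma_section_bigcup => -[|[|i]] //=.
by apply: sigma_section1; split => // x y; rewrite inE.
Qed.

(* A family is large if some fiber of [f] meets all of its members outside any
   given countable union of sections. *)
Definition large (L : seq (set G)) := forall B, sigma_section B ->
  exists x, forall E, List.In E L -> exists c, [/\ E c, ~ B c & f c = x].

Lemma large_perm L L' : (forall E, List.In E L' -> List.In E L) ->
  large L -> large L'.
Proof. by move=> LL' lL B /lL[x xP]; exists x => E /LL'/xP. Qed.

(** If every choice of [i] failed, each failure would come with a [sigma_section], and the union of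
    these would contradict the largeness of the original family. *)
Lemma large_refine E0 L (H : nat -> set G) : (forall z, E0 z -> exists i, H i z) ->
  large (E0 :: L) -> exists i, large ((E0 `&` H i) :: L).
Proof.
move=> E0H lL; apply: contrapT => /forallNP nl.
have /(_ _)/cid-/all_tag[B] : forall i, exists B, sigma_section B /\ ~ exists x,
    forall E, List.In E ((E0 `&` H i) :: L) -> exists c, [/\ E c, ~ B c & f c = x].
  by move=> i; have /existsNP[B /not_implyP] := nl i; exists B.
move=> /all_and2[sB nB]; have [x xP] := lL _ (sigma_section_bigcup sB).
have [c [E0c nBc fc]] := xP E0 (or_introl erefl).
have [i Hic] := E0H _ E0c; apply: (nB i); exists x => E [<-|LE].
  by exists c; split => // Bc; apply: nBc; exists i.
have [c' [Ec' nBc' fc']] := xP _ (or_intror LE).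
by exists c'; split => // Bc'; apply: nBc'; exists i.
Qed.

(** Suppose each [j] fails because of some [Bj j], with union [B]. Let [W] be the points of [E0]
    outside [B] whose fiber meets every other member outside [B]. Two points of [W] with equal
    images cannot be separated by any [U j], so [f] is injective on [W]; as [W] is Souslin, it lies
    in a Borel section, and adding this section to [B] contradicts largeness. *)
Lemma large_split E0 L : (forall E, List.In E (E0 :: L) -> measurable E) ->
  large (E0 :: L) -> exists j, large ((E0 `&` U j) :: (E0 `&` ~` U j) :: L).
Proof.
move=> mL lL; apply: contrapT => /forallNP nl.
have /(_ _)/cid-/all_tag[Bj] : forall j, exists B, sigma_section B /\ ~ exists x,
    forall E, List.In E ((E0 `&` U j) :: (E0 `&` ~` U j) :: L) ->
    exists c, [/\ E c, ~ B c & f c = x].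
  by move=> i; have /existsNP[B /not_implyP] := nl i; exists B.
move=> /all_and2[sB nB]; set B := \bigcup_i Bj i.
have sBB : sigma_section B := sigma_section_bigcup sB.
have mB := sigma_section_measurable sBB.
pose W := [set c | (E0 c /\ ~ B c) /\ forall E, List.In E L ->
   exists c', [/\ E c', ~ B c' & f c' = f c]].
have sW : souslin U W.
  have -> : W = (E0 `\` B) `&` f @^-1` [set x | forall E, List.In E L ->
     exists c', [/\ E c', ~ B c' & f c' = x]] by [].
  apply: souslin_preimage => //.
    apply: souslin_measurable => //; apply: measurableD => //.
    by apply: mL; left.
  have {nl lL nB} mL' : forall E, List.In E L -> measurable E.
    by move=> E LE; apply: mL; right.
  elim: L {mL W} mL' => [|E L IH] mL.
    apply: souslin_measurable => //; rewrite [X in measurable X](_ : _ = setT)//.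
    by apply/seteqP; split => // x _ E [].
  have -> : [set x | forall E', List.In E' (E :: L) ->
     exists c', [/\ E' c', ~ B c' & f c' = x]] =
     (f @` (E `\` B)) `&` [set x | forall E, List.In E L ->
     exists c', [/\ E c', ~ B c' & f c' = x]].
    apply/seteqP; split => [x H|x [[c [Ec nBc] fc] H] E' [<-|/H//]].
      split; last by move=> E' LE'; apply: H; right.
      by have [c [Ec nBc fc]] := H _ (or_introl erefl); exists c.
    by exists c.
  apply: souslinI => //; last by apply: IH => E' LE'; apply: mL; right.
  apply: souslin_image => //; apply: souslin_measurable => //.
  by apply: measurableD => //; apply: mL; left.
have Winj : {in W &, injective f}.
  suff H : forall c c' k, W c -> W c' -> f c = f c' -> U k c -> ~ U k c' -> False.
    move=> c c'; rewrite !inE => Wc Wc' cc'; apply: sepU => _ [k _ <-].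
    by split=> Uk; apply: contrapT => nUk; [apply: (H c c' k)|apply: (H c' c k)].
  move=> c c' k [[Ec nBc] Lc] [[Ec' nBc'] _] cc' Ukc nUkc'.
  have nBk z : ~ B z -> ~ Bj k z by move=> nBz Bz; apply: nBz; exists k.
  apply: (nB k); exists (f c) => E [<-|[<-|LE]].
  - by exists c; split => //; exact: nBk.
  - by exists c'; split => //; exact: nBk.
  - by have [z [Ez nBz fz]] := Lc _ LE; exists z; split => //; exact: nBk.
have [B' [mB' WB' B'inj]] := souslin_injective_hull sepU mU resU fU sW Winj.
have [x xP] := lL _ (sigma_sectionU sBB (sigma_section1 (conj mB' B'inj))).
have [c [Ec nBc fc]] := xP E0 (or_introl erefl).
apply: (nBc); right; apply: WB'; split; first by split => // Bc; apply: nBc; left.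
move=> E LE; have [c' [Ec' nBc' fc']] := xP _ (or_intror LE).
by exists c'; split => //; [move=> Bc'; apply: nBc'; left|rewrite fc' fc].
Qed.

(** One level of a Cantor scheme: the halves of the member at position [n] stand at positions [2n]
    and [2n+1], inside and outside some [U j], and each half lies in a single cell of [Q]. *)
Inductive splits (Q : nat -> set G) : seq (set G) -> seq (set G) -> Prop :=
| splits_nil : splits Q [::] [::]
| splits_cons E E0 E1 L L' i0 i1 j :
    E0 `<=` E `&` Q i0 `&` U j -> E1 `<=` E `&` Q i1 `&` ~` U j ->
    splits Q L L' -> splits Q (E :: L) (E0 :: E1 :: L').

(** Largeness is a joint property of the family, so the halves already produced are carried along in
    [L2] while the remaining members are split one by one. *)
Lemma large_splits (Q : nat -> set G) L1 L2 : (forall z, exists i, Q i z) ->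
  (forall i, measurable (Q i)) ->
  (forall E, List.In E (L1 ++ L2) -> measurable E) -> large (L1 ++ L2) ->
  exists L', [/\ splits Q L1 L',
    forall E, List.In E (L' ++ L2) -> measurable E & large (L' ++ L2)].
Proof.
move=> cQ mQ; elim: L1 L2 => [|E L1 IH] L2 mL lL.
  by exists [::]; split => //; exact: splits_nil.
have [j lj] := large_split mL lL.
have mE : measurable E by apply: mL; left.
have mL12 E' : List.In E' (L1 ++ L2) -> measurable E' by move=> ?; apply: mL; right.
have [//|i0 l0] := large_refine (H := Q) _ lj.
have /large_refine-/(_ Q (fun z _ => cQ z))[i1 l1] :
    large ((E `&` ~` U j) :: (E `&` U j `&` Q i0) :: L1 ++ L2).
  by apply: large_perm l0 => E' /=; tauto.
pose E0 := E `&` U j `&` Q i0; pose E1 := E `&` ~` U j `&` Q i1.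
have mE0 : measurable E0 by apply: measurableI => //; exact: measurableI.
have mE1 : measurable E1.
  by apply: measurableI => //; apply: measurableI => //; exact: measurableC.
have inP E' : List.In E' (L1 ++ [:: E0, E1 & L2]) <->
    [\/ E' = E0, E' = E1 | List.In E' (L1 ++ L2)].
  split=> [/In_cat[L1E|[E0E|[E1E|L2E]]]|[->|->|/In_cat[?|?]]].
  - by apply: Or33; apply/In_cat; left.
  - exact: Or31.
  - exact: Or32.
  - by apply: Or33; apply/In_cat; right.
  - by apply/In_cat; right; left.
  - by apply/In_cat; right; right; left.
  - by apply/In_cat; left.
  - by apply/In_cat; right; right; right.
have [||L' [sL' mL' lL']] := IH [:: E0, E1 & L2].
- by move=> E' /inP[->|->|/mL12].
- apply: large_perm l1 => E' /inP[->|->|?]; [right; left|left|right; right] => //.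
have inP' E' : List.In E' ([:: E0, E1 & L'] ++ L2) -> List.In E' (L' ++ [:: E0, E1 & L2]).
  by rewrite !In_cat /=; tauto.
exists [:: E0, E1 & L']; split.
- by apply: (splits_cons (i0 := i0) (i1 := i1) (j := j)) => // z [[]].
- by move=> E' /inP'/mL'.
- exact: large_perm lL'.
Qed.

Lemma splits_size Q L L' : splits Q L L' -> size L' = (size L).*2.
Proof. by elim=> //= E E0 E1 {}L {}L' _ _ _ _ _ _ ->; rewrite doubleS. Qed.

Lemma splits_nth Q L L' n (b : bool) : splits Q L L' -> (n < size L)%N ->
  exists i j, nth set0 L' (b + n.*2) `<=` nth set0 L n `&` Q i /\
   forall b' : bool, nth set0 L' (b' + n.*2) `<=` (if b' then ~` U j else U j).
Proof.
move=> sL; elim: sL n => //= E E0 E1 {}L {}L' i0 i1 j s0 s1 sL IH [|n] /= nL.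
  exists (if b then i1 else i0), j; split.
    by clear IH; case: b => //= z; [move=> /s1[]|move=> /s0[]].
  by case=> /= z; [move=> /s1[]|move=> /s0[]].
by have [i' [j' [H1 H2]]] := IH n nL; exists i', j';
  rewrite doubleS !addnS /=; split => // b'; rewrite !addnS /=; exact: H2.
Qed.

(* Lusin-Novikov: otherwise [setT] is large, and repeatedly splitting a large
   family yields a Cantor scheme all of whose branches converge in one fiber. *)
Theorem lusin_novikov : (forall x, countable (f @^-1` [set x])) ->
  sigma_section setT.
Proof.
move=> cf; apply: contrapT => nT.
have l0 : large [:: setT].
  move=> B sB; apply: contrapT => /forallNP nx; apply: nT.
  suff <- : B = setT by [].
  apply/seteqP; split => // z _; apply: contrapT => nBz; apply: (nx (f z)).
  by move=> E [<-|//]; exists z.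
have [Q [cQ mQ rQ]] := resU (fun=> measurableT).
pose ok (L : seq (set G)) := (forall E, List.In E L -> measurable E) /\ large L.
have step n (L : seq (set G)) : exists L', ok L -> ok L' /\ splits (Q n) L L'.
  have [[mL lL]|nok] := pselect (ok L); last by exists L.
  have := @large_splits (Q n) L [::] (cQ n) (mQ n).
  rewrite {1 2}cats0 => /(_ mL lL)[L' []]; rewrite !cats0 => sL mL' lL'.
  by exists L'.
have [g gP] := choice (fun nL => step nL.1 nL.2).
pose Ln := fix Ln n := if n is n'.+1 then g (n', Ln n') else [:: setT].
have okL n : ok (Ln n).
  elim: n => [|n IH] /=; first by split => // E [<-|//]; exact: measurableT.
  by have [] := gP (n, Ln n) IH.
have sL n : splits (Q n) (Ln n) (Ln n.+1) by have [] := gP (n, Ln n) (okL n).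
have szL n : size (Ln n) = (2 ^ n)%N.
  by elim: n => // n IH; rewrite (splits_size (sL n)) IH expnS mul2n.
(* The position in [Ln n] of the node reached along [s]; the latest bit is the lowest binary
   digit. *)
pose ix := fix ix (s : nat -> bool) n : nat :=
  if n is n'.+1 then (s n' + (ix s n').*2)%N else 0%N.
have ixlt s n : (ix s n < size (Ln n))%N.
  rewrite szL; elim: n => //= n IH; rewrite expnS mul2n.
  by case: (s n); rewrite ?add0n ?ltn_double// add1n ltn_Sdouble.
pose E s n := nth set0 (Ln n) (ix s n).
have ES s n : exists i, E s n.+1 `<=` E s n `&` Q n i.
  by have [i [j []]] := splits_nth (s n) (sL n) (ixlt s n); exists i.
have /choice[a aP] : forall s, exists a : nat -> nat,
    forall n, E s n.+1 `<=` E s n `&` Q n (a n).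
  by move=> s; have [a aP] := choice (ES s); exists a.
have Ele s m n : (m <= n)%N -> E s n `<=` E s m.
  move=> /subnK <-; elim: (n - m)%N => // k IH z; rewrite addSn.
  by move=> /aP[/IH].
have Ecell s n : E s n `<=` cell Q (mkseq (a s) n).
  by move=> z Ez; apply/cell_mkseq => k kn; have /aP[] := Ele s k.+1 n kn _ Ez.
(* Largeness is used with the empty [sigma_section]: some fiber meets all members of level [n] at
   once. *)
have common n : exists x, forall s, exists2 c, E s n c & f c = x.
  have /(_ set0)[|x xP] := (okL n).2.
    by apply: sigma_section1; split => // x y; rewrite inE.
  exists x => s; have [|c [Ec _ fc]] := xP (E s n); last by exists c.
  have := ixlt s n; rewrite /E.
  by elim: (Ln n) (ix s n) => // D L IH [|m] /=; [left|rewrite ltnS => /IH; right].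
have lim s : exists z, forall k, exists n, forall y, E s n y -> (U k y <-> U k z).
  have [n|z zP] := rQ (a s).
    by have [x /(_ s)[c /Ecell]] := common n; exists c.
  exists z => k; have [|n nP] := zP (U k); first by left; exists k.
  by exists n => y /Ecell/nP.
have {lim}[h hP] := choice lim.
have fh s t : f (h s) = f (h t).
  apply: sepU => _ [k _ <-]; have [j _ jk] := fU k.
  have [n nP] := hP s j; have [n' n'P] := hP t j.
  have [x xP] := common (maxn n n').
  have [[c /(Ele _ _ _ (leq_maxl _ _))/nP cs cx] [c' /(Ele _ _ _ (leq_maxr _ _))/n'P ct c'x]] :=
    (xP s, xP t).
  by move: cs ct; rewrite jk /= cx c'x => <- <-.
(* The set [U j] that split the node at position [i] reads off the next bit of [s] from the limit
   [h s]; hence distinct sequences have distinct limits. *)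
have bits n i : (i < 2 ^ n)%N -> exists j, forall s, ix s n = i ->
    (U j (h s) <-> ~~ s n).
  rewrite -szL => /(splits_nth false (sL n))[_ [j [_ jP]]]; exists j => s si.
  have [m mP] := hP s j; have [x /(_ s)[c Ec _]] := common (maxn m n.+1).
  have <- := mP c (Ele _ _ _ (leq_maxl _ _) _ Ec).
  have := Ele _ _ _ (leq_maxr _ _) _ Ec; rewrite /E /= si => /jP.
  by case: (s n).
have hinj : injective h.
  move=> s t st; have H n : ix s n = ix t n -> s n = t n.
    move=> ist; have [|j jP] := bits n (ix s n); first by rewrite -szL.
    have := jP s erefl; have := jP t (esym ist); rewrite st.
    by case: (s n); case: (t n) => // -[H1 H2] [H3 H4]; [have := H3 (H2 isT)|have := H1 (H4 isT)].
  have ixE n : ix s n = ix t n.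
    by elim: n => //= n IH; rewrite (H _ IH) IH.
  by apply/funext => n; exact: H.
have := cf (f (h (fun=> true))); apply: (uncountable_cantor hinj) => s.
exact: fh.
Qed.

(* Lusin-Souslin: the image is recovered as the intersection over [n] of Borel
   sets separating the images of the disjoint cells of depth [n]. *)
Theorem lusin_souslin D : measurable D -> {in D &, injective f} ->
  measurable (f @` D).
Proof.
move=> mD finj.
have [Q0 [cQ0 mQ0 rQ0]] := resU (fun=> mD).
(* Disjoint covers, so that injectivity makes the images of distinct cells of one depth disjoint and
   Lusin's separation applies to them. *)
pose Q k i := Q0 k i `\` \bigcup_(j < i) Q0 k j.
have mQ k i : measurable (Q k i).
  by apply: measurableD => //; apply: fin_bigcup_measurable.
have QQ0 k i : Q k i `<=` Q0 k i by move=> z [].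
have cQ : covers Q.
  move=> k z; have ex : exists i, `[< Q0 k i z >].
    by have [i ?] := cQ0 k z; exists i; apply/asboolP.
  exists (ex_minn ex); case: ex_minnP => i /asboolP Qi imin; split => //.
  by move=> [j /= ji /asboolP/imin]; rewrite leqNgt ji.
have Qdisj k i j z : Q k i z -> Q k j z -> i = j.
  move=> [Qi nQi] [Qj nQj]; have [ij|ji|//] := ltngtP i j.
    by exfalso; apply: nQj; exact: (ex_intro2 _ _ i ij Qi).
  by exfalso; apply: nQi; exact: (ex_intro2 _ _ j ji Qj).
have cell_uniq s t z : size s = size t -> cell Q s z -> cell Q t z -> s = t.
  move=> st cs ct; apply: (@eq_from_nth _ 0%N) => // k ks.
  by apply: Qdisj (cs k ks) (ct k _); rewrite -st.
have mcell s : measurable (cell Q s).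
  have -> : cell Q s = \bigcap_(k < size s) Q k (nth 0%N s k) by [].
  exact: fin_bigcap_measurable.
pose A s := f @` (D `&` cell Q s).
have sA s : souslin U (A s).
  by apply: souslin_image => //; apply: souslin_measurable => //; exact: measurableI.
have Adisj s t y : size s = size t -> A s y -> A t y -> s = t.
  move=> st [z [Dz zs] <-] [z' [Dz' z't] fzz'].
  have zz' : z' = z by apply: finj => //; exact/mem_set.
  by apply: cell_uniq st zs _; rewrite -zz'.
have sepA s t : exists B, [/\ measurable B, A s `<=` B &
    (size s = size t -> s <> t -> A t `<=` ~` B)].
  have [[st nst]|H] := pselect (size s = size t /\ s <> t).
    have [|B [mB AB BA]] := souslin_separation sepU mU (sA s) (sA t).
      by apply/seteqP; split => // y [ys yt]; apply: nst; exact: Adisj ys yt.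
    by exists B.
  by exists setT; split => // st nst; exfalso; apply: H.
have [S SP] := choice (fun st => sepA st.1 st.2).
(* Cutting by [hull] forces a point lying in the Borel sets of all depths to agree with the limit of
   the branch on every [U k]. *)
pose hull s k := if `[< A s `<=` U k >] then U k else
  if `[< A s `<=` ~` U k >] then ~` U k else setT.
have hullP s k : A s `<=` hull s k.
  by rewrite /hull; case: asboolP => // _; case: asboolP.
pose dec c := odflt [::] (@unpickle (seq nat) c).
have decK t : dec (pickle t) = t by rewrite /dec pickleK.
(* The separation of [A s] from [A t] is used in both directions, which makes the sets [B s] of a
   given depth pairwise disjoint. *)
pose piece s c := S (s, dec c) `&` (if `[< size (dec c) = size s /\ dec c <> s >]
  then ~` S (dec c, s) else setT) `&` hull s c.
(* Empty when [A s] is empty, so that a branch along which all [B s] contain a point has nonempty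
   cells and converges. *)
pose B s := if `[< A s !=set0 >] then \bigcap_c piece s c else set0.
have mS st : measurable (S st) by have [] := SP st.
have mB s : measurable (B s).
  rewrite /B; case: asboolP => // _; apply: bigcapT_measurable => c.
  apply: measurableI; first apply: measurableI => //.
    by case: asboolP => // _; exact: measurableC.
  rewrite /hull; case: asboolP => // _; case: asboolP => // _; exact: measurableC.
have AB s : A s `<=` B s.
  move=> y Ay; rewrite /B; case: asboolP => [_|[]]; last by exists y.
  move=> c _; split; last exact: hullP.
  split; first by have [_ H _] := SP (s, dec c); exact: H.
  case: asboolP => // -[ts nts]; have [_ _ /(_ ts nts)] := SP (dec c, s).
  exact.
have Bdisj s t y : size s = size t -> B s y -> B t y -> s = t.
  rewrite /B; case: asboolP => // _; case: asboolP => // _ st sy ty.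
  apply: contrapT => nst.
  have [[Ssy _] _] := sy (pickle t) I; have [[_ +] _] := ty (pickle s) I.
  by rewrite decK in Ssy; rewrite decK; case: asboolP => [_ /(_ Ssy)//|[]//].
(* Intersecting over prefixes makes the sequences found at different depths cohere into one branch,
   by disjointness. *)
pose Bo s := \bigcap_(k < (size s).+1) B (take k s).
have mBo s : measurable (Bo s) by exact: fin_bigcap_measurable.
have ABo s : A s `<=` Bo s.
  move=> y [z [Dz zs] fz] k ks; apply: AB; exists z => //; split => // j.
  rewrite size_takel// => jk; rewrite nth_take//; apply: zs.
  exact: leq_trans jk _.
have -> : f @` D = \bigcap_n \bigcup_c (if size (dec c) == n then Bo (dec c) else set0).
  apply/seteqP; split => [_ [z Dz <-] n _|y yP].
    have [a aP] := choice (cQ^~ z).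
    exists (pickle (mkseq a n)) => //; rewrite decK size_mkseq eqxx; apply: ABo.
    by exists z => //; split => //; apply/cell_mkseq => k _; exact: aP.
  have /choice[s sP] : forall n, exists s, size s = n /\ Bo s y.
    by move=> n; have [c _] := yP n I; case: eqP => // szc Boy; exists (dec c).
  pose a n := nth 0%N (s n.+1) n.
  have sE n : s n = mkseq a n.
    elim: n => [|n IH]; first by apply/nilP; rewrite /nilp (sP 0%N).1.
    have [sz1 Bo1] := sP n.+1; have [sz0 Bo0] := sP n.
    have tE : take n (s n.+1) = s n.
      apply: (@Bdisj _ _ y); first by rewrite size_takel ?sz1.
        by apply: Bo1; rewrite /= sz1 ltnS.
      by have := Bo0 n; rewrite /= sz0 ltnSn take_oversize ?sz0//; exact.
    rewrite mkseqS -IH -tE -[LHS](@take_size) sz1 (take_nth 0%N) ?sz1//.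
  have By n : B (mkseq a n) y.
    have [sz0 /(_ n)] := sP n; rewrite /= sz0 ltnSn take_oversize ?sz0//.
    by rewrite sE; exact.
  have Ane n : A (mkseq a n) !=set0 by have := By n; rewrite /B; case: asboolP.
  have ccell n z : cell Q (mkseq a n) z -> cell Q0 (mkseq a n) z.
    by move=> /cell_mkseq H; apply/cell_mkseq => k kn; apply: QQ0; exact: H.
  have [n|z zP] := rQ0 a.
    by have [_ [z [_ /ccell zn] _]] := Ane n; exists z.
  exists z.
    have [|n nP] := zP D; first by right; exists 0%N.
    by have [_ [c [Dc cn] _]] := Ane n; apply/(nP c) => //; exact: ccell.
  apply: sepU => _ [k _ <-]; have [j _ jk] := fU k.
  have [|n nP] := zP (U j); first by left; exists j.
  have := By n; rewrite /B; case: asboolP => // _ /(_ k I)[_].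
  rewrite /hull; case: asboolP => [AU Uy|nAU].
    split => // _; have [_ [c [Dc cn] _]] := Ane n.
    have := nP c (ccell _ _ cn); rewrite jk /= => <-.
    by apply: AU; exists c.
  have nUz : ~ U k (f z).
    move=> Uz; apply: nAU => _ [c [Dc cn] <-].
    by have := nP c (ccell _ _ cn); rewrite jk /= => ->.
  case: asboolP => [_ nUy|[]]; first by split.
  move=> _ [c [Dc cn] <-]; have := nP c (ccell _ _ cn); rewrite jk /= => H /H.
  exact: nUz.
apply: bigcapT_measurable => n; apply: bigcup_measurable => c _.
by case: eqP.
Qed.

End LusinNovikov.

(** * Measurability of sets given by formulas with countable quantifiers *)

Section MeasurableSets.
Context d (T : measurableType d).
Implicit Types P Q : T -> Prop.

Lemma mset_ex (P : nat -> T -> Prop) : (forall n, measurable [set x | P n x]) ->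
  measurable [set x | exists n, P n x].
Proof.
move=> mP; have -> : [set x | exists n, P n x] = \bigcup_n [set x | P n x].
  by apply/seteqP; split => [x [n]|x [n _]]; exists n.
exact: bigcup_measurable.
Qed.

Lemma mset_all (P : nat -> T -> Prop) : (forall n, measurable [set x | P n x]) ->
  measurable [set x | forall n, P n x].
Proof.
move=> mP; have -> : [set x | forall n, P n x] = \bigcap_n [set x | P n x].
  by apply/seteqP; split => [x H n _|x H n]; exact: H.
exact: bigcapT_measurable.
Qed.

Lemma mset_countex (I : countType) (P : I -> T -> Prop) :
  (forall i, measurable [set x | P i x]) -> measurable [set x | exists i, P i x].
Proof.
move=> mP.
have -> : [set x | exists i, P i x] =
  [set x | exists n, if unpickle n is Some i then P i x else False].
  apply/seteqP; split => [x [i Px]|x /= [n]]; first by exists (pickle i); rewrite pickleK.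
  by case: unpickle => // i; exists i.
by apply: mset_ex => n; case: unpickle => [i|]; [exact: mP|exact: measurable0].
Qed.

Lemma mset_and P Q : measurable [set x | P x] -> measurable [set x | Q x] ->
  measurable [set x | P x /\ Q x].
Proof. exact: measurableI. Qed.

Lemma mset_or P Q : measurable [set x | P x] -> measurable [set x | Q x] ->
  measurable [set x | P x \/ Q x].
Proof. exact: measurableU. Qed.

Lemma mset_not P : measurable [set x | P x] -> measurable [set x | ~ P x].
Proof. exact: measurableC. Qed.

Lemma mset_imp P Q : measurable [set x | P x] -> measurable [set x | Q x] ->
  measurable [set x | P x -> Q x].
Proof.
move=> mP mQ; have -> : [set x | P x -> Q x] = [set x | ~ P x \/ Q x].
  apply/seteqP; split => x /= H; last by case: H.
  by have [/H|] := pselect (P x); [right|left].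
by apply: mset_or => //; exact: mset_not.
Qed.

Lemma mset_iff P Q : measurable [set x | P x] -> measurable [set x | Q x] ->
  measurable [set x | P x <-> Q x].
Proof. by move=> mP mQ; apply: mset_and; exact: mset_imp. Qed.

Lemma mset_const (P : Prop) : measurable [set x : T | P].
Proof.
have [p|np] := pselect P.
  by rewrite [X in measurable X](_ : _ = setT)//; apply/seteqP; split.
by rewrite [X in measurable X](_ : _ = set0)//; apply/seteqP; split.
Qed.

Lemma mset_preim d' (T' : measurableType d') (f : T -> T') (A : set T') :
  measurable_fun setT f -> measurable A -> measurable [set x | A (f x)].
Proof. by move=> mf mA; rewrite -[X in measurable X]setTI; exact: mf. Qed.

Lemma mset_eq d' (T' : measurableType d') (V : nat -> set T') (f g : T -> T') :
  separating (range V) -> (forall k, measurable (V k)) ->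
  measurable_fun setT f -> measurable_fun setT g ->
  measurable [set x | f x = g x].
Proof.
move=> sV mV mf mg.
have -> : [set x | f x = g x] = [set x | forall k, V k (f x) <-> V k (g x)].
  apply/seteqP; split => [x /= ->//|x H]; apply: sV => _ [k _ <-]; exact: H.
by apply: mset_all => k; apply: mset_iff; exact: mset_preim.
Qed.

Lemma measurable_fun_mset d' (T' : measurableType d') (f : T -> T') :
  (forall A, measurable A -> measurable [set x | A (f x)]) -> measurable_fun setT f.
Proof. by move=> mf _ A mA; rewrite setTI; exact: mf. Qed.

Lemma measurable_fun_countable d' (T' : measurableType d') (n : T -> nat)
    (f : nat -> T -> T') : (forall k, measurable [set x | n x = k]) ->
  (forall k, measurable_fun setT (f k)) -> measurable_fun setT (fun x => f (n x) x).
Proof.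
move=> mn mf; apply: measurable_fun_mset => A mA.
have -> : [set x | A (f (n x) x)] = [set x | exists k, n x = k /\ A (f k x)].
  by apply/seteqP; split => [x Ax|x /= [k [->]]//]; exists (n x).
apply: mset_ex => k; apply: mset_and => //; exact: mset_preim.
Qed.

Lemma measurable_fun_cond d' (T' : measurableType d') P (f g : T -> T') :
  measurable [set x | P x] -> measurable_fun setT f -> measurable_fun setT g ->
  measurable_fun setT (fun x => if `[< P x >] then f x else g x).
Proof.
move=> mP mf mg; apply: measurable_fun_mset => A mA.
have -> : [set x | A (if `[< P x >] then f x else g x)] =
          [set x | (P x /\ A (f x)) \/ (~ P x /\ A (g x))].
  apply/seteqP; split => x /=; first by case: asboolP => ?; [left|right].
  by case: asboolP => ? [] [].
apply: mset_or; apply: mset_and; do ?exact: mset_preim => //; exact: mset_not.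
Qed.

Section Least.
Context (P : nat -> T -> Prop).

Definition least x : nat :=
  if pselect (exists n, `[< P n x >]) is left ex then ex_minn ex else 0%N.

Lemma leastP x : (exists n, P n x) -> P (least x) x.
Proof.
move=> [n Pn]; rewrite /least; case: pselect => [ex|[]]; last first.
  by exists n; apply/asboolP.
by case: ex_minnP => m /asboolP.
Qed.

Lemma least_min x n : P n x -> (least x <= n)%N.
Proof.
move=> Pn; rewrite /least; case: pselect => // ex.
by case: ex_minnP => m _; apply; apply/asboolP.
Qed.

Lemma measurable_least k : (forall n, measurable [set x | P n x]) ->
  measurable [set x | least x = k].
Proof.
move=> mP.
have -> : [set x | least x = k] =
    [set x | (P k x /\ forall j, (j < k)%N -> ~ P j x) \/
             (k = 0%N /\ forall n, ~ P n x)].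
  apply/seteqP; split => x /=.
    have [ex <-|nex] := pselect (exists n, P n x).
      left; split; first exact: leastP.
      by move=> j jk /least_min; rewrite leqNgt jk.
    have -> : least x = 0%N.
      by rewrite /least; case: pselect => // ex; exfalso;
      case: ex => n /asboolP Pn; apply: nex; exists n.
    by move=> <-; right; split => // n Pn; apply: nex; exists n.
  move=> [[Pk H]|[-> H]].
    apply/eqP; rewrite eqn_leq least_min//= leqNgt; apply/negP => /H; apply.
    by apply: leastP; exists k.
  by rewrite /least; case: pselect => // ex; exfalso; case: ex => n /asboolP /H.
apply: mset_or; apply: mset_and => //.
- apply: mset_all => j; apply: mset_imp; first exact: mset_const.
  exact: mset_not.
- exact: mset_const.
- by apply: mset_all => n; exact: mset_not.
Qed.

End Least.
End MeasurableSets.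

(** * Borel enumeration of the target fibers *)

Section Enumeration.
Context (R : realType) (dX dG : measure_display).
Context (X : measurableType dX) (G : measurableType dG) (GG : groupoid X G).
Context (BG : discrete_borel_groupoid R GG).

Lemma unit_inj : injective (unit_at GG).
Proof. by move=> x y xy; rewrite -[x](src_unit GG) xy src_unit. Qed.

Lemma measurable_unit : measurable_fun setT (unit_at GG).
Proof.
apply: measurable_fun_mset => A mA; apply/(units_borel BG).
have -> : unit_at GG @` [set x | A (unit_at GG x)] = A `&` range (unit_at GG).
  apply/seteqP; split => [_ [x Ax <-]|y [+ [x _ xy]]]; first by split => //; exists x.
  by rewrite -xy; exists x.
by apply: measurableI => //; exact/(units_borel BG).
Qed.

Lemma unit_separating : exists V : nat -> set X,
  separating (range V) /\ forall k, measurable (V k).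
Proof.
have [W [sW mW _ _]] := standard_borel_base (arrows_standard_borel BG).
exists (fun k => [set x | W k (unit_at GG x)]); split => [x y H|k].
  apply: unit_inj; apply: sW => _ [k _ <-].
  by apply: (H [set x | W k (unit_at GG x)]); exists k.
by apply: mset_preim => //; exact: measurable_unit.
Qed.

Section Maps.
Context d (T : measurableType d).

Lemma mset_eqX (a b : T -> X) : measurable_fun setT a -> measurable_fun setT b ->
  measurable [set t | a t = b t].
Proof. by have [V [sV mV]] := unit_separating; exact: mset_eq sV mV. Qed.

Lemma mset_eqG (a b : T -> G) : measurable_fun setT a -> measurable_fun setT b ->
  measurable [set t | a t = b t].
Proof.
have [W [sW mW _ _]] := standard_borel_base (arrows_standard_borel BG).
exact: mset_eq sW mW.
Qed.

Lemma measurable_src_comp (a : T -> G) : measurable_fun setT a ->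
  measurable_fun setT (fun t => src GG (a t)).
Proof. exact: measurableT_comp (measurable_src BG). Qed.

Lemma measurable_tgt_comp (a : T -> G) : measurable_fun setT a ->
  measurable_fun setT (fun t => tgt GG (a t)).
Proof. exact: measurableT_comp (measurable_tgt BG). Qed.

Lemma measurable_ginv_comp (a : T -> G) : measurable_fun setT a ->
  measurable_fun setT (fun t => ginv GG (a t)).
Proof. exact: measurableT_comp (measurable_ginv BG). Qed.

Lemma measurable_unit_comp (a : T -> X) : measurable_fun setT a ->
  measurable_fun setT (fun t => unit_at GG (a t)).
Proof. exact: measurableT_comp measurable_unit. Qed.
End Maps.

Lemma measurable_gmul_comp d (T : measurableType d) (a b : T -> G) :
  measurable_fun setT a -> measurable_fun setT b ->
  (forall t, src GG (a t) = tgt GG (b t)) ->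
  measurable_fun setT (fun t => gmul GG (a t) (b t)).
Proof.
move=> ma mb ab; apply: measurable_fun_mset => A mA.
have mD : measurable [set gh : G * G | src GG gh.1 = tgt GG gh.2].
  by apply: mset_eqX; [exact: measurable_src_comp|exact: measurable_tgt_comp].
have := measurable_gmul BG mD mA.
have mab : measurable_fun setT (fun t => (a t, b t)) by exact: measurable_fun_pair.
move=> /(mset_preim mab); congr measurable; apply/seteqP; split => t /=; first by case.
by [].
Qed.

(** Lusin-Novikov is stated for self-maps of one space, so the target map is replaced by [unit_at]
    after [tgt], which has the same fibers because units determine points. On each section [D n] the
    inverse of the target map is Borel by Lusin-Souslin. *)
Theorem target_enumeration : exists sg : nat -> X -> G,
  [/\ forall n, measurable_fun setT (sg n), forall n x, tgt GG (sg n x) = x &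
      forall g, exists n, sg n (tgt GG g) = g].
Proof.
have [W bW] := standard_borel_base (arrows_standard_borel BG).
have [sW mW _ _] := bW.
pose f g := unit_at GG (tgt GG g).
have mf : measurable_fun setT f.
  by apply: measurable_unit_comp; exact: measurable_tgt BG.
have ff g : f (f g) = f g by rewrite /f tgt_unit.
(* Even indices list the base, odd indices its preimages under [f]. As [f] is idempotent, the family
   is already closed under preimages by [f]. *)
pose U c := if odd c then f @^-1` W c./2 else W c./2.
have mU c : measurable (U c) by rewrite /U; case: ifP => // _; exact: mset_preim.
have U0 k : U k.*2 = W k by rewrite /U odd_double doubleK.
have U1 k : U k.*2.+1 = f @^-1` W k by rewrite /U /= odd_double /= uphalf_double.
have WU : range W `<=` range U by move=> _ [k _ <-]; exists k.*2.
have sU : separating (range U) by move=> y z H; apply: sW => E /WU; exact: H.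
have fU k : range U (f @^-1` U k).
  have [->|->] : U k = W k./2 \/ U k = f @^-1` W k./2 by rewrite /U; case: ifP; [right|left].
    by exists (k./2.*2.+1).
  exists (k./2.*2.+1) => //; rewrite U1.
  by apply/seteqP; split => g /=; rewrite ff.
have rU (E : nat -> set G) : (forall m, measurable (E m)) ->
    resolvable (range U `|` range E).
  move=> mE; pose E' c := if odd c then E c./2 else f @^-1` W c./2.
  have /(resolvable_seq bW) : forall c, measurable (E' c).
    by move=> c; rewrite /E'; case: ifP => // _; exact: mset_preim.
  apply: resolvable_sub => _ [[c _ <-]|[c _ <-]].
    rewrite /U; case: ifP => _; last by left; exists c./2.
    by right; exists c./2.*2 => //; rewrite /E' odd_double doubleK.
  by right; exists c.*2.+1 => //; rewrite /E' /= odd_double /= uphalf_double.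
have cf x : countable (f @^-1` [set x]).
  have [[g <-]|ng] := pselect (exists g, f g = x).
    apply: sub_countable (countable_tgt_fiber BG (tgt GG g)).
    by apply: subset_card_le => h /= /unit_inj.
  rewrite (_ : f @^-1` [set x] = set0)//; apply/seteqP; split => // g fg.
  by apply: ng; exists g.
have [D [sD TD]] := lusin_novikov sU mU rU fU cf.
have mtD n A : measurable A -> measurable (tgt GG @` (D n `&` A)).
  move=> mA; have := lusin_souslin sU mU rU fU (D := D n `&` A).
  have -> : tgt GG @` (D n `&` A) = [set x | (f @` (D n `&` A)) (unit_at GG x)].
    apply/seteqP; split => [_ [g DA <-]|x [g DA /unit_inj <-]]; exists g => //.
  move=> H; apply: mset_preim; first exact: measurable_unit.
  have [mD Dinj] := sD n; apply: H; first exact: measurableI.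
  by move=> g h; rewrite !inE => -[Dg _] [Dh _]; apply: Dinj; rewrite inE.
(* Off the image of [D n] the value is the unit at [x], which keeps the target equal to [x]. *)
have ex n x : exists g, if `[< (tgt GG @` D n) x >] then D n g /\ tgt GG g = x
    else g = unit_at GG x.
  by case: asboolP => [[g Dg <-]|_]; [exists g|exists (unit_at GG x)].
have [sg sgP] := choice (fun nx => ex nx.1 nx.2).
exists (fun n x => sg (n, x)); split.
- move=> n; apply: measurable_fun_mset => A mA.
  have -> : [set x | A (sg (n, x))] = [set x | (tgt GG @` (D n `&` A)) x \/
      (~ (tgt GG @` (D n `&` setT)) x /\ A (unit_at GG x))].
    rewrite setIT; apply/seteqP; split => x /=.
      have := sgP (n, x) => /=; case: asboolP => [_ [Dg tg] Ag|nD -> Ag].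
        by left; exists (sg (n, x)).
      by right.
    have := sgP (n, x) => /=; case: asboolP => [xD [Ds ts] [[g [Dg Ag] tg]|[]//]|nD ->].
      have -> // : sg (n, x) = g.
      by have [_] := sD n; apply; rewrite ?inE// /f tg ts.
    by move=> [[g [Dg Ag] tg]|[]//]; exfalso; apply: nD; exists g.
  apply: mset_or; first exact: mtD.
  apply: mset_and; first exact: mset_not (mtD _ _ measurableT).
  exact: mset_preim measurable_unit mA.
- move=> n x; have := sgP (n, x) => /=; case: asboolP => [_ []//|_ ->].
  exact: tgt_unit.
- move=> g; have [n _ Dg] : (\bigcup_n D n) g by rewrite -TD.
  exists n; have := sgP (n, tgt GG g) => /=; case: asboolP => [_ [Ds ts]|[]].
    by have [_] := sD n; apply; rewrite ?inE// /f ts.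
  by exists g.
Qed.

End Enumeration.

(** * Harmonic functions and first returns *)

Section EsumTools.
Context (R : realType).
Local Open Scope ereal_scope.

Lemma esumZl (T : choiceType) (A : set T) (r : R) (a : T -> \bar R) :
  (0 <= r)%R -> (forall i, A i -> 0 <= a i) ->
  \esum_(i in A) (r%:E * a i) = r%:E * \esum_(i in A) a i.
Proof.
move=> r0 a0.
have H F : fsets A F -> r%:E * \sum_(x \in F) a x = \sum_(x \in F) (r%:E * a x).
  move=> [finF FA]; rewrite !fsbig_finite//= !big_seq ge0_sume_distrr// => i.
  by rewrite in_fset_set// inE => /FA/a0.
rewrite /esum -ereal_supZl//; last first.
  apply/set0P; exists (\sum_(x \in set0) a x); exists set0 => //.
  exact: fsets_set0.
congr ereal_sup; apply/seteqP; split=> [_ [F AF <-]|_ [_ [F AF <-] <-]].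
  by exists (\sum_(x \in F) a x); [exists F|rewrite /= H].
by exists F => //; rewrite H.
Qed.

Lemma esum_ge1 (T : choiceType) (A : set T) (a : T -> \bar R) i :
  A i -> (forall j, A j -> 0 <= a j) -> a i <= \esum_(j in A) a j.
Proof.
move=> Ai a0; apply: esum_ge; exists [set i]; last by rewrite fsbig_set1.
by split => // j ->.
Qed.

Lemma esum_swap (T1 T2 : choiceType) (A : set T1) (B : set T2) (a : T1 -> T2 -> \bar R) :
  (forall i j, A i -> B j -> 0 <= a i j) ->
  \esum_(i in A) \esum_(j in B) a i j = \esum_(j in B) \esum_(i in A) a i j.
Proof.
move=> a0; rewrite !esum_esum; [|by move=> i j ? ?; exact: a0..].
apply: (reindex_esum (B `*`` fun=> A) _ (fun x => (x.2, x.1))).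
split=> [[i j] []//|[i1 i2] [j1 j2] _ _ [-> ->]//|[i1 i2] [H1 H2]].
by exists (i2, i1).
Qed.

Lemma esum_single (T : choiceType) (A : set T) (a : T -> \bar R) i : A i ->
  0 <= a i -> (forall j, A j -> j <> i -> a j = 0) -> \esum_(j in A) a j = a i.
Proof.
move=> Ai ai0 aj0; rewrite -[RHS](@esum_set1 _ _ i)//.
rewrite [LHS](esumID [set i]); last first.
  by move=> j Aj; have [->//|/aj0->] := pselect (j = i).
rewrite [X in _ + X]esum1 ?adde0; last by move=> j [Aj /= ji]; exact: aj0.
by congr esum; apply/seteqP; split => [j []//|j ->].
Qed.

(** Adding [m] makes every term non-negative and so trades a signed sum for an [esum]; as [p] has
    mass 1, the added terms contribute exactly [m]. *)
Lemma rsum_shift (T : choiceType) (A : set T) (p u : T -> R) (m : R) :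
  (forall i, A i -> (0 <= p i)%R) -> \esum_(i in A) (p i)%:E = 1 ->
  (forall i, A i -> (`|u i| <= m)%R) -> (0 <= m)%R ->
  \esum_(i in A) (p i * (u i + m))%:E = (rsum A (fun i => p i * u i) + m)%:E.
Proof.
move=> p0 p1 um m0.
set v := EFin \o (fun i => p i * u i)%R.
have v0 i : 0 <= v^\+ i by rewrite funeposE le_max lexx orbT.
have w0 i : 0 <= v^\- i by rewrite funenegE le_max lexx orbT.
have vm i : A i -> v^\+ i <= m%:E * (p i)%:E /\ v^\- i <= m%:E * (p i)%:E.
  move=> Ai; rewrite funeposE funenegE /v /= !ge_max -!EFinM !lee_fin mulr_ge0 ?p0// !andbT.
  have := um _ Ai; rewrite ler_norml => /andP[u1 u2].
  have pi0 := p0 _ Ai; split; first by rewrite mulrC ler_wpM2r.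
  by rewrite -mulrN mulrC ler_wpM2r// lerNl.
have sm : \esum_(i in A) (m%:E * (p i)%:E) = m%:E.
  by rewrite esumZl// ?p1 ?mule1// => i Ai; rewrite lee_fin p0.
have fin (w : T -> \bar R) : (forall i, A i -> 0 <= w i) ->
    (forall i, A i -> w i <= m%:E * (p i)%:E) ->
    \esum_(i in A) w i \is a fin_num.
  move=> w00 wm; rewrite ge0_fin_numE ?esum_ge0//.
  apply: (@le_lt_trans _ _ (\esum_(i in A) (m%:E * (p i)%:E))).
    exact: le_esum.
  by rewrite sm ltry.
have fv : \esum_(i in A) v^\+ i \is a fin_num by apply: fin => // i /vm[].
have fw : \esum_(i in A) v^\- i \is a fin_num by apply: fin => // i /vm[].
have : \esum_(i in A) v^\+ i + m%:E =
       \esum_(i in A) (p i * (u i + m))%:E + \esum_(i in A) v^\- i.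
  rewrite -{1}sm -!esumD//; last 2 first.
  - move=> i Ai; rewrite lee_fin mulr_ge0 ?p0// -lerBlDr sub0r.
    by have := um _ Ai; rewrite ler_norml => /andP[].
  - by move=> i Ai; rewrite mule_ge0// lee_fin p0.
  apply: eq_esum => i Ai; rewrite funeposE funenegE /v /= -EFinM -!EFin_max.
  rewrite -!EFinD mulrDr [(m * _)%R]mulrC; congr EFin.
  by case: (leP (p i * u i)%R 0%R) => h; case: (leP (- (p i * u i))%R 0%R) => h'; lra.
rewrite /rsum -/v; move: fv fw.
case: (\esum_(i in A) v^\+ i) => // a; case: (\esum_(i in A) v^\- i) => // b _ _.
case: (\esum_(i in A) _) => // c.
by rewrite -!EFinD => -[ac]; congr EFin => /=; lra.
Qed.
End EsumTools.

(* Liouville properties can be tested on [0,1]-valued functions, for which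
   harmonicity is an identity between sums of non-negative terms. *)
Section RealLiouville.
Context (R : realType) (T : Type) (I : choiceType) (S : set T) (A : T -> set I).
Context (p : T -> I -> R) (m : T -> I -> T).
Context (p0 : forall t i, S t -> A t i -> 0 <= p t i).
Context (p1 : forall t, S t -> \esum_(i in A t) (p t i)%:E = 1%E).
Context (mS : forall t i, S t -> A t i -> S (m t i)).

Definition complex_liouville := forall f : T -> R[i], bounded_on S f ->
  (forall t, S t -> csum (A t) (fun i => (p t i)%:C%C * f (m t i)) = f t) ->
  constant_on S f.

Definition real_liouville := forall F : T -> R, (forall t, S t -> 0 <= F t <= 1) ->
  (forall t, S t -> \esum_(i in A t) (p t i * F (m t i))%:E = (F t)%:E) ->
  constant_on S F.

Lemma Re_realM (a : R) (z : R[i]) : complex.Re (a%:C%C * z) = a * complex.Re z.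
Proof. by case: z => x y /=; rewrite mul0r subr0. Qed.

Lemma Im_realM (a : R) (z : R[i]) : complex.Im (a%:C%C * z) = a * complex.Im z.
Proof. by case: z => x y /=; rewrite mul0r addr0. Qed.

Lemma real_liouville_rsum (u : T -> R) (c : R) : real_liouville ->
  (forall t, S t -> `|u t| <= c) ->
  (forall t, S t -> rsum (A t) (fun i => p t i * u (m t i)) = u t) ->
  constant_on S u.
Proof.
move=> L uc hu.
have [[t0 St0]|nS] := pselect (S !=set0); last first.
  by exists 0 => t St; exfalso; apply: nS; exists t.
have c0 : 0 <= c by exact: le_trans (normr_ge0 _) (uc _ St0).
(* The affine map sending [u] to [e * (u + c)] takes values in [0,1] and preserves harmonicity; the
   summand 1 keeps the denominator positive when [c] is 0. *)
pose e := (2 * (c + 1))^-1; have e0 : 0 < e by rewrite invr_gt0; lra.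
have ce : 2 * c * e <= 1 by rewrite ler_pdivrMr ?mul1r; lra.
have [t St|t St|k kP] := L (fun t => e * (u t + c)).
- have := uc _ St; rewrite ler_norml => /andP[u1 u2].
  rewrite mulr_ge0 ?(ltW e0)//=; last lra.
  apply: le_trans ce; rewrite mulrC ler_wpM2r ?(ltW e0)//; lra.
- have := @rsum_shift R I (A t) (p t) (fun i => u (m t i)) c.
  rewrite hu// => /(_ _ (p1 St) _ c0) H.
  rewrite [RHS]EFinM -H; [|by move=> i; exact: p0|by move=> i Ai; exact/uc/mS].
  rewrite -esumZl ?(ltW e0)//; first by apply: eq_esum => i _; rewrite -EFinM mulrCA.
  move=> i Ai; rewrite lee_fin mulr_ge0// ?p0//.
  have := uc _ (mS St Ai); rewrite ler_norml => /andP[]; lra.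
exists (e^-1 * k - c) => t St; rewrite -(kP _ St) mulKf ?gt_eqF// addrK //.
Qed.

Lemma real_complex_liouville : real_liouville <-> complex_liouville.
Proof.
split=> [L f [M fM] hf|L F F01 hF].
  have [||a aP] := @real_liouville_rsum (fun t => complex.Re (f t)) (complex.Re M) L.
  - move=> t St; have := le_trans (normc_ge_Re (f t)) (fM _ St).
    by rewrite lecE /= => /andP[].
  - move=> t St; rewrite -[in RHS](hf _ St) /=; congr rsum.
    by apply/funext => i; rewrite Re_realM.
  have [||b bP] := @real_liouville_rsum (fun t => complex.Im (f t)) (complex.Re M) L.
  - move=> t St; have : `|complex.Im (f t)|%:C%C <= M.
      apply: le_trans (fM _ St); rewrite normc_def lecR.
      rewrite -sqrtr_sqr ler_wsqrtr// lerDr sqr_ge0//.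
    by rewrite lecE /= => /andP[].
  - move=> t St; rewrite -[in RHS](hf _ St) /=; congr rsum.
    by apply/funext => i; rewrite Im_realM.
  exists (Complex a b) => t St; move: (aP _ St) (bP _ St).
  by case: (f t) => x y /= -> ->.
have shift0 t (u : I -> R) : S t -> (forall i, A t i -> 0 <= u i <= 1) ->
    (\esum_(i in A t) (p t i * u i)%:E = (rsum (A t) (fun i => p t i * u i))%:E)%E.
  move=> St u01.
  have := @rsum_shift R I (A t) (p t) u 1 (fun i => p0 St) (p1 St).
  have -> : (\esum_(i in A t) (p t i * (u i + 1))%:E =
     \esum_(i in A t) (p t i * u i)%:E + 1)%E.
    rewrite -(p1 St) -esumD; first by apply: eq_esum => i _; rewrite mulrDr mulr1.
      by move=> i Ai; rewrite lee_fin mulr_ge0 ?p0//; case/andP: (u01 _ Ai).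
    by move=> i Ai; rewrite lee_fin p0.
  have u1 i : A t i -> `|u i| <= 1 by move=> /u01/andP[u0 u1]; rewrite ger0_norm.
  move=> /(_ u1 ler01) /(congr1 (fun x => x - 1%:E)%E).
  by rewrite addeK// EFinD addeK.
have [||z zP] := L (fun t => (F t)%:C%C).
- exists 1 => t St; have /andP[F0 F1] := F01 _ St.
  by rewrite normc_def /= expr0n /= addr0 sqrtr_sqr ger0_norm// -[1]/(1%:C%C) lecR.
- move=> t St; rewrite /csum.
  have -> : rsum (A t) (fun i => complex.Re ((p t i)%:C%C * (F (m t i))%:C%C)) = F t.
    have := hF _ St; rewrite shift0//; last by move=> i Ai; exact/F01/mS.
    move=> -[<-]; congr rsum; apply/funext => i; exact: Re_realM.
  have -> : rsum (A t) (fun i => complex.Im ((p t i)%:C%C * (F (m t i))%:C%C)) = 0.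
    have := @shift0 t (fun=> 0) St; rewrite esum1 => [|i _]; last by rewrite mulr0.
    move=> /(_ (fun i _ => ltac:(by rewrite lexx ler01)))[E]; rewrite [RHS]E.
    by congr rsum; apply/funext => i; rewrite Im_realM.
  by [].
by exists (complex.Re z) => t St; rewrite -(zP _ St).
Qed.

End RealLiouville.

Section LiouvilleReal.
Context (R : realType) (dX dG : measure_display).
Context (X : measurableType dX) (G : measurableType dG) (GG : groupoid X G).

Definition harmonic_on (p : G -> R) (x : X) (F : G -> R) := forall g,
  tgt_fiber GG x g ->
  \esum_(h in tgt_fiber GG (src GG g)) (p h * F (gmul GG g h))%:E = (F g)%:E.

Lemma liouville_atP (p : G -> R) (x : X) : (forall g, 0 <= p g) ->
  (forall x, \esum_(h in tgt_fiber GG x) (p h)%:E = 1%E) ->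
  liouville_at GG p x <->
  forall F : G -> R, (forall g, tgt_fiber GG x g -> 0 <= F g <= 1) ->
    harmonic_on p x F -> constant_on (tgt_fiber GG x) F.
Proof.
move=> p0 p1.
have := @real_complex_liouville R G G (tgt_fiber GG x) (fun g => tgt_fiber GG (src GG g))
  (fun _ => p) (gmul GG).
rewrite /real_liouville /complex_liouville => H.
apply: iff_sym; apply: H => // g h; rewrite /tgt_fiber /= => gx hg.
by rewrite tgt_mul.
Qed.

End LiouvilleReal.

Definition harmonic_group (R : realType) (Gamma : groupType) (nu F : Gamma -> R) :=
  forall g, \esum_(h in [set: Gamma]) (nu h * F (g * h)%g)%:E = (F g)%:E.

Lemma choquet_deny_groupP (R : realType) (Gamma : groupType) :
  choquet_deny_group R Gamma <-> countable [set: Gamma] /\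
  forall nu : Gamma -> R, prob_weight nu -> support_generates_semigroup nu ->
  forall F : Gamma -> R, (forall g, 0 <= F g <= 1) -> harmonic_group nu F ->
    constant_on [set: Gamma] F.
Proof.
have H (nu : Gamma -> R) : prob_weight nu ->
    (forall F : Gamma -> R, (forall g, 0 <= F g <= 1) -> harmonic_group nu F ->
      constant_on [set: Gamma] F) <->
    (forall f : Gamma -> R[i], bounded_on [set: Gamma] f ->
    (forall g, f g = csum [set: Gamma] (fun h => (nu h)%:C%C * f (g * h)%g)) ->
    constant_on [set: Gamma] f).
  move=> [nu0 nu1].
  have := @real_complex_liouville R Gamma Gamma setT (fun=> setT) (fun=> nu)
    (fun g h => (g * h)%g) (fun _ _ _ _ => nu0 _) (fun _ _ => nu1) (fun _ _ _ _ => I).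
  rewrite /real_liouville /complex_liouville => -[H1 H2]; split=> [L f bf hf|L F F01 hF].
    by apply: H1 => // F F01 hF; apply: L => g; [exact: F01|exact: hF].
  by apply: H2 => // f bf hf; apply: L => // g; rewrite hf.
split=> -[cG L]; split => // nu pnu gnu; first by apply/(H _ pnu); exact: L.
by apply/(H _ pnu); exact: L.
Qed.

Section Cancellation.
Context (X : Type) (G : choiceType) (GG : groupoid X G).
Implicit Types a g : G.

Lemma ginvK a : ginv GG (ginv GG a) = a.
Proof.
rewrite -[LHS](gmul1r GG) src_inv tgt_inv -(gmulVl GG a) gmulA ?src_inv ?tgt_inv//.
by rewrite gmulVl src_inv gmul1l.
Qed.

Lemma mulVK a g : tgt GG a = tgt GG g -> gmul GG a (gmul GG (ginv GG a) g) = g.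
Proof. by move=> ag; rewrite gmulA ?src_inv ?tgt_inv// gmulVr ag gmul1l. Qed.

Lemma mulKV a g : src GG a = tgt GG g -> gmul GG (ginv GG a) (gmul GG a g) = g.
Proof. by move=> ag; rewrite gmulA ?src_inv ?tgt_inv// gmulVl ag gmul1l. Qed.

Lemma mulgVK a g : src GG g = src GG a -> gmul GG (gmul GG g (ginv GG a)) a = g.
Proof. by move=> ga; rewrite -gmulA ?tgt_inv ?src_inv// gmulVl -ga gmul1r. Qed.

Lemma mulgKV a g : src GG g = tgt GG a -> gmul GG (gmul GG g a) (ginv GG a) = g.
Proof. by move=> ga; rewrite -gmulA ?tgt_inv ?src_inv// gmulVr -ga gmul1r. Qed.

End Cancellation.

Section FirstReturn.
Context (R : realType) (dX dG : measure_display).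
Context (X : measurableType dX) (G : measurableType dG) (GG : groupoid X G).
Context (p : G -> R) (p0 : forall g, 0 <= p g).
Context (p1 : forall x, \esum_(h in tgt_fiber GG x) (p h)%:E = 1%E).
Local Open Scope ereal_scope.
Implicit Types (C : X -> Prop) (Phi Psi : G -> \bar R).
Local Notation "g ** h" := (gmul GG g h) (at level 40, left associativity).
Local Notation src := (src GG).
Local Notation tgt := (tgt GG).
Local Notation unit := (unit_at GG).

(** One step of the chain, killed unless the new source satisfies [C]; the constantly true [C] gives
    the Markov operator itself. *)
Definition kernel_op C Phi g := \esum_(h in [set h | tgt h = src g /\ C (src h)])
  ((p h)%:E * Phi (g ** h)).

Lemma pE0 h : 0 <= (p h)%:E. Proof. by rewrite lee_fin. Qed.

Lemma kernel_op_ge0 C Phi g : (forall k, 0 <= Phi k) -> 0 <= kernel_op C Phi g.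
Proof. by move=> P0; apply: esum_ge0 => h _; rewrite mule_ge0 ?pE0. Qed.

Lemma kernel_op_le C Phi Psi g :
  (forall k, tgt k = tgt g -> C (src k) -> Phi k <= Psi k) ->
  kernel_op C Phi g <= kernel_op C Psi g.
Proof.
move=> H; apply: le_esum => h [hg Ch]; apply: lee_wpmul2l; first exact: pE0.
by apply: H; rewrite ?tgt_mul ?src_mul.
Qed.

Lemma kernel_op_ext C Phi Psi g :
  (forall k, tgt k = tgt g -> C (src k) -> Phi k = Psi k) ->
  kernel_op C Phi g = kernel_op C Psi g.
Proof.
by move=> H; apply/eqP; rewrite eq_le !kernel_op_le// => k kg Ck; rewrite H.
Qed.

Lemma kernel_opD C Phi Psi : (forall k, 0 <= Phi k) -> (forall k, 0 <= Psi k) ->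
  kernel_op C (Phi \+ Psi) = kernel_op C Phi \+ kernel_op C Psi.
Proof.
move=> H1 H2; apply/funext => g; rewrite /kernel_op -esumD; last 2 first.
- by move=> h _; rewrite mule_ge0 ?pE0.
- by move=> h _; rewrite mule_ge0 ?pE0.
by apply: eq_esum => h _; rewrite ge0_muleDr.
Qed.

Lemma kernel_opZ C (r : R) Phi : (0 <= r)%R -> (forall k, 0 <= Phi k) ->
  kernel_op C (fun g => r%:E * Phi g) = (fun g => r%:E * kernel_op C Phi g).
Proof.
move=> r0 H1; apply/funext => g; rewrite /kernel_op -esumZl//.
  by apply: eq_esum => h _; rewrite muleCA.
by move=> h _; rewrite mule_ge0 ?pE0.
Qed.

Lemma kernel_op_esum (I : choiceType) (D : set I) C (Phi : I -> G -> \bar R) :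
  (forall i k, 0 <= Phi i k) ->
  kernel_op C (fun g => \esum_(i in D) Phi i g) =
  (fun g => \esum_(i in D) kernel_op C (Phi i) g).
Proof.
move=> P0; apply/funext => g; rewrite /kernel_op esum_swap.
  by apply: eq_esum => h _; rewrite esumZl.
by move=> i h _ _; rewrite mule_ge0 ?pE0.
Qed.

Lemma kernel_op_trans C Phi a g : src a = tgt g ->
  kernel_op C (fun k => Phi (a ** k)) g = kernel_op C Phi (a ** g).
Proof.
move=> ag; rewrite /kernel_op src_mul//; apply: eq_esum => h [hg _].
by rewrite gmulA.
Qed.

Lemma kernel_op_split C Phi g : (forall k, 0 <= Phi k) ->
  kernel_op (fun=> True) Phi g =
  kernel_op C Phi g + kernel_op (fun y => ~ C y) Phi g.
Proof.
move=> P0; rewrite /kernel_op (esumID [set h | C (src h)]); last first.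
  by move=> h _; rewrite mule_ge0 ?pE0.
by congr (_ + _); congr esum; apply/seteqP; split => h /=; tauto.
Qed.

Lemma esum_lt (T : choiceType) (A : set T) (a b : T -> \bar R) i : A i ->
  (forall j, A j -> 0 <= a j <= b j) -> \esum_(j in A) b j < +oo -> a i < b i ->
  \esum_(j in A) a j < \esum_(j in A) b j.
Proof.
move=> Ai ab fb abi.
have a0 j : A j -> 0 <= a j by move=> /ab/andP[].
have ab' j : A j -> a j <= b j by move=> /ab/andP[].
have b0 j : A j -> 0 <= b j by move=> Aj; apply: le_trans (ab' j Aj); exact: a0.
have AI (c : T -> \bar R) : (forall j, A j -> 0 <= c j) ->
    \esum_(j in A) c j = c i + \esum_(j in A `&` ~` [set i]) c j.
  move=> c0; rewrite (esumID [set i])//; congr (_ + _).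
  have -> : A `&` [set i] = [set i] by apply/seteqP; split => [j []//|j ->].
  by rewrite esum_set1// c0.
move: fb; rewrite !AI// => fb; apply: lte_leD => //.
  rewrite ge0_fin_numE; last by apply: esum_ge0 => j [Aj _]; exact: a0.
  apply: le_lt_trans fb; apply: (@le_trans _ _ (\esum_(j in A `&` ~` [set i]) b j)).
    by apply: le_esum => j [Aj _]; exact: ab'.
  by rewrite leeDr// b0.
by apply: le_esum => j [Aj _]; exact: ab'.
Qed.

(** Termwise comparison with the total mass 1: the arrow [h] contributes strictly less than its
    weight, being killed or multiplied by a value below 1. *)
Lemma kernel_op_lt1 C Phi g h : (forall k, 0 <= Phi k <= 1) -> tgt h = src g ->
  (0 < p h)%R -> ~ C (src h) \/ Phi (g ** h) < 1 -> kernel_op C Phi g < 1.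
Proof.
move=> P01 hg ph H; rewrite -(p1 (src g)).
have -> : kernel_op C Phi g = \esum_(h in tgt_fiber GG (src g))
    (if `[< C (src h) >] then (p h)%:E * Phi (g ** h) else 0).
  rewrite /kernel_op esum_mkcond [RHS]esum_mkcond; apply: eq_esum => k _.
  case: asboolP => Ck; last first.
    by rewrite if_same; case: ifPn => //; rewrite inE => -[_ /Ck].
  by congr (if _ then _ else _); apply/idP/idP; rewrite !inE; [move=> -[]|split].
have P0 k : 0 <= Phi k by have /andP[] := P01 k.
have P1 k : Phi k <= 1 by have /andP[] := P01 k.
apply: (esum_lt (i := h)) => //.
- move=> k _; case: asboolP => _; last by rewrite lexx pE0.
  rewrite mule_ge0 ?pE0//= -[leRHS]mule1; by apply: lee_wpmul2l; [exact: pE0|exact: P1].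
- by rewrite p1 ltry.
- case: H => [nC|P]; case: asboolP => // _; rewrite ?lte_fin//.
  by rewrite -[ltRHS]mule1 lte_pmul2l// lte_fin.
Qed.

Context (x : X).
Local Notation stepA := (kernel_op (fun y => y = x)).
Local Notation stepB := (kernel_op (fun y => y <> x)).

(** The expectation of [Phi] after [n] steps on the event that none of them ends at source [x]; for
    [one] it is the probability of that event. *)
Definition stay n Phi := iter n stepB Phi.

(* The expectation of [Phi] at the first return to source [x], on the event
   that this happens at time [n+1]. *)
Definition first_return n Phi := stay n (stepA Phi).

Lemma stay_ge0 n Phi : (forall k, 0 <= Phi k) -> forall g, 0 <= stay n Phi g.
Proof. by move=> P0; elim: n => //= n IH g; exact: kernel_op_ge0. Qed.

Lemma stay_le n Phi Psi g : (forall k, tgt k = tgt g -> Phi k <= Psi k) ->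
  stay n Phi g <= stay n Psi g.
Proof.
elim: n g => [|n IH] g H /=; first exact: H.
by apply: kernel_op_le => k kg _; apply: IH => l lk; apply: H; rewrite lk.
Qed.

Lemma stay_ext n Phi Psi g : (forall k, tgt k = tgt g -> Phi k = Psi k) ->
  stay n Phi g = stay n Psi g.
Proof. by move=> H; apply/eqP; rewrite eq_le !stay_le// => k kg; rewrite H. Qed.

Lemma stay_trans n Phi a g : src a = tgt g ->
  stay n (fun k => Phi (a ** k)) g = stay n Phi (a ** g).
Proof.
elim: n g => //= n IH g ag; rewrite -kernel_op_trans//; apply: kernel_op_ext => k kg _.
by rewrite IH// kg.
Qed.

Lemma stayD n Phi Psi : (forall k, 0 <= Phi k) -> (forall k, 0 <= Psi k) ->
  stay n (Phi \+ Psi) = stay n Phi \+ stay n Psi.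
Proof.
by move=> H1 H2; elim: n => //= n ->; apply: kernel_opD; exact: stay_ge0.
Qed.

Lemma stayZ n (r : R) Phi : (0 <= r)%R -> (forall k, 0 <= Phi k) ->
  stay n (fun g => r%:E * Phi g) = (fun g => r%:E * stay n Phi g).
Proof.
by move=> H1 H2; elim: n => //= n ->; apply: kernel_opZ => //; exact: stay_ge0.
Qed.

Lemma stay_esum (I : choiceType) (D : set I) n (Phi : I -> G -> \bar R) :
  (forall i k, 0 <= Phi i k) ->
  stay n (fun g => \esum_(i in D) Phi i g) =
  (fun g => \esum_(i in D) stay n (Phi i) g).
Proof.
by move=> H; elim: n => //= n ->; apply: kernel_op_esum => i; exact: stay_ge0.
Qed.

Lemma first_return_ge0 n Phi : (forall k, 0 <= Phi k) -> forall g, 0 <= first_return n Phi g.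
Proof. by move=> P0; apply: stay_ge0 => k; exact: kernel_op_ge0. Qed.

Lemma first_returnZ n (r : R) Phi g : (0 <= r)%R -> (forall k, 0 <= Phi k) ->
  first_return n (fun k => r%:E * Phi k) g = r%:E * first_return n Phi g.
Proof.
move=> r0 P0; rewrite /first_return kernel_opZ// stayZ// => k.
exact: kernel_op_ge0.
Qed.

Lemma first_return_ext n Phi Psi g :
  (forall k, tgt k = tgt g -> src k = x -> Phi k = Psi k) ->
  first_return n Phi g = first_return n Psi g.
Proof.
move=> H; apply: stay_ext => k kg; apply: kernel_op_ext => l lk lx.
by apply: H; rewrite // lk.
Qed.

Lemma first_return_trans n Phi a g : src a = tgt g ->
  first_return n (fun k => Phi (a ** k)) g = first_return n Phi (a ** g).
Proof.
move=> ag; rewrite /first_return -stay_trans//; apply: stay_ext => k kg.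
by rewrite kernel_op_trans// kg.
Qed.

(** Optional stopping at the first return, truncated at time [n]: either the chain has returned, or
    it has stayed away and [F] is evaluated at its current position. *)
Lemma stay_decomp n (F : G -> \bar R) : (forall k, 0 <= F k) ->
  (forall g, kernel_op (fun=> True) F g = F g) ->
  forall g, F g = \sum_(i < n) first_return i F g + stay n F g.
Proof.
move=> F0 hF g; elim: n => [|n IH]; first by rewrite big_ord0 add0e.
rewrite {1}IH big_ord_recr /= -addeA; congr (_ + _).
rewrite /first_return -[X in _ + X]/(stay n.+1 F g) /stay iterSr -/(stay _ _).
rewrite -[LHS]/(stay n F g) -[X in _ + X]/(stay n (stepB F) g).
have A0 k : 0 <= stepA F k by exact: kernel_op_ge0.
have B0 k : 0 <= stepB F k by exact: kernel_op_ge0.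
have /(congr1 (fun f => f g)) /= <- := stayD n A0 B0.
by apply: stay_ext => k _; rewrite -hF (kernel_op_split (fun y => y = x)).
Qed.

Definition one : G -> \bar R := fun=> 1.

Lemma one_ge0 k : 0 <= one k. Proof. exact: lee01. Qed.

Lemma one_harmonic g : kernel_op (fun=> True) one g = one g.
Proof.
rewrite /kernel_op /one -[RHS](p1 (src g)).
have -> : [set h | tgt h = src g /\ True] = tgt_fiber GG (src g).
  by apply/seteqP; split => h /=; tauto.
by apply: eq_esum => h _; rewrite mule1.
Qed.

Lemma stay_one_le n m g : (m <= n)%N -> stay n one g <= stay m one g.
Proof.
move=> /subnK <-; elim: (n - m)%N g => // k IH g.
apply: le_trans (IH g); rewrite addSn /stay iterSr; apply: stay_le => l _.
rewrite -[leRHS]one_harmonic (kernel_op_split (fun y => y = x)) ?leeDr//.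
by apply: kernel_op_ge0 => h; exact: one_ge0.
Qed.

Lemma stay_one_le1 n g : stay n one g <= 1.
Proof. exact: (@stay_one_le n 0). Qed.

Lemma stay_one_src n g h : src g = src h -> stay n one g = stay n one h.
Proof.
have H k : stay n one k = stay n one (unit (src k)).
  by rewrite -[k in LHS](gmul1r GG) -stay_trans ?tgt_unit.
by move=> gh; rewrite H gh -H.
Qed.

Lemma esum_gt0 (T : choiceType) (A : set T) (a : T -> \bar R) :
  (forall j, A j -> 0 <= a j) -> 0 < \esum_(j in A) a j -> exists2 i, A i & 0 < a i.
Proof.
move=> a0 s0; apply: contrapT => H; move: s0; rewrite esum1 ?ltxx// => i Ai.
apply/eqP; rewrite eq_le a0// andbT leNgt; apply/negP => ai.
by apply: H; exists i.
Qed.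

Lemma mulep_gt0 (r : R) (y : \bar R) : (0 <= r)%R -> 0 <= y -> 0 < r%:E * y ->
  (0 < r)%R /\ 0 < y.
Proof.
move=> r0 y0 ry; split.
  by rewrite lt_neqAle r0 andbT; apply/eqP => r00; rewrite -r00 mul0e ltxx in ry.
by rewrite lt_neqAle y0 andbT; apply/eqP => y00; rewrite -y00 mule0 ltxx in ry.
Qed.

Lemma markov_pow_ge0 n g : 0 <= markov_pow GG p n g.
Proof.
elim: n g => [|n IH] g /=; first exact: pE0.
by apply: esum_ge0 => h _; rewrite mule_ge0 ?pE0.
Qed.

Lemma markov_pow_step n g : 0 < markov_pow GG p n.+1 g ->
  exists h, [/\ tgt h = tgt g, (0 < p h)%R & 0 < markov_pow GG p n (ginv GG h ** g)].
Proof.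
move=> /esum_gt0[h _|h hg /mulep_gt0[]//].
- by rewrite mule_ge0 ?pE0 ?markov_pow_ge0.
- exact: markov_pow_ge0.
- by exists h.
Qed.

Lemma src_KV h g : tgt h = tgt g -> src (ginv GG h ** g) = src g.
Proof. by move=> hg; rewrite src_mul// src_inv. Qed.

Lemma tgt_KV h g : tgt h = tgt g -> tgt (ginv GG h ** g) = src h.
Proof. by move=> hg; rewrite tgt_mul ?tgt_inv// src_inv. Qed.

(** The index [n] of [markov_pow] stands for [n+1] steps. A path of this length and positive weight
    from [tgt a] to [x] loses its mass to killing at the latest at its last step, and the loss
    propagates back to the starting point. *)
Lemma stay_one_lt1 n a : src a = x -> 0 < markov_pow GG p n a ->
  stay n.+1 one (unit (tgt a)) < 1.
Proof.
have P01 m k : 0 <= stay m one k <= 1.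
  by rewrite stay_one_le1 andbT; apply: stay_ge0 => l; exact: one_ge0.
elim: n a => [|n IH] a ax.
  rewrite /= lte_fin => pa; apply: (@kernel_op_lt1 _ _ _ a) => //.
  - by move=> k; exact: (P01 0%N).
  - by rewrite src_unit.
  - by left; rewrite ax.
move=> /markov_pow_step[h [ha ph hmp]].
apply: (@kernel_op_lt1 _ _ _ h) => //; first by move=> k; exact: (P01 n.+1).
  by rewrite src_unit.
right; rewrite -ha gmul1l -[ltLHS]/(stay n.+1 one h).
rewrite (@stay_one_src _ h (unit (tgt (ginv GG h ** a)))); last first.
  by rewrite src_unit tgt_KV.
by apply: IH => //; rewrite src_KV.
Qed.

Lemma isotropyP a : src a = x -> tgt a = x -> exists c : isotropy GG x, sval c = a.
Proof.
move=> sa ta; have H : isotropy_pred GG x a by apply/asboolP.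
by exists (exist _ a H).
Qed.

Definition dirac_fun (a : G) : G -> \bar R := fun k => if k == a then 1 else 0.

Lemma dirac_fun_ge0 a k : 0 <= dirac_fun a k.
Proof. by rewrite /dirac_fun; case: eqP. Qed.

(** The first-return distribution: the probability that the chain started at the unit of [x] stands
    at [c] when its source first returns to [x]. *)
Definition hit (c : isotropy GG x) :=
  \esum_(n in [set: nat]) first_return n (dirac_fun (sval c)) (unit x).

Lemma hit_ge0 c : 0 <= hit c.
Proof. by apply: esum_ge0 => n _; apply: first_return_ge0 => k; exact: dirac_fun_ge0. Qed.

(** By left invariance the chain from [g] is the translate by [g] of the chain from the unit of [x],
    and at its first return the latter stands at an element of the isotropy group. *)
Lemma first_return_hit (F : G -> R) g : (forall k, (0 <= F k)%R) -> src g = x ->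
  \esum_(n in [set: nat]) first_return n (EFin \o F) g =
  \esum_(c in [set: isotropy GG x]) (F (g ** sval c))%:E * hit c.
Proof.
move=> F0 gx.
transitivity (\esum_(n in [set: nat]) \esum_(c in [set: isotropy GG x])
    ((F (g ** sval c))%:E * first_return n (dirac_fun (sval c)) (unit x))); last first.
  rewrite esum_swap; last first.
    move=> n c _ _; rewrite mule_ge0 ?lee_fin//.
    by apply: first_return_ge0 => k; exact: dirac_fun_ge0.
  apply: eq_esum => c _; rewrite esumZl// => n _.
  by apply: first_return_ge0 => k; exact: dirac_fun_ge0.
apply: eq_esum => n _.
rewrite -{1}(gmul1r GG g) gx -first_return_trans ?tgt_unit//.
transitivity (first_return n (fun k => \esum_(c in [set: isotropy GG x])
    ((F (g ** sval c))%:E * dirac_fun (sval c) k)) (unit x)).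
  apply: first_return_ext => k; rewrite tgt_unit => kx /isotropyP/(_ kx)[c <-].
  rewrite (@esum_single _ _ _ _ c)//.
  - by rewrite /dirac_fun eqxx mule1.
  - by rewrite mule_ge0 ?lee_fin// dirac_fun_ge0.
  - move=> c' _ c'c; rewrite /dirac_fun; case: eqP => [|_]; last by rewrite mule0.
    by move=> /val_inj cc'; exfalso; apply: c'c.
rewrite /first_return.
have Fd0 c k : 0 <= (F (g ** sval c))%:E * dirac_fun (sval c) k.
  by rewrite mule_ge0 ?lee_fin// dirac_fun_ge0.
rewrite kernel_op_esum// stay_esum; last by move=> c k; exact: kernel_op_ge0.
apply: eq_esum => c _.
rewrite kernel_opZ//; last by move=> k; exact: dirac_fun_ge0.
rewrite stayZ// => k; apply: kernel_op_ge0 => l; exact: dirac_fun_ge0.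
Qed.

(* Cutting a path of positive weight ending at [x] at its visits to [x] writes
   its product in terms of first returns. *)
Lemma hit_path (S : set (isotropy GG x)) n g :
  (forall a b, S a -> S b -> S (a * b)%g) -> (forall c, 0 < hit c -> S c) ->
  src g = x -> 0 < markov_pow GG p n g ->
  exists k a, [/\ src a = x, tgt a = tgt g,
    0 < first_return k (dirac_fun a) (unit (tgt g)) &
    g = a \/ exists2 c, S c & g = a ** sval c].
Proof.
move=> SM hS; elim: n g => [|n IH] g gx.
  rewrite /= lte_fin => pg; exists 0%N, g; split=> //; last by left.
  apply: (@lt_le_trans _ _ ((p g)%:E * dirac_fun g (unit (tgt g) ** g))).
    by rewrite gmul1l /dirac_fun eqxx mule1 lte_fin.
  apply: (@esum_ge1 _ _ _ _ g); first by rewrite src_unit.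
  by move=> h _; rewrite mule_ge0 ?pE0 ?dirac_fun_ge0.
move=> /markov_pow_step[h [hg ph hmp]].
have [|k [a [ax ta Ha ga]]] := IH _ _ hmp; first by rewrite src_KV.
rewrite tgt_KV// in ta Ha.
have [hx|hx] := pselect (src h = x); last first.
  have ha : src h = tgt a by [].
  exists k.+1, (h ** a); split; [by rewrite src_mul|by rewrite tgt_mul| |].
  - apply: (@lt_le_trans _ _ ((p h)%:E *
      first_return k (dirac_fun (h ** a)) (unit (tgt g) ** h))).
      rewrite -hg gmul1l mule_gt0// -?lte_fin//.
      rewrite -(gmul1r GG h) -first_return_trans ?tgt_unit//.
      rewrite (_ : first_return _ _ _ = first_return k (dirac_fun a) (unit (src h)))//.
      apply: first_return_ext => l; rewrite tgt_unit => lh _.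
      rewrite /dirac_fun gmul1r; congr (if _ then _ else _).
      apply/eqP/eqP => [H|->//].
      have := congr1 (gmul GG (ginv GG h)) H.
      rewrite !gmulA ?src_inv// gmulVl.
      by rewrite -{1}lh ha !gmul1l.
    apply: (@esum_ge1 _ _ _ _ h); first by rewrite src_unit.
    move=> l _; rewrite mule_ge0 ?pE0//; apply: first_return_ge0 => m.
    exact: dirac_fun_ge0.
  - case: ga => [ga|[c Sc ga]]; [left|right; exists c => //].
      by rewrite -ga mulVK.
    by rewrite -gmulA ?isotropy_tgt// -ga mulVK.
exists 0%N, h; split => //.
  apply: (@lt_le_trans _ _ ((p h)%:E * dirac_fun h (unit (tgt g) ** h))).
    by rewrite -hg gmul1l /dirac_fun eqxx mule1 lte_fin.
  apply: (@esum_ge1 _ _ _ _ h); first by rewrite src_unit.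
  by move=> l _; rewrite mule_ge0 ?pE0 ?dirac_fun_ge0.
right; rewrite hx in ta Ha.
have [c ca] := isotropyP ax ta.
have Sc : S c.
  apply: hS; apply: (lt_le_trans Ha); rewrite -ca.
  by apply: esum_ge1 => // m _; apply: first_return_ge0 => l; exact: dirac_fun_ge0.
case: ga => [ga|[b Sb ga]].
  by exists c; rewrite // ca -ga mulVK.
by exists (c * b)%g; [exact: SM|rewrite /= ca -ga mulVK].
Qed.

End FirstReturn.

Section FiniteOrbit.
Context (R : realType) (dX dG : measure_display).
Context (X : measurableType dX) (G : measurableType dG) (GG : groupoid X G).
Context (p : G -> R) (p0 : forall g, 0 <= p g).
Context (p1 : forall x, \esum_(h in tgt_fiber GG x) (p h)%:E = 1%E).
Local Open Scope ereal_scope.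
Local Notation stay := (stay GG p).
Local Notation first_return := (first_return GG p).
Local Notation one := (@one R dG G).

Lemma esum_remainder (H rem : nat -> \bar R) (v : \bar R) : (forall n, 0 <= H n) ->
  (forall n, 0 <= rem n) -> (forall n, v = \sum_(i < n) H i + rem n) ->
  (forall e : R, (0 < e)%R -> exists n, rem n <= e%:E) ->
  v = \esum_(n in [set: nat]) H n.
Proof.
move=> H0 r0 vE re; rewrite -nneseries_esumT//; apply/eqP; rewrite eq_le; apply/andP; split.
  apply/lee_addgt0Pr => e /re[n rn]; rewrite (vE n) leeD// -(big_mkord xpredT).
  by apply: nneseries_lim_ge => i _ _; exact: H0.
apply: lime_le; first by apply: is_cvg_nneseries => n _ _; exact: H0.
by apply: nearW => n; rewrite big_mkord (vE n) leeDl.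
Qed.

Context (nd : nondegenerate_markov GG p) (x : X).
Context (finO : finite_set [set y | orbit_relation GG (x, y)]).

(** Non-degeneracy gives each point of the orbit a time by which some mass has returned to [x]. The
    probability of staying away decreases with time and depends on the source alone, so on a finite
    orbit one time [N] and one bound [r] serve all points. *)
Lemma stay_contraction : exists N (r : R), (0 <= r < 1)%R /\
  forall g, tgt GG g = x -> stay x N one g <= r%:E.
Proof.
have ex1 y : orbit_relation GG (x, y) -> exists n, stay x n one (unit_at GG y) < 1.
  move=> [g _ [gx gy]].
  have : tgt_fiber GG y (ginv GG g) by rewrite /tgt_fiber /= tgt_inv.
  rewrite -nd => -[n _ [ty mp]]; exists n.+1; rewrite -ty.
  by apply: stay_one_lt1 => //; rewrite src_inv.
have /finite_seqP[s sE] := finO.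
have : exists N (r : R), (0 <= r < 1)%R /\
    forall y, y \in s -> stay x N one (unit_at GG y) <= r%:E.
  have : forall y, y \in s -> orbit_relation GG (x, y).
    by move=> y ys; have : [set` s] y by []; rewrite -sE.
  elim: s {sE} => [|y s IH] sO; first by exists 0%N, 0%R; rewrite lexx ltr01.
  have [N [r [/andP[r0 r1] Nr]]] : exists N (r : R), (0 <= r < 1)%R /\
      forall y, y \in s -> stay x N one (unit_at GG y) <= r%:E.
    by apply: IH => z zs; apply: sO; rewrite inE zs orbT.
  have [n ny] := ex1 y (sO _ (mem_head _ _)).
  have fy : stay x n one (unit_at GG y) \is a fin_num.
    rewrite ge0_fin_numE; first exact: lt_trans ny (ltry _).
    by apply: stay_ge0 => // k; exact: one_ge0.
  exists (maxn n N), (Num.max (fine (stay x n one (unit_at GG y))) r); split.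
    by rewrite le_max r0 orbT /= gt_max r1 andbT -lte_fin fineK.
  move=> z; rewrite inE => /predU1P[->|zs].
    apply: le_trans (stay_one_le _ _ _ _ (leq_maxl n N)) _ => //.
    by rewrite EFin_max fineK// le_max lexx.
  apply: le_trans (stay_one_le _ _ _ _ (leq_maxr n N)) _ => //.
  by apply: le_trans (Nr _ zs) _; rewrite lee_fin le_max lexx orbT.
move=> [N [r [r01 Nr]]]; exists N, r; split => // g gx.
have -> : stay x N one g = stay x N one (unit_at GG (src GG g)).
  by apply: stay_one_src => //; rewrite src_unit.
by apply: Nr; have : [set` s] (src GG g) by rewrite -sE /=; exists g; rewrite ?gx.
Qed.

Lemma stay_vanish (e : R) : (0 < e)%R -> exists n, forall g, tgt GG g = x ->
  stay x n one g <= e%:E.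
Proof.
move=> e0; have [N [r [/andP[r0 r1] Nr]]] := stay_contraction.
(* Markov property in blocks of [N] steps: every block costs a factor [r]. *)
have H k g : tgt GG g = x -> stay x (k * N)%N one g <= (r ^+ k)%:E.
  elim: k g => [|k IH] g gx; first by rewrite mul0n expr0.
  rewrite mulSn addnC /stay iterD -/(stay _ _ _).
  apply: (@le_trans _ _ (stay x (k * N)%N (fun g => r%:E * one g) g)).
    by apply: stay_le => // h hg; rewrite mule1; apply: Nr; rewrite hg.
  rewrite stayZ//.
  by rewrite exprS EFinM; apply: lee_wpmul2l => //; exact: IH.
have : (fun k => r ^+ k)%R @ \oo --> (0%R : R) by apply: cvg_expr; rewrite ger0_norm.
move=> /cvgrPdist_le/(_ e e0)[k _ /(_ k (leqnn _))]; rewrite /= sub0r normrN => ke.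
exists (k * N)%N => g gx; apply: le_trans (H _ _ gx) _; rewrite lee_fin.
exact: le_trans (ler_norm _) ke.
Qed.

(** Optional stopping: the remainder in [stay_decomp] is at most the probability of staying away,
    which tends to zero. *)
Lemma harmonic_first_return (F : G -> R) : (forall g, 0 <= F g <= 1)%R ->
  (forall g, kernel_op GG p (fun=> True) (EFin \o F) g = (F g)%:E) ->
  forall g, tgt GG g = x ->
  (F g)%:E = \esum_(n in [set: nat]) first_return x n (EFin \o F) g.
Proof.
move=> F01 hF g gx.
have F0 k : 0 <= (EFin \o F) k by rewrite lee_fin; case/andP: (F01 k).
apply: (esum_remainder (rem := fun n => stay x n (EFin \o F) g)).
- by move=> n; apply: first_return_ge0.
- by move=> n; apply: stay_ge0.
- by move=> n; exact: stay_decomp.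
move=> e /stay_vanish[n nP]; exists n; apply: le_trans (nP _ gx).
by apply: stay_le => // k _; rewrite lee_fin; case/andP: (F01 k).
Qed.

Theorem finite_orbit_liouville : choquet_deny_group R (isotropy GG x) ->
  liouville_at GG p x.
Proof.
move=> /choquet_deny_groupP[cG CD]; apply/liouville_atP => // F0 F001 hF0.
(* Extended by zero off the target fiber of [x], the function is harmonic on all arrows, since right
   multiplication preserves targets. *)
pose F g := if tgt GG g == x then F0 g else 0%R.
have F01 g : (0 <= F g <= 1)%R.
  by rewrite /F; case: eqP => [/F001//|_]; rewrite lexx ler01.
have hF g : kernel_op GG p (fun=> True) (EFin \o F) g = (F g)%:E.
  rewrite {2}/F; case: eqP => [gx|gx].
    rewrite -hF0// /kernel_op.
    have -> : [set h | tgt GG h = src GG g /\ True] = tgt_fiber GG (src GG g).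
      by apply/seteqP; split => h /=; tauto.
    by apply: eq_esum => h hg; rewrite /= /F tgt_mul// gx eqxx.
  rewrite /kernel_op esum1// => h [hg _].
  by rewrite /= /F tgt_mul//; case: eqP => // _; rewrite mule0.
have hone : forall g, tgt GG g = x -> 1 = \esum_(n in [set: nat]) first_return x n one g.
  apply: (harmonic_first_return (F := fun=> 1%R)) => g; first by rewrite ler01 lexx.
  exact: one_harmonic.
have hit_sum : \esum_(c in [set: isotropy GG x]) hit p c = 1.
  rewrite (hone (unit_at GG x)) ?tgt_unit//.
  rewrite (first_return_hit p0 (F := fun=> 1%R))// ?src_unit//.
  by apply: eq_esum => c _; rewrite mul1e.
have hit_fin (c : isotropy GG x) : (fine (hit p c))%:E = hit p c.
  rewrite fineK// ge0_fin_numE; last exact: hit_ge0.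
  apply: (@le_lt_trans _ _ 1); last exact: ltry.
  by rewrite -hit_sum; apply: esum_ge1 => // c' _; exact: hit_ge0.
have [||||k kP] := CD (fun c => fine (hit p c)) _ _ (fun c => F (sval c)).
- split; first by move=> c; apply: fine_ge0; exact: hit_ge0.
  by rewrite -hit_sum; apply: eq_esum => c _; exact: hit_fin.
- apply/seteqP; split => // c _ S [SM hS].
  have hS' c' : 0 < hit p c' -> S c' by rewrite -hit_fin lte_fin; exact: hS.
  have : tgt_fiber GG x (sval c) by exact: isotropy_tgt.
  rewrite -nd => -[n _ [_ mp]].
  have [m [a [ax ta Ha]]] := hit_path p0 SM hS' (isotropy_src c) mp.
  rewrite isotropy_tgt in ta Ha.
  have [a' aE] := isotropyP ax ta.
  have Sa : S a'.
    apply: hS'; apply: (lt_le_trans Ha); rewrite -aE.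
    by apply: esum_ge1 => // l _; apply: first_return_ge0 => // j; exact: dirac_fun_ge0.
  move=> [ca|[b Sb cb]]; first by have -> : c = a' by apply: val_inj; rewrite /= ca aE.
  have -> : c = (a' * b)%g by apply: val_inj; rewrite /= cb aE.
  exact: SM.
- by move=> c; exact: F01.
- move=> g; rewrite harmonic_first_return ?isotropy_tgt//.
  rewrite first_return_hit ?isotropy_src//; last by move=> c; case/andP: (F01 c).
  by apply: eq_esum => c _; rewrite -hit_fin -EFinM mulrC.
have [e ee] := @isotropyP _ _ _ _ GG x (unit_at GG x) (src_unit _ _) (tgt_unit _ _).
have k0 : (0 <= k)%R by rewrite -(kP e I); case/andP: (F01 (sval e)).
(* From any [g] in the fiber the first return happens with probability 1 and lands in the isotropy
   group, where [F] equals [k]. *)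
exists k => g gx; have : (F g)%:E = k%:E.
  rewrite harmonic_first_return//.
  transitivity (\esum_(n in [set: nat]) (k%:E * first_return x n one g)).
    apply: eq_esum => n _.
    transitivity (first_return x n (fun g => k%:E * one g) g).
      apply: first_return_ext => // l lg lx; rewrite mule1 /=.
      have [c <-] := isotropyP lx (etrans lg gx).
      by rewrite kP.
    by rewrite first_returnZ// => ?; exact: one_ge0.
  rewrite esumZl//; first by rewrite -hone// mule1.
  by move=> n _; apply: first_return_ge0 => // ?; exact: one_ge0.
by rewrite /F gx eqxx => -[].
Qed.

End FiniteOrbit.

(** * Invariant kernels *)

Section Kernels.
Context (R : realType) (dX dG : measure_display).
Context (X : measurableType dX) (G : measurableType dG) (GG : groupoid X G).
Context (BG : discrete_borel_groupoid R GG).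

Lemma measurable_esum_nat d (T : measurableType d) (u : nat -> T -> R) :
  (forall n x, 0 <= u n x) -> (forall n, measurable_fun setT (u n)) ->
  measurable_fun setT (fun x => \esum_(n in [set: nat]) (u n x)%:E).
Proof.
move=> u0 mu.
have -> : (fun x => \esum_(n in [set: nat]) (u n x)%:E) =
          (fun x => \sum_(n <oo | n \in xpredT) (u n x)%:E)%E.
  apply/funext => x; rewrite nneseries_esum; last by move=> n _; rewrite lee_fin.
  by congr esum; apply/seteqP; split.
apply: ge0_emeasurable_sum => [n x _ _|n _]; first by rewrite lee_fin.
exact/measurable_EFinP.
Qed.

Definition half_weight (n : nat) : R := 1 / (2 ^ n.+1)%:R.

Lemma half_weight_gt0 n : 0 < half_weight n.
Proof. by rewrite divr_gt0// ltr0n expn_gt0. Qed.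

Lemma half_weight_sum : \esum_(n in [set: nat]) (half_weight n)%:E = 1%E.
Proof.
rewrite -nneseries_esumT; last by move=> n; rewrite lee_fin ltW ?half_weight_gt0.
have := @cvg_geometric_eseries_half R 1 0; rewrite expr0 divr1 => /cvg_lim <-//.
by congr (limn (eseries _)); apply/funext => n; rewrite /half_weight addn1.
Qed.

Section Push.
Context (tau : nat -> X -> G) (w : nat -> X -> R).
Context (tt : forall n x, tgt GG (tau n x) = x) (w0 : forall n x, 0 <= w n x).
Context (w1 : forall x, \esum_(n in [set: nat]) (w n x)%:E = 1%E).

(** The law of [tau n x] when the index [n] is drawn with weights [w n x]; indices giving the same
    arrow add up. Sums over a fiber become sums over the natural numbers, which makes measurability
    accessible. *)
Definition push (h : G) : R :=
  fine (\esum_(n in [set n | tau n (tgt GG h) = h]) (w n (tgt GG h))%:E).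

Lemma pushE h : (push h)%:E = \esum_(n in [set n | tau n (tgt GG h) = h]) (w n (tgt GG h))%:E.
Proof.
rewrite fineK// ge0_fin_numE; last by apply: esum_ge0 => n _; rewrite lee_fin.
apply: (@le_lt_trans _ _ 1%E); last exact: ltry.
rewrite -(w1 (tgt GG h)) [leLHS]esum_mkcond; apply: le_esum => n _.
by case: ifP => // _; rewrite lee_fin.
Qed.

Lemma push_ge0 h : 0 <= push h.
Proof. by apply: fine_ge0; apply: esum_ge0 => n _; rewrite lee_fin. Qed.

Lemma push_gt0 n x : 0 < w n x -> 0 < push (tau n x).
Proof.
move=> wn; rewrite -lte_fin pushE; apply: (@lt_le_trans _ _ (w n x)%:E).
  by rewrite lte_fin.
by rewrite -{1}(tt n x); apply: esum_ge1 => [|j _]; rewrite /= ?tt// lee_fin.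
Qed.

Lemma push_sum x (F : G -> R) : (forall h, 0 <= F h) ->
  \esum_(h in tgt_fiber GG x) (push h * F h)%:E =
  \esum_(n in [set: nat]) (w n x * F (tau n x))%:E.
Proof.
move=> F0; transitivity (\esum_(h in tgt_fiber GG x)
    \esum_(n in [set n | tau n (tgt GG h) = h]) (w n x * F (tau n x))%:E).
  apply: eq_esum => h hx; rewrite mulrC EFinM pushE -esumZl//; last first.
    by move=> n _; rewrite lee_fin.
  by apply: eq_esum => n /= <-; rewrite tt hx -EFinM mulrC.
rewrite esum_esum; last by move=> h n _ _; rewrite lee_fin mulr_ge0.
apply: (reindex_esum _ _ (fun n => (tau n x, n))); split.
- by move=> n _ /=; rewrite /tgt_fiber /= tt.
- by move=> n m _ _ [].
- by move=> [h n] /= [hx hn]; exists n => //; rewrite -[in LHS]hx hn.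
Qed.

Lemma push_invariant : (forall n, measurable_fun setT (tau n)) ->
  (forall n, measurable_fun setT (w n)) -> invariant_markov GG push.
Proof.
move=> mt mw; split; first exact: push_ge0.
  move=> x; have := @push_sum x (fun=> 1) (fun=> ler01).
  under eq_esum do rewrite mulr1.
  by move=> ->; under eq_esum do rewrite mulr1.
move=> f mf f0.
have -> : markov_ge0_op GG push f =
    (fun g => \esum_(n in [set: nat])
      (w n (src GG g) * f (gmul GG g (tau n (src GG g))))%:E).
  by apply/funext => g; rewrite /markov_ge0_op -(push_sum _ (F := fun h => f (gmul GG g h))).
have ms := measurable_src BG.
apply: measurable_esum_nat => [n g|n]; first by rewrite mulr_ge0.
apply: measurable_funM; first exact: measurableT_comp (mw n) ms.
apply: measurableT_comp mf _; apply: (measurable_gmul_comp BG) => //.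
exact: measurableT_comp (mt n) ms.
Qed.
End Push.

Section Mix.
Context (theta : X -> R) (th01 : forall x, 0 <= theta x <= 1) (p q : G -> R).

Definition mix (h : G) := (1 - theta (tgt GG h)) * p h + theta (tgt GG h) * q h.

Lemma mix_sum x (F : G -> R) : (forall h, 0 <= p h) -> (forall h, 0 <= q h) ->
  (forall h, 0 <= F h) ->
  (\esum_(h in tgt_fiber GG x) (mix h * F h)%:E =
  (1 - theta x)%:E * (\esum_(h in tgt_fiber GG x) (p h * F h)%:E) +
  (theta x)%:E * (\esum_(h in tgt_fiber GG x) (q h * F h)%:E))%E.
Proof.
move=> p0 q0 F0; have /andP[t0 t1] := th01 x.
have t10 : 0 <= 1 - theta x by rewrite subr_ge0.
have pF h : (0 <= (p h * F h)%:E)%E by rewrite lee_fin mulr_ge0.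
have qF h : (0 <= (q h * F h)%:E)%E by rewrite lee_fin mulr_ge0.
rewrite -(esumZl t10)// -(esumZl t0)// -esumD; last 2 first.
- by move=> h _; rewrite mule_ge0 ?lee_fin// mulr_ge0.
- by move=> h _; rewrite mule_ge0 ?lee_fin// mulr_ge0.
by apply: eq_esum => h hx; rewrite /mix hx -!EFinM -EFinD mulrDl !mulrA.
Qed.

Lemma mix_invariant : measurable_fun setT theta -> invariant_markov GG p ->
  invariant_markov GG q -> invariant_markov GG mix.
Proof.
move=> mt [p0 p1 pm] [q0 q1 qm].
have m0 h : 0 <= mix h.
  have /andP[t0 t1] := th01 (tgt GG h).
  by rewrite addr_ge0// mulr_ge0// subr_ge0.
split => //.
  move=> x; have := @mix_sum x (fun=> 1) p0 q0 (fun=> ler01).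
  under eq_esum do rewrite mulr1.
  have -> : \esum_(h in tgt_fiber GG x) (p h * 1)%:E = 1%E.
    by under eq_esum do rewrite mulr1.
  have -> : \esum_(h in tgt_fiber GG x) (q h * 1)%:E = 1%E.
    by under eq_esum do rewrite mulr1.
  by rewrite !mule1 -EFinD subrK.
move=> f mf f0.
have -> : markov_ge0_op GG mix f = (fun g =>
   (1 - theta (src GG g))%:E * markov_ge0_op GG p f g +
   (theta (src GG g))%:E * markov_ge0_op GG q f g)%E.
  apply/funext => g.
  exact: (mix_sum _ (F := fun h => f (gmul GG g h)) p0 q0 (fun h => f0 _)).
have mts : measurable_fun setT (fun g => theta (src GG g)).
  exact: measurableT_comp mt (measurable_src BG).
apply: emeasurable_funD; apply: emeasurable_funM.
- by apply/measurable_EFinP; apply: measurable_funB.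
- exact: pm.
- exact/measurable_EFinP.
- exact: qm.
Qed.

End Mix.

Lemma nondegenerate_pos (p : G -> R) : (forall h, 0 < p h) -> nondegenerate_markov GG p.
Proof.
move=> p0 x; apply/seteqP; split => [g [n _ []]//|g gx].
by exists 0%N => //; split => //=; rewrite lte_fin.
Qed.

End Kernels.

(** * Infinite orbits *)

Section Orbits.
Context (R : realType) (dX dG : measure_display).
Context (X : measurableType dX) (G : measurableType dG) (GG : groupoid X G).

Definition orbit (x : X) : set X := [set y | orbit_relation GG (x, y)].

Lemma orbit_src g : orbit (tgt GG g) (src GG g).
Proof. by exists g. Qed.

Lemma orbit_eq x y : orbit x y -> orbit y = orbit x.
Proof.
have H x' y' : orbit x' y' -> orbit y' `<=` orbit x'.
  move=> [g _ [gx gy]] z [h _ [hy hz]].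
  have gh : src GG g = tgt GG h by rewrite gy hy.
  by exists (gmul GG g h) => //; rewrite tgt_mul// src_mul// gx hz.
move=> xy; apply/seteqP; split; first exact: H.
apply: H; have [g _ [<- <-]] := xy.
by exists (ginv GG g) => //; rewrite tgt_inv src_inv.
Qed.

Lemma orbit_refl x : orbit x x.
Proof. by exists (unit_at GG x); rewrite // tgt_unit src_unit. Qed.

Context (BG : discrete_borel_groupoid R GG) (sg : nat -> X -> G).
Context (msg : forall n, measurable_fun setT (sg n)).
Context (tsg : forall n x, tgt GG (sg n x) = x).
Context (sgP : forall g, exists n, sg n (tgt GG g) = g).
Context (V : nat -> set X) (sV : separating (range V)) (mV : forall k, measurable (V k)).

Definition ssg n x := src GG (sg n x).

Lemma measurable_ssg n : measurable_fun setT (ssg n).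
Proof. exact: (measurable_src_comp BG). Qed.

Lemma orbitP x y : orbit x y <-> exists n, ssg n x = y.
Proof.
split=> [[g _ [<- <-]]|[n <-]]; last by have := orbit_src (sg n x); rewrite tsg.
by have [n gn] := sgP g; exists n; rewrite /ssg gn.
Qed.

Lemma orbit_ssg n x : orbit x (ssg n x).
Proof. by apply/orbitP; exists n. Qed.

Definition code (y : X) n : seq bool := mkseq (fun k => `[< V k y >]) n.

Definition cylinder (s : seq bool) : set X := [set y | code y (size s) = s].

Lemma size_code y n : size (code y n) = n. Proof. exact: size_mkseq. Qed.

Lemma codeS y n : code y n.+1 = rcons (code y n) `[< V n y >].
Proof. exact: mkseqS. Qed.

Lemma code_inj y z : (forall n, code y n = code z n) -> y = z.
Proof.
move=> H; apply: sV => _ [k _ <-]; have := H k.+1; rewrite !codeS.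
by move=> /rcons_inj[_ E]; split=> ?; apply/asboolP; [rewrite -E|rewrite E]; exact/asboolP.
Qed.

Lemma measurable_code n s : measurable [set y | code y n = s].
Proof.
have -> : [set y | code y n = s] =
    [set y | size s = n /\ forall k, (k < n)%N -> (V k y <-> nth false s k)].
  apply/seteqP; split => y /=.
    move=> <-; rewrite size_code; split => // k kn; rewrite nth_mkseq//.
    exact: (rwP (asboolP _)).
  move=> [sn H]; apply: (@eq_from_nth _ false); rewrite ?size_code// => k kn.
  by rewrite nth_mkseq//; apply/asboolP/idP => /(H k kn).
apply: mset_and; first exact: mset_const.
apply: mset_all => k; apply: mset_imp; first exact: mset_const.
by apply: mset_iff; [exact: mV|exact: mset_const].
Qed.

Lemma measurable_cylinder s : measurable (cylinder s).
Proof. exact: measurable_code. Qed.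

(* The leftmost branch of the tree of cylinders meeting the orbit of [x] in a
   set satisfying [Q]. *)
Section Leftmost.
Context (Q : set X -> Prop).
Context (mQ : forall s, measurable [set x | Q (orbit x `&` cylinder s)]).
Context (QU : forall A B, Q (A `|` B) -> Q A \/ Q B).

Fixpoint leftmost x n : seq bool := if n is m.+1 then
  rcons (leftmost x m) (~~ `[< Q (orbit x `&` cylinder (rcons (leftmost x m) false)) >])
  else [::].

Lemma size_leftmost x n : size (leftmost x n) = n.
Proof. by elim: n => //= n IH; rewrite size_rcons IH. Qed.

Lemma leftmostP x n : Q (orbit x) -> Q (orbit x `&` cylinder (leftmost x n)).
Proof.
move=> Qx; elim: n => [|n IH] /=.
  by rewrite (_ : cylinder _ = setT) ?setIT//; apply/seteqP; split.
case: asboolP => //= nQ.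
have : Q ((orbit x `&` cylinder (rcons (leftmost x n) false)) `|`
          (orbit x `&` cylinder (rcons (leftmost x n) true))).
  rewrite -setIUr (_ : _ `|` _ = cylinder (leftmost x n))//.
  have cR b y : cylinder (rcons (leftmost x n) b) y <->
     code y n = leftmost x n /\ `[< V n y >] = b.
    rewrite /cylinder /= size_rcons size_leftmost codeS; split.
      by move=> /rcons_inj[].
    by move=> [-> ->].
  have c0 y : cylinder (leftmost x n) y <-> code y n = leftmost x n.
    by rewrite /cylinder /= size_leftmost.
  apply/seteqP; split => y; first by case=> /cR[? _]; exact/c0.
  by move=> /c0 yn; case E: `[< V n y >]; [right|left]; apply/cR.
by case/QU.
Qed.

Lemma leftmost_orbit x y n : orbit x y -> leftmost y n = leftmost x n.
Proof. by move=> /orbit_eq xy; elim: n => //= n ->; rewrite xy. Qed.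

Lemma measurable_leftmost n s : measurable [set x | leftmost x n = s].
Proof.
elim: n s => [|n IH] s; first exact: (@mset_const _ X ([::] = s)).
have -> : [set x | leftmost x n.+1 = s] = [set x | exists s' : seq bool,
    leftmost x n = s' /\
    (Q (orbit x `&` cylinder (rcons s' false)) /\ rcons s' false = s \/
     ~ Q (orbit x `&` cylinder (rcons s' false)) /\ rcons s' true = s)].
  apply/seteqP; split => x /=.
    move=> <-; exists (leftmost x n); split => //.
    by case: asboolP => /= ?; [left|right].
  by move=> [_ [<- []]]; case: asboolP => Qs /= [].
apply: mset_countex => s'; apply: mset_and; first exact: IH.
apply: mset_or; apply: mset_and; do ?exact: mset_const; first exact: mQ.
exact/mset_not/mQ.
Qed.

Lemma code_leftmost_le y n m : (m <= n)%N -> code y n = leftmost y n ->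
  code y m = leftmost y m.
Proof.
move=> /subnK <-; elim: (n - m)%N => // k IH; rewrite addSn codeS /=.
by move=> /rcons_inj[/IH].
Qed.

Lemma measurable_code_leftmost n : measurable [set y | code y n = leftmost y n].
Proof.
have -> : [set y | code y n = leftmost y n] =
    [set y | exists s : seq bool, code y n = s /\ leftmost y n = s].
  by apply/seteqP; split => y /= => [->|[s [-> ->]]//]; eexists.
apply: mset_countex => s; apply: mset_and; first exact: measurable_code.
exact: measurable_leftmost.
Qed.

End Leftmost.

Lemma measurable_orbit_meets s :
  measurable [set x | (orbit x `&` cylinder s) !=set0].
Proof.
have -> : [set x | (orbit x `&` cylinder s) !=set0] =
          [set x | exists n, cylinder s (ssg n x)].
  apply/seteqP; split => x /=; first by move=> [_ [/orbitP[n <-] ?]]; exists n.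
  by move=> [n ?]; exists (ssg n x); split => //; exact: orbit_ssg.
by apply: mset_ex => n; apply: mset_preim; [exact: measurable_ssg|exact: measurable_cylinder].
Qed.

Lemma measurable_orbit_infinite s :
  measurable [set x | infinite_set (orbit x `&` cylinder s)].
Proof.
have -> : [set x | infinite_set (orbit x `&` cylinder s)] =
    [set x | forall N, exists n, cylinder s (ssg n x) /\
       forall m, (m < N)%N -> ssg m x <> ssg n x].
  apply/seteqP; split => x /=.
    move=> inf N; apply: contrapT => /forallNP H; apply: inf.
    apply: (@sub_finite_set _ _ ((ssg^~ x) @` `I_N)).
      move=> _ [/orbitP[n <-] sn]; apply: contrapT => nim; apply: (H n); split=> //.
      by move=> m mN mn; apply: nim; exists m.
    exact: finite_image.
  move=> H fin; have [N NP] : exists N, forall y, (orbit x `&` cylinder s) y ->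
      exists2 m, (m < N)%N & ssg m x = y.
    have /finite_seqP[l lE] := fin.
    have : forall y, y \in l -> orbit x y.
      by move=> y yl; have : [set` l] y by []; rewrite -lE => -[].
    have : exists N, forall y, y \in l -> orbit x y -> exists2 m, (m < N)%N & ssg m x = y.
      elim: l {lE} => [|y l [N IH]]; first by exists 0%N.
      have [/orbitP[m my]|noy] := pselect (orbit x y).
        exists (maxn m.+1 N) => z; rewrite inE => /predU1P[-> _|/IH zN /zN[k kN kz]].
          by exists m => //; rewrite leq_max leqnn.
        by exists k => //; rewrite leq_max kN orbT.
      by exists N => z; rewrite inE => /predU1P[->//|/IH].
    move=> [N NP] _; exists N => y; rewrite lE => /= yl; apply: NP => //.
    by have : [set` l] y by []; rewrite -lE => -[].
  have [n [sn nP]] := H N; have [|m mN mn] := NP (ssg n x).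
    by split => //; exact: orbit_ssg.
  exact: nP mN mn.
apply: mset_all => N; apply: mset_ex => n; apply: mset_and.
  by apply: mset_preim; [exact: measurable_ssg|exact: measurable_cylinder].
apply: mset_all => m; apply: mset_imp; first exact: mset_const.
by apply: mset_not; apply: (mset_eqX BG); exact: measurable_ssg.
Qed.

End Orbits.

(** * Harmonic functions between subharmonic and superharmonic ones *)

Section Reduite.
Context (R : realType) (dX dG : measure_display).
Context (X : measurableType dX) (G : measurableType dG) (GG : groupoid X G).
Context (p : G -> R) (p0 : forall g, 0 <= p g).
Context (p1 : forall x, \esum_(h in tgt_fiber GG x) (p h)%:E = 1%E).

Definition mean (F : G -> R) g :=
  \esum_(h in tgt_fiber GG (src GG g)) (p h * F (gmul GG g h))%:E.

Lemma mean_le F F' g : (forall h, F h <= F' h) -> (mean F g <= mean F' g)%E.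
Proof. by move=> FF'; apply: le_esum => h _; rewrite lee_fin ler_wpM2l. Qed.

Lemma mean_one g : mean (fun=> 1) g = 1%E.
Proof. by rewrite /mean; under eq_esum do rewrite mulr1; exact: p1. Qed.

(* The least superharmonic majorant [F] of [u] is harmonic, since its mean is
   again a superharmonic majorant of [u]. *)
Lemma harmonic_between (u w : G -> R) : (forall g, 0 <= u g) ->
  (forall g, w g <= 1) -> (forall g, u g <= w g) ->
  (forall g, (u g)%:E <= mean u g)%E -> (forall g, mean w g <= (w g)%:E)%E ->
  exists F : G -> R, [/\ forall g, u g <= F g <= w g &
    forall g, mean F g = (F g)%:E].
Proof.
move=> u0 w1 uw su sw.
pose C := [set F : G -> R | (forall g, u g <= F g) /\
  forall g, (mean F g <= (F g)%:E)%E].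
have Cw : C w by [].
pose F g := inf [set f g | f in C].
have hlb g : has_lbound [set f g | f in C] by exists 0 => _ [f [uf _] <-]; exact: le_trans (uf g).
have FC f g : C f -> F g <= f g by move=> Cf; apply: ge_inf => //; exists f.
have uF g : u g <= F g.
  by apply: lb_le_inf; [exists (w g); exists w|move=> _ [f [uf _] <-]].
have Fw g : F g <= w g by exact: FC.
have mF f g : C f -> (mean F g <= (f g)%:E)%E.
  by move=> Cf; apply: le_trans (Cf.2 g); apply: mean_le => h; exact: FC.
have mF0 g : (0 <= mean F g)%E.
  by apply: esum_ge0 => h _; rewrite lee_fin mulr_ge0//; exact: le_trans (u0 _) (uF _).
have mFE g : (fine (mean F g))%:E = mean F g.
  by rewrite fineK// ge0_fin_numE//; apply: le_lt_trans (mF _ _ Cw) (ltry _).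
have mFF g : fine (mean F g) <= F g.
  apply: lb_le_inf; first by exists (w g); exists w.
  by move=> _ [f Cf <-]; rewrite -lee_fin mFE; exact: mF.
have CF : C (fun g => fine (mean F g)).
  split=> g; last by rewrite mFE; exact: mean_le.
  rewrite -lee_fin mFE; apply: le_trans (su g) _; exact: mean_le.
exists F; split => g; first by rewrite uF Fw.
by rewrite -mFE; congr EFin; apply/eqP; rewrite eq_le mFF (FC _ _ CF).
Qed.

End Reduite.

Section CountBelow.
Implicit Types P : nat -> Prop.

Fixpoint count_below P n := if n is m.+1 then (count_below P m + `[< P m >])%N else 0%N.

Lemma count_below_const P m n : (m <= n)%N ->
  (forall k, (m <= k < n)%N -> ~ P k) -> count_below P n = count_below P m.
Proof.
move=> /subnK <-; elim: (n - m)%N => // k IH H; rewrite addSn /= IH.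
  case: asboolP => [Pk|_]; last by rewrite addn0.
  by exfalso; apply: H Pk; rewrite leq_addl addSn ltnS leqnn.
by move=> j /andP[mj jk]; apply: H; rewrite mj addSn ltnS ltnW.
Qed.

(** Just past an element of [P] the count has grown by one, and it does not change before the next
    element, so no value is skipped. *)
Lemma count_below_surj P : (forall n, exists2 m, (n <= m)%N & P m) ->
  forall i, exists2 m, P m & count_below P m = i.
Proof.
move=> H; have next a : exists2 m, P m & count_below P m = count_below P a.
  have ex : exists m, (a <= m)%N && `[< P m >].
    by have [m am Pm] := H a; exists m; rewrite am; apply/asboolP.
  case: (ex_minnP ex) => m /andP[am /asboolP Pm] mmin; exists m => //.
  apply: count_below_const => // k /andP[ak km] Pk.
  by have := mmin k; rewrite ak leqNgt km (introT (asboolP _) Pk) => /(_ isT).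
elim=> [|i [m Pm <-]]; first by have [m Pm E] := next 0%N; exists m.
have [m' Pm' E] := next m.+1; exists m' => //.
by rewrite E /=; case: asboolP => // _; rewrite addn1.
Qed.

Lemma measurable_count_below d (T : measurableType d) (P : T -> nat -> Prop) n r :
  (forall k, measurable [set x | P x k]) -> measurable [set x | count_below (P x) n = r].
Proof.
move=> mP; elim: n r => [|n IH] r; first exact: (@mset_const _ T (0%N = r)).
have -> : [set x | count_below (P x) n.+1 = r] = [set x | exists s,
    count_below (P x) n = s /\ (P x n /\ s.+1 = r \/ ~ P x n /\ s = r)].
  apply/seteqP; split => x /=.
    move=> <-; eexists; split; first by [].
    by case: asboolP => ?; rewrite ?addn1 ?addn0; [left|right].
  by move=> [s [->]]; case: asboolP => Pn [] [] // _ <-; rewrite ?addn1 ?addn0.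
apply: mset_ex => s; apply: mset_and => //.
apply: mset_or; apply: mset_and; do ?exact: mset_const; first exact: mP.
exact/mset_not/mP.
Qed.

End CountBelow.

Section InfiniteOrbits.
Context (R : realType) (dX dG : measure_display).
Context (X : measurableType dX) (G : measurableType dG) (GG : groupoid X G).
Context (BG : discrete_borel_groupoid R GG) (sg : nat -> X -> G).
Context (msg : forall n, measurable_fun setT (sg n)).
Context (tsg : forall n x, tgt GG (sg n x) = x).
Context (sgP : forall g, exists n, sg n (tgt GG g) = g).
Context (V : nat -> set X) (sV : separating (range V)) (mV : forall k, measurable (V k)).
Local Notation orbit := (orbit GG).
Local Notation ssg := (ssg GG sg).
Local Notation code := (code V).
Local Notation Z := (leftmost GG V (fun A => infinite_set A)).

(* On an infinite orbit the codes cluster at the leftmost branch [Z], so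
   that the agreement of a code with [Z] is unbounded. *)
Definition level := least (fun n y => code y n <> Z y n).

Definition occupied x m := exists n, level (ssg n x) = m.

(** The levels occurring in an orbit may have gaps. Counting the occupied ones below that of [y]
    closes the gaps, so that a point two ranks higher always exists in an infinite orbit. *)
Definition rank y := count_below (occupied y) (level y).

Lemma measurable_level m : measurable [set y | level y = m].
Proof.
apply: measurable_least => n; apply: mset_not.
apply: measurable_code_leftmost => // s.
exact: (measurable_orbit_infinite BG).
Qed.

Lemma measurable_rank r : measurable [set y | rank y = r].
Proof.
have -> : [set y | rank y = r] =
    [set y | exists l, level y = l /\ count_below (occupied y) l = r].
  by apply/seteqP; split => y /= => [<-|[_ [<-]]//]; exists (level y).
apply: mset_ex => l; apply: mset_and; first exact: measurable_level.
apply: measurable_count_below => k; apply: mset_ex => n.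
apply: (mset_preim (f := ssg n) (A := [set y | level y = k])); last exact: measurable_level.
exact: (measurable_ssg BG).
Qed.

Lemma infinite_setU_or (A B : set X) : infinite_set (A `|` B) ->
  infinite_set A \/ infinite_set B.
Proof.
move=> H; have [fA|] := pselect (finite_set A); last by left.
by right => fB; apply: H; rewrite finite_setU.
Qed.

Lemma occupiedP x m : occupied x m <-> exists2 y, orbit x y & level y = m.
Proof.
split=> [[n nm]|[y /(orbitP tsg sgP)[n <-] ym]]; last by exists n.
by exists (ssg n x) => //; exact: orbit_ssg.
Qed.

Lemma occupied_orbit x y : orbit x y -> occupied y = occupied x.
Proof.
move=> /orbit_eq xy; apply/funext => m; apply/propext.
by rewrite !occupiedP xy.
Qed.

(** The cylinder of [Z x n] meets the orbit in infinitely many points, at most one of which has the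
    whole branch as its code. Any other one departs from the branch, but not before depth [n]. *)
Lemma level_unbounded x : infinite_set (orbit x) ->
  forall n, exists2 m, (n <= m)%N & occupied x m.
Proof.
move=> infx n; 
have inf : infinite_set (orbit x `&` cylinder V (Z x n)).
  exact: (leftmostP (Q := fun A => infinite_set A) V infinite_setU_or n infx).
have [y [oy cy] [k nk]] : exists2 y, (orbit x `&` cylinder V (Z x n)) y &
    exists k, code y k <> Z y k.
  apply: contrapT => H; apply: inf.
  have all y : (orbit x `&` cylinder V (Z x n)) y -> forall k, code y k = Z x k.
    move=> [oy cy] k; rewrite -(leftmost_orbit _ _ _ oy); apply: contrapT => nk.
    by apply: H; exists y => //; exists k.
  have [[y0 Ay0]|nA] := pselect ((orbit x `&` cylinder V (Z x n)) !=set0).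
    apply: (@sub_finite_set _ _ [set y0]) => // y Ay.
    by apply: (code_inj sV) => k; rewrite (all _ Ay) (all _ Ay0).
  rewrite (_ : _ `&` _ = set0)//; apply/seteqP; split => // y Ay.
  by apply: nA; exists y.
have lP := leastP (P := fun n y => code y n <> Z y n) (ex_intro _ k nk).
exists (level y); last by apply/occupiedP; exists y.
rewrite leqNgt; apply/negP => ln; apply: lP.
apply: code_leftmost_le (ltnW ln) _.
by rewrite (leftmost_orbit _ _ _ oy); move: cy; rewrite /cylinder /= size_leftmost.
Qed.

Lemma rank_surj x i : infinite_set (orbit x) -> exists2 y, orbit x y & rank y = i.
Proof.
move=> /level_unbounded/count_below_surj/(_ i)[m /occupiedP[y oy ym] mi].
by exists y => //; rewrite /rank (occupied_orbit oy) ym.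
Qed.

Definition jump_index := least (fun n y => rank (ssg n y) = (rank y).+2).

Definition jump y := sg (jump_index y) y.

Lemma measurable_jump : measurable_fun setT jump.
Proof.
apply: measurable_fun_countable => // k; apply: measurable_least => n.
have -> : [set y | rank (ssg n y) = (rank y).+2] =
    [set y | exists r, rank y = r /\ rank (ssg n y) = r.+2].
  by apply/seteqP; split => y /= => [->|[r [-> ->]]//]; exists (rank y).
apply: mset_ex => r; apply: mset_and; first exact: measurable_rank.
apply: (mset_preim (f := ssg n) (A := [set y | rank y = r.+2])); last exact: measurable_rank.
exact: (measurable_ssg BG).
Qed.

Lemma rank_jump y : infinite_set (orbit y) -> rank (src GG (jump y)) = (rank y).+2.
Proof.
move=> infy; have [z /(orbitP tsg sgP)[n nz] rz] := rank_surj (rank y).+2 infy.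
by apply: (leastP (P := fun n y => rank (ssg n y) = (rank y).+2)); exists n; rewrite nz.
Qed.

(** This is 2^-(r+2), a bound for the probability of ever slipping from rank [r] on. The slip at
    rank [r] is [delta r - delta r.+2], so that the slips at ranks [r], [r+2], and so on telescope
    to [delta r]. *)
Definition delta (r : nat) : R := half_weight R r.+1.

Definition slip y : R := delta (rank y) - delta (rank y).+2.

Lemma delta_bounds r : 0 < delta r <= 1 / 4 /\ delta r.+2 = delta r / 4.
Proof.
rewrite half_weight_gt0 /= /delta /half_weight; split.
  rewrite ler_pM2l// lef_pV2 ?posrE ?ltr0n ?expn_gt0// ler_nat.
  by rewrite !expnS !mulnA leq_pmulr// expn_gt0.
by rewrite !expnS !natrM; field; rewrite ?pnatr_eq0 -?lt0n ?expn_gt0.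
Qed.

Lemma slip_bounds y : 0 < slip y <= 1.
Proof. by rewrite /slip; have [/andP[d0 d1] ->] := delta_bounds (rank y); lra. Qed.

(** The deterministic jump is written as a [push] that ignores its index. The other part charges
    every arrow, and as [slip] is positive this gives non-degeneracy. *)
Definition drift : G -> R := mix GG slip
  (push GG (fun=> jump) (fun n _ => half_weight R n))
  (push GG sg (fun n _ => half_weight R n)).

Let hw0 n (x : X) : 0 <= half_weight R n.
Proof. exact/ltW/half_weight_gt0. Qed.

Let hw1 (x : X) : \esum_(n in [set: nat]) (half_weight R n)%:E = 1%E.
Proof. exact: half_weight_sum. Qed.

Let tjump (n : nat) x : tgt GG (jump x) = x.
Proof. exact: tsg. Qed.

Let slip01 x : 0 <= slip x <= 1.
Proof. by have /andP[/ltW-> ->] := slip_bounds x. Qed.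

Lemma drift_invariant : invariant_markov GG drift.
Proof.
apply: (mix_invariant BG) => //.
- apply: (measurable_fun_countable (f := fun r _ => delta r - delta r.+2)).
    exact: measurable_rank.
  by move=> k; exact: measurable_cst.
- by apply: push_invariant => // n; exact: measurable_jump.
- by apply: push_invariant.
Qed.

Lemma drift_gt0 g : 0 < drift g.
Proof.
rewrite /drift /mix; have /andP[s0 s1] := slip_bounds (tgt GG g).
rewrite ltr_wpDl//; first by rewrite mulr_ge0 ?subr_ge0// push_ge0.
rewrite mulr_gt0//; have [n gn] := sgP g.
by rewrite -gn push_gt0// half_weight_gt0.
Qed.

(** Only the jump is evaluated; the other part has mass [slip] and is merely bounded between 0 and
    [slip]. *)
Lemma mean_drift F g : (forall h, 0 <= F h <= 1) ->
  (((1 - slip (src GG g)) * F (gmul GG g (jump (src GG g))))%:E <= mean GG drift F g <=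
  ((1 - slip (src GG g)) * F (gmul GG g (jump (src GG g))) + slip (src GG g))%:E)%E.
Proof.
move=> F01; have F0 h : 0 <= F h by have /andP[] := F01 h.
rewrite /mean (mix_sum GG slip01 _ (F := fun h => F (gmul GG g h)))//; try exact: push_ge0.
rewrite (push_sum tjump hw0 hw1 _ (F := fun h => F (gmul GG g h)))//.
rewrite (push_sum tsg hw0 hw1 _ (F := fun h => F (gmul GG g h)))//.
set s := slip _; have /andP[s0 s1] : 0 < s <= 1 := slip_bounds _.
have hwp n : 0 <= half_weight R n by exact/ltW/half_weight_gt0.
have -> : \esum_(n in [set: nat]) (half_weight R n * F (gmul GG g (jump (src GG g))))%:E =
    (F (gmul GG g (jump (src GG g))))%:E.
  under eq_esum do rewrite mulrC EFinM.
  by rewrite esumZl// ?half_weight_sum ?mule1// => n _; rewrite lee_fin hwp.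
set E := esum _ _.
have E0 : (0 <= E)%E by apply: esum_ge0 => n _; rewrite lee_fin mulr_ge0.
have E1 : (E <= 1)%E.
  rewrite -half_weight_sum; apply: le_esum => n _; rewrite lee_fin -[leRHS]mulr1.
  by rewrite ler_wpM2l//; have /andP[] := F01 (gmul GG g (sg n (src GG g))).
have sE : (0 <= s%:E * E <= s%:E)%E.
  rewrite mule_ge0 ?lee_fin ?(ltW s0)//= -[leRHS]mule1.
  by apply: lee_wpmul2l => //; rewrite lee_fin ltW.
have /andP[sE0 sE1] := sE.
apply/andP; split; first by rewrite -EFinM leeDl.
by rewrite [leRHS]EFinD EFinM; apply: leeD2l.
Qed.

(** A harmonic function between [u] and [w] is at least 3/4 at rank 0 and at most 1/4 at rank 1, and
    an infinite orbit has points of both ranks. *)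
Lemma drift_not_liouville x : infinite_set (orbit x) -> ~ liouville_at GG drift x.
Proof.
move=> infx; have [d0 d1 _] := drift_invariant.
move=> /(liouville_atP _ d0 d1) L.
pose rk g := rank (src GG g).
(* With [d = delta r], [d' = delta r.+2] and slip [d - d'], [u] is subharmonic because
   [(1 - (d - d')) * (1 - d') >= 1 - d], and [w] is superharmonic because
   [(1 - (d - d')) * d' + (d - d') <= d]. At the other arrows the values 0 and 1 satisfy the
   inequalities trivially. *)
pose u g : R := if (tgt GG g == x) && ~~ odd (rk g) then 1 - delta (rk g) else 0.
pose w g : R := if (tgt GG g == x) && odd (rk g) then delta (rk g) else 1.
have dlt r : 0 < delta r <= 1 / 4 by have [] := delta_bounds r.
have u01 g : 0 <= u g <= 1.
  by rewrite /u; have /andP[? ?] := dlt (rk g); case: ifP => _; lra.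
have w01 g : 0 <= w g <= 1.
  by rewrite /w; have /andP[? ?] := dlt (rk g); case: ifP => _; lra.
have uw g : u g <= w g.
  rewrite /u /w; have /andP[? ?] := dlt (rk g).
  by case: (tgt GG g == x); case: (odd (rk g)) => /=; lra.
have jx g : tgt GG g = x -> let h := gmul GG g (jump (src GG g)) in
    tgt GG h = x /\ rk h = (rk g).+2.
  move=> gx /=; have cg : src GG g = tgt GG (jump (src GG g)) by rewrite tsg.
  rewrite tgt_mul// /rk src_mul//; split => //; apply: rank_jump.
  by rewrite (orbit_eq (x := x))//; rewrite -gx; exact: orbit_src.
have su g : ((u g)%:E <= mean GG drift u g)%E.
  have [/andP[/eqP gx og]|ng] := boolP ((tgt GG g == x) && ~~ odd (rk g)); last first.
    rewrite {1}/u (negPf ng); apply: esum_ge0 => h _; rewrite lee_fin mulr_ge0//.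
    by have /andP[] := u01 (gmul GG g h).
  have [hx hr] := jx _ gx; have /andP[+ _] := mean_drift g u01.
  apply: le_trans; rewrite lee_fin /u hx gx eqxx hr /= negbK og.
  have [/andP[? ?] d2] := delta_bounds (rk g).
  by rewrite /slip -/(rk g) d2; nra.
have sw g : (mean GG drift w g <= (w g)%:E)%E.
  have [/andP[/eqP gx og]|ng] := boolP ((tgt GG g == x) && odd (rk g)); last first.
    rewrite {2}/w (negPf ng) -(mean_one d1 g); apply: mean_le => // h.
    by have /andP[] := w01 h.
  have [hx hr] := jx _ gx; have /andP[_ /le_trans] := mean_drift g w01.
  apply; rewrite lee_fin /w hx gx eqxx hr /= negbK og.
  have [/andP[? ?] d2] := delta_bounds (rk g).
  by rewrite /slip -/(rk g) d2; nra.
have [F [uFw hF]] := harmonic_between d0 (fun g => (andP (u01 g)).1)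
  (fun g => (andP (w01 g)).2) uw su sw.
have [|g _|k kP] := L F.
- move=> g _; have /andP[? ?] := uFw g; have /andP[? ?] := u01 g; have /andP[? ?] := w01 g.
  by apply/andP; split; lra.
- exact: hF.
have [y0 oy0 r0] := rank_surj 0 infx; have [y1 oy1 r1] := rank_surj 1 infx.
have [g0 _ [g0x g0y]] := oy0; have [g1 _ [g1x g1y]] := oy1.
have := uFw g0; have := uFw g1; rewrite (kP _ g0x) (kP _ g1x) /u /w /rk.
rewrite g0x g1x eqxx g0y g1y r0 r1 /=.
have /andP[a0 a1] := dlt 0%N; have /andP[b0 b1] := dlt 1%N.
move=> /andP[k1 k2] /andP[k3 k4]; suff : (1 : R) < 1 by rewrite ltxx.
lra.
Qed.

End InfiniteOrbits.

(** * Measurable selection *)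

Section Selection.
Context (R : realType) (d : measure_display) (X : measurableType d) (mu : probability X R).

(** Intersecting near-minimizers gives a measurable superset of [S] of least measure. If [M] misses
    [S], removing [M] leaves a superset of [S], so by minimality the part removed is null. *)
Lemma measurable_hull (S : set X) : exists H, [/\ measurable H, S `<=` H &
  forall M, measurable M -> S `&` M = set0 -> mu (H `&` M) = 0%E].
Proof.
pose C := [set H : set X | measurable H /\ S `<=` H].
pose v := ereal_inf [set mu H | H in C].
have v0 : (0 <= v)%E by apply: le_ereal_inf_tmp => _ [H [mH _] <-].
have v1 : (v <= 1)%E.
  by apply: ereal_inf_lbound; exists setT; [split|rewrite probability_setT].
have vfin : v \is a fin_num by rewrite ge0_fin_numE//; apply: le_lt_trans v1 (ltry _).
have ex n : exists H, C H /\ (mu H <= v + (n.+1%:R^-1)%:E)%E.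
  have n0 : 0 < (n.+1%:R^-1 : R) by rewrite invr_gt0.
  have [_ [H CH <-] Hv] := lb_ereal_inf_adherent n0 vfin.
  by exists H; split => //; exact: ltW.
have [H HP] := choice ex.
have mH n : measurable (H n) by have [[]] := HP n.
have mHH : measurable (\bigcap_n H n) by exact: bigcapT_measurable.
have SH : S `<=` \bigcap_n H n by move=> x Sx n _; have [[_ SH] _] := HP n; exact: SH.
exists (\bigcap_n H n); split => // M mM SM.
have muH : (mu (\bigcap_n H n) <= v)%E.
  apply/lee_addgt0Pr => e e0; pose n := Num.truncn e^-1.
  apply: (@le_trans _ _ (mu (H n))); first by apply: le_measure; rewrite ?inE//; exact: bigcap_inf.
  have [_ Hn] := HP n; apply: le_trans Hn _; apply: leeD2l; rewrite lee_fin.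
  rewrite -[leRHS]invrK lef_pV2 ?posrE ?invr_gt0//; exact/ltW/truncnS_gt.
have vD : (v <= mu (\bigcap_n H n `\` M))%E.
  apply: ereal_inf_lbound; exists (\bigcap_n H n `\` M) => //; split.
    exact: measurableD.
  move=> x Sx; split; first exact: SH.
  by move=> Mx; have : (S `&` M) x by []; rewrite SM.
have muI0 : (0 <= mu (\bigcap_n H n `&` M))%E by [].
have fD : mu (\bigcap_n H n `\` M) \is a fin_num.
  by apply: fin_num_measure; exact: measurableD.
have := le_trans muH vD; rewrite (measureDI mu mHH mM) -[leRHS]adde0 leeD2lE//.
by move=> muI; apply/eqP; rewrite eq_le muI muI0.
Qed.

Context (dT : measure_display) (T : measurableType dT) (W : nat -> set T) (bW : resolving_base W).
Context (V : nat -> set X) (sV : separating (range V)) (mV : forall k, measurable (V k)).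
Context (pr : T -> X) (mpr : measurable_fun setT pr) (t0 : X -> T).

(* Off a null set the measurable hulls of the projections of the pieces of [A]
   are covered by those of their subpieces, so that the leftmost branch through
   hulls containing [x] converges to a point of [A] above [x]. *)
Theorem measurable_selection (A : set T) : measurable A -> exists B N sel,
  [/\ measurable B, measurable N, mu N = 0%E, pr @` A `<=` B `|` N &
    [/\ forall x, B x -> A (sel x) /\ pr (sel x) = x &
        forall E, measurable E -> measurable [set x | B x /\ E (sel x)]]].
Proof.
(* Adjoining [A] and the preimages of the [V k] makes the limit of a branch of pieces lie in [A] and
   the projection continuous along it. *)
move=> mA; pose E c := if c is k.+1 then pr @^-1` V k else A.
have mE c : measurable (E c) by case: c => //= k; exact: mset_preim.
have [Q [cQ mQ rQ]] := resolvable_seq bW mE.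
have [sW mW _ gW] := bW.
pose P s := A `&` cell Q s.
have [H0 H0P] := choice (fun s => measurable_hull (pr @` P s)).
(* The hull is cut by every [V k] that contains or misses the projection of the piece; a point lying
   in these sets along a branch is then the projection of the limit. Nonemptiness of [P s] is what
   lets the branch converge. *)
pose H s := [set x | H0 s x /\ P s !=set0 /\
  forall k, (pr @` P s `<=` V k -> V k x) /\ (pr @` P s `<=` ~` V k -> ~ V k x)].
have mH s : measurable (H s).
  apply: mset_and; first by have [] := H0P s.
  apply: mset_and; first exact: mset_const.
  apply: mset_all => k; apply: mset_and; apply: mset_imp; do ?exact: mset_const.
    exact: mV.
  exact/mset_not/mV.
have PH s : pr @` P s `<=` H s.
  move=> x Px; have [_ H0s _] := H0P s; split; first exact: H0s.
  split; first by case: Px => z Pz _; exists z.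
  by move=> k; split; exact.
(* Points at which the branch could get stuck. They form a null set, since the projection of [P s]
   misses the complement of the hulls of the subpieces. *)
pose Ns s := H s `\` \bigcup_i H (rcons s i).
have mNs s : measurable (Ns s) by apply: measurableD => //; exact: bigcup_measurable.
have Ns0 s : mu (Ns s) = 0%E.
  have [mH0 _ H0m] := H0P s.
  have mC : measurable (~` \bigcup_i H (rcons s i)).
    by apply: measurableC; exact: bigcup_measurable.
  apply: (@subset_measure0 _ _ _ mu _ (H0 s `&` ~` \bigcup_i H (rcons s i))) => //.
    exact: measurableI.
    by move=> x [[H0x _] nH]; split.
  apply: H0m => //; apply/seteqP; split => // x [[z [Az cz] <-]]; apply.
  have [i Qi] := cQ (size s) z; exists i => //; apply: PH; exists z => //.
  by split => //; exact/cell_rcons.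
pose dec c := odflt [::] (@unpickle (seq nat) c).
pose N := \bigcup_c Ns (dec c).
have mN : measurable N by exact: bigcup_measurable.
have N0 : mu N = 0%E.
  have nN : mu.-negligible N.
    by apply: negligible_bigcup => c; exists (Ns (dec c)); split;
      [exact: mNs|exact: Ns0|exact: subset_refl].
  exact: measure_negligible.
have NsN s : Ns s `<=` N by move=> x Nx; exists (pickle s); rewrite // /dec pickleK.
pose B := H [::] `\` N.
have mB : measurable B by exact: measurableD.
pose br := fix br n x : seq nat := if n is m.+1 then
  rcons (br m x) (least (fun i x => H (rcons (br m x) i) x) x) else [::].
have size_br n x : size (br n x) = n by elim: n => //= n IH; rewrite size_rcons IH.
have brE n x : br n x = mkseq (fun k => nth 0%N (br k.+1 x) k) n.
  elim: n => // n IH; rewrite mkseqS -IH /= nth_rcons size_br ltnn eqxx //.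
have Hbr n x : B x -> H (br n x) x.
  move=> [Hx nN]; elim: n => //= n IH; apply: (leastP (P := fun i x => H (rcons (br n x) i) x)).
  apply: contrapT => nex; apply: nN; apply: (NsN (br n x)); split => // -[i _ Hi].
  by apply: nex; exists i.
have mbr n s : measurable [set x | br n x = s].
  elim: n s => [|n IH] s; first exact: (@mset_const _ X ([::] = s)).
  have -> : [set x | br n.+1 x = s] = [set x | exists t : seq nat, exists i : nat,
      br n x = t /\ (least (fun i x => H (rcons (br n x) i) x) x = i /\ rcons t i = s)].
    apply/seteqP; split => x /=; last by move=> [t [i [-> [-> ->]]]].
    by move=> <-; exists (br n x); eexists; split => //; split.
  apply: mset_countex => t; apply: mset_ex => i; apply: mset_and => //.
  apply: mset_and; last exact: mset_const.
  apply: measurable_least => j.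
  have -> : [set x | H (rcons (br n x) j) x] =
      [set x | exists t : seq nat, br n x = t /\ H (rcons t j) x].
    by apply/seteqP; split => x /=; [move=> Hx; exists (br n x)|move=> [u [->]]].
  by apply: mset_countex => u; apply: mset_and => //; exact: mH.
have Pbr n x : B x -> P (br n x) !=set0 by move=> /(Hbr n)[_ []].
have lim x : exists z, B x -> forall F, (range W `|` range E) F ->
    exists n, forall y, cell Q (br n x) y -> (F y <-> F z).
  have [Bx|nBx] := pselect (B x).
    have [n|z zP] := rQ (fun k => nth 0%N (br k.+1 x) k).
      by rewrite -brE; have [y [_ ?]] := Pbr n _ Bx; exists y.
    exists z => _ F /zP[n nP]; exists n => y; rewrite brE; exact: nP.
  by exists (t0 x).
have [sel selP] := choice lim.
have piece_mono x m n : (m <= n)%N -> cell Q (br n x) `<=` cell Q (br m x).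
  by move=> mn y; rewrite [br n x]brE [br m x]brE; exact: cell_le.
exists B, N, sel; split => //.
- move=> x Ax; have [Nx|nN] := pselect (N x); [by right|left; split => //].
  by apply: PH; case: Ax => z Az zx; exists z.
split=> [x Bx|].
  have limx := selP x Bx; split.
    have [|n nP] := limx A; first by right; exists 0%N.
    by have [y [Ay cy]] := Pbr n _ Bx; apply/(nP y).
  apply: sV => _ [k _ <-].
  have [|n nP] := limx (pr @^-1` V k); first by right; exists k.+1.
  have [_ [_ /(_ k)[HV HnV]]] := Hbr n _ Bx.
  have [Vz|nVz] := pselect (V k (pr (sel x))).
    by split=> // _; apply: HV => _ [y [_ /nP[_ yV]] <-]; exact: yV.
  split => // Vx; exfalso; apply: (HnV _ Vx) => _ [y [_ /nP[yV _]] <-] /yV.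
  exact: nVz.
suff H1 : <<s range W >> `<=` [set E | measurable [set x | B x /\ E (sel x)]].
  by move=> F /gW/H1.
apply: smallest_sub; last first.
  move=> _ [k _ <-] /=.
  (* Membership of the limit in [W k] is settled at some finite depth, hence depends on countably
     many finite branches. *)
  have -> : [set x | B x /\ W k (sel x)] = [set x | B x /\ exists n, exists s : seq nat,
      br n x = s /\ P s `<=` W k].
    apply/seteqP; split => x [Bx Wx]; split => //.
      have [|n nP] := selP x Bx (W k); first by left; exists k.
      by exists n, (br n x); split => // y [_ /nP[_]]; exact.
    have [n [s [<- PW]]] := Wx.
    have [|n' nP] := selP x Bx (W k); first by left; exists k.
    have [y [Ay cy]] := Pbr (maxn n n') _ Bx.
    apply/(nP y); first exact: piece_mono (leq_maxr _ _) _ cy.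
    by apply: PW; split => //; exact: piece_mono (leq_maxl _ _) _ cy.
  apply: mset_and => //; apply: mset_ex => n; apply: mset_countex => s.
  by apply: mset_and => //; exact: mset_const.
split=> [|F mF|F mF] /=.
- by rewrite [X in measurable X](_ : _ = set0)//; apply/seteqP; split => x // [].
- rewrite [X in measurable X](_ : _ = B `\` [set x | B x /\ F (sel x)]).
    exact: measurableD.
  apply/seteqP; split => x /= [Bx nF]; split => //; first by case: nF => _ nF [_ /nF].
  by split => // Fx; apply: nF.
rewrite [X in measurable X](_ : _ = \bigcup_n [set x | B x /\ F n (sel x)]).
  by apply: bigcup_measurable => n _; exact: mF.
apply/seteqP; split => x; first by move=> [Bx [n _ Fx]]; exists n.
by move=> [n _ [Bx Fx]]; split => //; exists n.
Qed.

End Selection.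

(** * Resolving bases for real sequences and for the unit space *)

Section RealBase.
Context (R : realType).

Lemma second_countable_real : @second_countable R.
Proof.
pose B := [set `](ratr ab.1 : R), ratr ab.2[%classic | ab in [set: rat * rat]].
exists B.
  apply: card_le_trans (card_image_le _ _) _; exact: countableP.
split; first by move=> _ [ab _ <-]; exact: interval_open.
move=> x A /nbhs_ballP[e /= e0 xA].
have /rat_in_itvoo[a] : x - e < x by rewrite ltrBlDr ltrDl.
rewrite in_itv /= => /andP[ax xa].
have /rat_in_itvoo[b] : x < x + e by rewrite ltrDl.
rewrite in_itv /= => /andP[bx xb].
exists `](ratr a : R), ratr b[%classic.
  by split; [exists (a, b)|rewrite /= in_itv /= xa bx].
move=> y /=; rewrite in_itv /= => /andP[ay yb]; apply: xA.
rewrite /ball /= ltr_distlC; lra.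
Qed.

Lemma standard_borel_real : standard_borel R R.
Proof.
exists (R : completePseudoMetricType R), id; split.
- exact: norm_hausdorff.
- exact: second_countable_real.
- by exists id.
move=> A; rewrite image_id; split=> [mA|].
  have : (@RGenOpens.G R).-sigma.-measurable A by rewrite -RGenOpens.measurableE.
  apply: sub_sigma_algebra2 => _ [x [y ->]]; exact: interval_open.
apply: smallest_sub; first exact: sigma_algebra_measurable.
exact: open_measurable.
Qed.

End RealBase.

Lemma sigma_algebra_preimage_sub (T T' : Type) (f : T -> T') (GT : set (set T))
    (GT' : set (set T')) : (forall E, GT' E -> <<s GT >> (f @^-1` E)) ->
  forall E, <<s GT' >> E -> <<s GT >> (f @^-1` E).
Proof.
move=> H; suff : <<s GT' >> `<=` [set E | <<s GT >> (f @^-1` E)] by [].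
apply: smallest_sub => //; split => [|E sE|E sE] /=.
- by rewrite preimage_set0; exact: sigma_algebra0.
- by rewrite setTD preimage_setC -setTD; exact: sigma_algebraCD.
- by rewrite preimage_bigcup; exact: sigma_algebra_bigcup.
Qed.

Section SequenceBase.
Context (R : realType) (dX : measure_display) (X : measurableType dX).
Context (V : nat -> set X) (bV : resolving_base V).

Definition real_seq_gen : set (set (nat -> R)) :=
  [set E | exists m, exists2 A, measurable A & E = (fun z => z m) @^-1` A].

Definition real_seq := g_sigma_algebraType real_seq_gen.

Lemma measurable_coord m : measurable_fun setT (fun z : real_seq => z m : R).
Proof.
apply: measurable_fun_mset => A mA; apply: sub_sigma_algebra.
by exists m, A.
Qed.

(** The covers of the factors are interleaved and the limit is taken coordinatewise. In a decoded
    index the first component is 0 for the factor [X] and [m+1] for the real coordinate [m]. *)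
Lemma resolving_base_product : exists W : nat -> set (X * real_seq), resolving_base W.
Proof.
have [WR [sR mR [QR [cQR mQR rQR]] gR]] := standard_borel_base (standard_borel_real R).
have [sX mX [QX [cQX mQX rQX]] gX] := bV.
pose dec k := odflt (0, 0)%N (@unpickle (nat * nat)%type k).
have decK (p : nat * nat) : dec (pickle p) = p by rewrite /dec pickleK.
pose lift (A : nat -> set X) (B : nat -> set R) c : set (X * real_seq) :=
  if (dec c).1 is m.+1 then [set t | B (dec c).2 (t.2 m)] else [set t | A (dec c).2 t.1].
have mfst : measurable_fun setT (fun t : X * real_seq => t.1) by exact: measurable_fst.
have msnd m : measurable_fun setT (fun t : X * real_seq => t.2 m : R).
  exact: measurableT_comp (measurable_coord m) measurable_snd.
pose W := lift V WR.
have mlift A B c : (forall k, measurable (A k)) -> (forall k, measurable (B k)) ->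
    measurable (lift A B c).
  move=> mA mB; rewrite /lift; case: (dec c) => [[|m] k] /=; first exact: mset_preim.
  exact: mset_preim (msnd m) (mB k).
have WV k : range W [set t | V k t.1].
  by exists (pickle (0%N, k)) => //; rewrite /W /lift decK.
have WRm m k : range W [set t | WR k (t.2 m)].
  by exists (pickle (m.+1, k)) => //; rewrite /W /lift decK.
exists W; split.
- move=> [x z] [x' z'] H; congr pair.
    by apply: sX => _ [k _ <-]; exact: (H _ (WV k)).
  apply/funext => m; apply: sR => _ [k _ <-]; exact: (H _ (WRm m k)).
- by move=> c; exact: mlift.
- exists (fun c i => lift (QX^~ i) (QR^~ i) c); split.
  + move=> c t; rewrite /lift; case: (dec c) => [[|m] k] /=; last exact: cQR.
    exact: cQX.
  + by move=> c i; exact: mlift.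
  move=> a ane; pose Q c i := lift (QX^~ i) (QR^~ i) c.
  pose am (m n : nat) := a (pickle (m, n)).
  have sub (m N : nat) : exists M, forall t, cell Q (mkseq a M) t ->
      forall n, (n < N)%N -> Q (pickle (m, n)) (am m n) t.
    exists (\max_(n < N) (pickle (m, n : nat)).+1)%N => t /cell_mkseq H n nN.
    apply: H.
    exact: (@leq_bigmax _ (fun n : 'I_N => (pickle (m, n : nat)).+1) (Ordinal nN)).
  have subX N : exists M, forall t, cell Q (mkseq a M) t -> cell QX (mkseq (am 0%N) N) t.1.
    have [M MP] := sub 0%N N; exists M => t /MP H; apply/cell_mkseq => n /H.
    by rewrite /Q /lift decK.
  have subR m N : exists M, forall t, cell Q (mkseq a M) t ->
      cell QR (mkseq (am m.+1) N) (t.2 m).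
    have [M MP] := sub m.+1 N; exists M => t /MP H; apply/cell_mkseq => n /H.
    by rewrite /Q /lift decK.
  have [n|x xP] := rQX (am 0%N).
    by have [M MP] := subX n; have [t /MP] := ane M; exists t.1.
  have limR m : exists r, forall E, range WR E -> exists n, forall y,
      cell QR (mkseq (am m.+1) n) y -> (E y <-> E r).
    apply: rQR => n.
    by have [M MP] := subR m n; have [t /MP] := ane M; exists (t.2 m).
  have [z zP] := choice limR.
  exists (x, z) => _ [c _ <-]; rewrite /W /lift; case: (dec c) => [[|m] k] /=.
    have [|n nP] := xP (V k); first by exists k.
    by have [M MP] := subX n; exists M => t /MP/nP.
  have [|n nP] := zP m (WR k); first by exists k.
  by have [M MP] := subR m n; exists M => t /MP/nP.
move=> A; apply: smallest_sub; first exact: smallest_sigma_algebra.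
move=> E [] [B mB <-]; rewrite setTI.
  apply: (@sigma_algebra_preimage_sub _ _ fst _ (range V)); last exact: gX.
  by move=> _ [k _ <-]; apply: sub_sigma_algebra; exact: WV.
apply: (@sigma_algebra_preimage_sub _ _ snd _ real_seq_gen); last exact: mB.
move=> _ [m [C mC ->]].
apply: (@sigma_algebra_preimage_sub _ _ (fun t : X * real_seq => t.2 m) _ (range WR)).
  by move=> _ [k _ <-]; apply: sub_sigma_algebra; exact: WRm.
exact: gR.
Qed.

End SequenceBase.

Section UnitBase.
Context (R : realType) (dX dG : measure_display).
Context (X : measurableType dX) (G : measurableType dG) (GG : groupoid X G).
Context (BG : discrete_borel_groupoid R GG).

(** The base of the arrows is restricted along [unit_at]. The range of units is adjoined first, so
    that the limit of cells containing units is again a unit. *)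
Lemma unit_base : exists V : nat -> set X, resolving_base V.
Proof.
have [W bW] := standard_borel_base (arrows_standard_borel BG).
have [sW mW _ gW] := bW.
have mu := measurable_unit BG.
have mrange : measurable (range (unit_at GG)) by exact/(units_borel BG).
have [Q [cQ mQ rQ]] := resolvable_seq bW (fun _ : nat => mrange).
exists (fun k => [set x | W k (unit_at GG x)]); split.
- move=> x y H; apply: (@unit_inj _ _ _ _ GG); apply: sW => _ [k _ <-].
  by apply: (H [set x | W k (unit_at GG x)]); exists k.
- by move=> k; exact: mset_preim.
- exists (fun k i => [set x | Q k i (unit_at GG x)]); split.
  + by move=> k x; exact: cQ.
  + by move=> k i; exact: mset_preim.
  move=> a ane; have [n|z zP] := rQ a.
    by have [x cx] := ane n; exists (unit_at GG x).
  have [|n nP] := zP (range (unit_at GG)); first by right; exists 0%N.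
  have [x cx] := ane n; have [+ _] := nP (unit_at GG x) cx.
  case=> [|y _ yz]; first by exists x.
  exists y => _ [k _ <-]; have [|n' n'P] := zP (W k); first by left; exists k.
  by exists n' => x' /n'P; rewrite -yz.
move=> A /(units_borel BG) /gW mA.
have -> : A = unit_at GG @^-1` (unit_at GG @` A).
  by apply/seteqP; split => [x Ax|x [y Ay /unit_inj <-]//]; exists x.
apply: sigma_algebra_preimage_sub mA => _ [k _ <-].
by apply: sub_sigma_algebra; exists k.
Qed.

End UnitBase.

(** * Isotropy groups at base points *)

Section BasePoint.
Context (R : realType) (dX dG : measure_display).
Context (X : measurableType dX) (G : measurableType dG) (GG : groupoid X G).
Context (BG : discrete_borel_groupoid R GG) (sg : nat -> X -> G).
Context (msg : forall n, measurable_fun setT (sg n)).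
Context (tsg : forall n x, tgt GG (sg n x) = x).
Context (sgP : forall g, exists n, sg n (tgt GG g) = g).
Context (V : nat -> set X) (sV : separating (range V)) (mV : forall k, measurable (V k)).
Local Notation orbit := (orbit GG).
Local Notation ssg := (ssg GG sg).
Local Notation code := (code V).
Local Notation Z := (leftmost GG V (fun A => A !=set0)).

(** The point whose code is lexicographically least in its orbit. In an infinite orbit the infimum
    of the codes need not be attained, whence the condition [has_base]. *)
Definition is_base y := forall n, code y n = Z y n.

Definition has_base x := exists n, is_base (ssg n x).

Lemma measurable_is_base : measurable [set y | is_base y].
Proof.
apply: mset_all => n; apply: measurable_code_leftmost => // s.
exact: (measurable_orbit_meets BG).
Qed.

Lemma measurable_has_base : measurable [set x | has_base x].
Proof.
apply: mset_ex => n; apply: (mset_preim (A := is_base)); last exact: measurable_is_base.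
exact: (measurable_ssg BG).
Qed.

Lemma is_base_inj x y : orbit x y -> is_base x -> is_base y -> x = y.
Proof.
move=> xy bx bY; apply: (code_inj sV) => n.
by rewrite bx bY (leftmost_orbit _ _ _ xy).
Qed.

Lemma has_baseP x : has_base x <-> exists2 y, orbit x y & is_base y.
Proof.
split=> [[n nb]|[y /(orbitP tsg sgP)[n <-] by_]]; last by exists n.
by exists (ssg n x) => //; exact: orbit_ssg.
Qed.

(** If no point followed the leftmost branch forever, finitely many points would all have left it at
    a common depth, although every cylinder along the branch meets the orbit. *)
Lemma finite_orbit_base x : finite_set (orbit x) -> has_base x.
Proof.
move=> fx; apply/has_baseP; apply: contrapT => nb.
have /finite_seqP[l lE] := fx.
have [N NP] : exists N, forall y, y \in l -> orbit x y -> code y N <> Z x N.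
  elim: l {lE} => [|y l [N IH]]; first by exists 0%N.
  have [oy|noy] := pselect (orbit x y); last first.
    by exists N => z; rewrite inE => /predU1P[->//|/IH].
  have /existsNP[m ym] : ~ is_base y by move=> by_; apply: nb; exists y.
  have le z k n : orbit x z -> (k <= n)%N -> code z k <> Z x k -> code z n <> Z x n.
    move=> oz kn H zn; apply: H; rewrite -(leftmost_orbit _ _ _ oz).
    by apply: code_leftmost_le kn _; rewrite (leftmost_orbit _ _ _ oz).
  exists (maxn m N) => z; rewrite inE => /predU1P[-> _|zl oz].
    by apply: (le _ m) => //; [exact: leq_maxl|rewrite -(leftmost_orbit _ _ _ oy)].
  by apply: (le _ N) => //; [exact: leq_maxr|exact: IH].
have QU (A B : set X) : A `|` B !=set0 -> A !=set0 \/ B !=set0.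
  by move=> [z [Az|Bz]]; [left|right]; exists z.
have [y [oy cy]] : (orbit x `&` cylinder V (Z x N)) !=set0.
  apply: (leftmostP (Q := fun A => A !=set0) V QU).
  by exists x; exact: orbit_refl.
have yl : y \in l by have : [set` l] y by rewrite -lE.
by apply: (NP y yl oy); move: cy; rewrite /cylinder /= size_leftmost.
Qed.

(** At a base point the arrow is set to the unit, since an enumerated one might be a nontrivial
    isotropy element. If the orbit has no base point, the index defaults to 0 and the target is
    still [x]. *)
Definition to_base x := if `[< is_base x >] then unit_at GG x
  else sg (least (fun n x => is_base (ssg n x)) x) x.

Definition base x := src GG (to_base x).

Lemma measurable_to_base : measurable_fun setT to_base.
Proof.
apply: measurable_fun_cond; first exact: measurable_is_base.
  exact: measurable_unit BG.
apply: measurable_fun_countable => // k; apply: measurable_least => n.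
apply: (mset_preim (A := is_base)); last exact: measurable_is_base.
exact: (measurable_ssg BG).
Qed.

Lemma measurable_base : measurable_fun setT base.
Proof. exact: (measurable_src_comp BG measurable_to_base). Qed.

Lemma tgt_to_base x : tgt GG (to_base x) = x.
Proof. by rewrite /to_base; case: asboolP => // _; rewrite tgt_unit. Qed.

Lemma to_base_id x : is_base x -> to_base x = unit_at GG x.
Proof. by move=> bx; rewrite /to_base; case: asboolP. Qed.

Lemma base_id x : is_base x -> base x = x.
Proof. by move=> bx; rewrite /base to_base_id// src_unit. Qed.

Lemma orbit_base x : orbit x (base x).
Proof. by rewrite -{1}(tgt_to_base x); exact: orbit_src. Qed.

Lemma is_base_base x : has_base x -> is_base (base x).
Proof.
move=> bx; rewrite /base /to_base; case: asboolP => [b|_]; first by rewrite src_unit.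
exact: (leastP (P := fun n x => is_base (ssg n x))).
Qed.

Lemma has_base_orbit x y : orbit x y -> has_base x -> has_base y.
Proof. by move=> /orbit_eq xy; rewrite !has_baseP xy. Qed.

Lemma base_orbit x y : orbit x y -> has_base x -> base y = base x.
Proof.
move=> xy bx; have bY := has_base_orbit xy bx.
apply: is_base_inj; [|exact: is_base_base..].
by rewrite (orbit_eq (orbit_base y)) (orbit_eq xy); exact: orbit_base.
Qed.

End BasePoint.

Lemma choquet_deny_iso (R : realType) (Gam Gam' : groupType) (f : Gam -> Gam') (f' : Gam' -> Gam) :
  (forall a b, f (a * b)%g = (f a * f b)%g) -> cancel f f' -> cancel f' f ->
  choquet_deny_group R Gam' -> choquet_deny_group R Gam.
Proof.
move=> fM fK f'K /choquet_deny_groupP[cG' CD]; apply/choquet_deny_groupP.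
have bijf : set_bij [set: Gam] [set: Gam'] f.
  split=> // [a b _ _ /(can_inj fK)//|c _]; by exists (f' c).
have reidx (u : Gam -> \bar R) : \esum_(c in [set: Gam']) u (f' c) = \esum_(a in [set: Gam]) u a.
  by rewrite (reindex_esum _ _ _ _ bijf); apply: eq_esum => a _; rewrite fK.
have f'M a b : f' (a * b)%g = (f' a * f' b)%g.
  by apply: (can_inj fK); rewrite fM !f'K.
split.
  have /countable_injP[e einj] := cG'; apply/countable_injP; exists (e \o f).
  move=> a b _ _ /einj; rewrite !inE => /(_ I I).
  exact: (can_inj fK).
move=> nu [nu0 nu1] gen F F01 hF.
have [||||k kP] := CD (nu \o f') _ _ (F \o f').
- by split => [c|]; [exact: nu0|rewrite -nu1 -reidx].
- apply/seteqP; split => // c _ S' [S'M nuS'].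
  have : [set: Gam] (f' c) by [].
  rewrite -gen => /(_ (f @^-1` S')); rewrite /= f'K; apply; split => /=.
    by move=> a b Sa Sb; rewrite fM; exact: S'M.
  by move=> a na; apply: nuS'; rewrite /= fK.
- by move=> c; exact: F01.
- move=> c; rewrite /= -hF -(reidx (fun a => (nu a * F (f' c * a)%g)%:E)).
  by apply: eq_esum => b _; rewrite f'M.
by exists k => a _; rewrite -(kP (f a) I) /= fK.
Qed.

Section ConjugateIsotropy.
Context (R : realType) (dX dG : measure_display).
Context (X : measurableType dX) (G : measurableType dG) (GG : groupoid X G).

Lemma conjugate_subproof (a : G) x y (ax : tgt GG a = x) (ay : src GG a = y)
    (c : isotropy GG x) : isotropy_pred GG y (gmul GG (ginv GG a) (gmul GG (sval c) a)).
Proof.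
have cs := isotropy_src c; have ct := isotropy_tgt c.
have h1 : src GG (sval c) = tgt GG a by rewrite cs ax.
have h2 : src GG (ginv GG a) = tgt GG (gmul GG (sval c) a).
  by rewrite src_inv tgt_mul// ct ax.
by apply/asboolP; split; rewrite /src_fiber /tgt_fiber /=;
  [rewrite !src_mul|rewrite tgt_mul// tgt_inv].
Qed.

Definition conjugate a x y ax ay c : isotropy GG y :=
  exist (fun g => isotropy_pred GG y g) _ (@conjugate_subproof a x y ax ay c).

Lemma conjugate_mul a x y (ax : tgt GG a = x) (ay : src GG a = y) (c c' : isotropy GG x) :
  conjugate ax ay (c * c')%g = (conjugate ax ay c * conjugate ax ay c')%g.
Proof.
have cs := isotropy_src c; have cs' := isotropy_src c'; have ct' := isotropy_tgt c'.
have ct := isotropy_tgt c.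
apply: val_inj => /=.
have h1 : src GG (sval c') = tgt GG a by rewrite cs' ax.
have h2 : src GG (sval c) = tgt GG a by rewrite cs ax.
have h3 : tgt GG a = tgt GG (gmul GG (sval c') a) by rewrite tgt_mul// ct' ax.
have h4 : src GG (ginv GG a) = tgt GG (gmul GG (sval c') a) by rewrite src_inv h3.
have h5 : src GG (ginv GG a) = tgt GG (gmul GG (sval c) a) by rewrite src_inv tgt_mul// ct ax.
rewrite -[RHS]gmulA//; last first.
  by rewrite src_mul// tgt_mul// tgt_inv.
congr gmul; rewrite -[RHS]gmulA//; last by rewrite tgt_mul// tgt_inv.
by rewrite mulVK// gmulA// cs ct'.
Qed.

Lemma conjugateK a x y (ax : tgt GG a = x) (ay : src GG a = y)
    (bx : tgt GG (ginv GG a) = y) (by_ : src GG (ginv GG a) = x) :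
  cancel (conjugate ax ay) (conjugate bx by_).
Proof.
move=> c; apply: val_inj => /=.
have cs := isotropy_src c; have ct := isotropy_tgt c.
have h1 : src GG (sval c) = tgt GG a by rewrite cs ax.
rewrite ginvK -gmulA ?src_mul ?tgt_inv ?src_inv//; last by rewrite tgt_mul// ct ax.
rewrite mulgKV// mulVK// ax ct //.
Qed.

Lemma choquet_deny_conjugate a : choquet_deny_group R (isotropy GG (src GG a)) ->
  choquet_deny_group R (isotropy GG (tgt GG a)).
Proof.
apply: (@choquet_deny_iso R _ _ (conjugate erefl erefl)
  (conjugate (tgt_inv GG a) (src_inv GG a))).
- exact: conjugate_mul.
- exact: conjugateK.
move=> c.
have cs := isotropy_src c; have ct := isotropy_tgt c.
apply: val_inj => /=; rewrite ginvK -gmulA ?src_mul ?tgt_inv ?src_inv//; last first.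
  by rewrite tgt_mul ?tgt_inv ?cs.
by rewrite mulgVK// mulKV// ct.
Qed.

End ConjugateIsotropy.

Section RealSets.
Context (R : realType) d (T : measurableType d).
Implicit Types u v : T -> R.

Lemma mset_eqe (u v : T -> \bar R) : measurable_fun setT u -> measurable_fun setT v ->
  measurable [set t | u t = v t].
Proof. by move=> mu mv; rewrite -[X in measurable X]setTI; exact: measurable_eqe. Qed.

Lemma mset_eqr u v : measurable_fun setT u -> measurable_fun setT v ->
  measurable [set t | u t = v t].
Proof.
move=> mu mv; have -> : [set t | u t = v t] = [set t | (u t)%:E = (v t)%:E].
  by apply/seteqP; split => t /= [->].
by apply: mset_eqe; exact/measurable_EFinP.
Qed.

Lemma mset_ltr u v : measurable_fun setT u -> measurable_fun setT v ->
  measurable [set t | u t < v t].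
Proof.
move=> mu mv; have := measurable_lte measurableT
  (_ : measurable_fun setT (EFin \o u)) (_ : measurable_fun setT (EFin \o v)).
rewrite setTI; apply; exact/measurable_EFinP.
Qed.

Lemma mset_ler u v : measurable_fun setT u -> measurable_fun setT v ->
  measurable [set t | u t <= v t].
Proof.
move=> mu mv; have -> : [set t | u t <= v t] = [set t | ~ (v t < u t)].
  by apply/seteqP; split => t /=; rewrite ltNge; [move=> -> //|move=> /negP; rewrite negbK].
exact/mset_not/mset_ltr.
Qed.

End RealSets.

(** * Borel encoding of the failure of the Choquet-Deny property *)

Section Witness.
Context (R : realType) (dX dG : measure_display).
Context (X : measurableType dX) (G : measurableType dG) (GG : groupoid X G).
Context (BG : discrete_borel_groupoid R GG) (sg : nat -> X -> G).
Context (msg : forall n, measurable_fun setT (sg n)).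
Context (tsg : forall n x, tgt GG (sg n x) = x).
Context (sgP : forall g, exists n, sg n (tgt GG g) = g).

Definition iso_enum m y := if `[< src GG (sg m y) = y >] then sg m y else unit_at GG y.

Lemma src_iso_enum m y : src GG (iso_enum m y) = y.
Proof. by rewrite /iso_enum; case: asboolP => // _; rewrite src_unit. Qed.

Lemma tgt_iso_enum m y : tgt GG (iso_enum m y) = y.
Proof. by rewrite /iso_enum; case: asboolP => // _; rewrite tgt_unit. Qed.

Lemma iso_enumP g y : src GG g = y -> tgt GG g = y -> exists m, iso_enum m y = g.
Proof.
move=> sy ty; have [m mg] := sgP g; exists m.
by rewrite /iso_enum; rewrite ty in mg; case: asboolP => //; rewrite mg.
Qed.

Lemma measurable_iso_enum m : measurable_fun setT (iso_enum m).
Proof.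
apply: measurable_fun_cond => //; last exact: measurable_unit BG.
apply: (mset_eqX BG); last exact: measurable_id.
exact: (measurable_src_comp BG).
Qed.

(** Products along finite words of indices turn generation by the support into a condition with
    countable quantifiers. *)
Fixpoint iso_prod (l : seq nat) y :=
  if l is m :: l' then gmul GG (iso_enum m y) (iso_prod l' y) else unit_at GG y.

Lemma tgt_iso_prod l y : tgt GG (iso_prod l y) = y.
Proof.
elim: l => [|m l IH] /=; first exact: tgt_unit.
by rewrite tgt_mul ?tgt_iso_enum// IH src_iso_enum.
Qed.

Lemma src_iso_prod l y : src GG (iso_prod l y) = y.
Proof.
elim: l => [|m l IH] /=; first exact: src_unit.
by rewrite src_mul// tgt_iso_prod src_iso_enum.
Qed.

Lemma measurable_iso_prod l : measurable_fun setT (iso_prod l).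
Proof.
elim: l => [|m l IH]; first exact: measurable_unit BG.
apply: (measurable_gmul_comp BG) => //; first exact: measurable_iso_enum.
by move=> y; rewrite src_iso_enum tgt_iso_prod.
Qed.

Lemma iso_prod_cat l l' y :
  iso_prod (l ++ l') y = gmul GG (iso_prod l y) (iso_prod l' y).
Proof.
elim: l => [|m l IH] /=; first by rewrite -{2}(tgt_iso_prod l' y) gmul1l.
by rewrite IH gmulA// ?src_iso_enum ?src_iso_prod ?tgt_iso_prod.
Qed.

(** The multiplication table of the isotropy group. Through the index of a product, harmonicity
    becomes a condition on entries of a sequence that is Borel jointly in the point and the
    sequence. *)
Definition iso_mul n m y := gmul GG (iso_enum n y) (iso_enum m y).

Definition mul_index n m y := least (fun k y => iso_enum k y = iso_mul n m y) y.

Lemma mul_indexP n m y : iso_enum (mul_index n m y) y = iso_mul n m y.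
Proof.
apply: (leastP (P := fun k y => iso_enum k y = iso_mul n m y)); apply: iso_enumP.
  by rewrite src_mul src_iso_enum// tgt_iso_enum.
by rewrite tgt_mul ?tgt_iso_enum// src_iso_enum.
Qed.

Lemma measurable_mul_index n m k : measurable [set y | mul_index n m y = k].
Proof.
apply: measurable_least => j; apply: (mset_eqG BG); first exact: measurable_iso_enum.
apply: (measurable_gmul_comp BG); do ?exact: measurable_iso_enum.
by move=> y; rewrite src_iso_enum tgt_iso_enum.
Qed.

(* A sequence [z] encodes a probability measure and a function on the isotropy
   group at [y]: their values at [iso_enum m y] are read off the even and the odd
   entries, absolute values making both non-negative. Repetitions in the
   enumeration add up for the measure. *)
Definition wgt m (z : nat -> R) : R := `|z m.*2|.

Definition val_at m (z : nat -> R) : R := `|z m.*2.+1|.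

(** The clauses say: mass 1, generation, values at most 1, compatibility with repetitions,
    harmonicity, non-constancy. All quantifiers are countable. The empty word is allowed in the
    second clause: where it is applied, the product is followed by a further step of positive
    weight. *)
Definition witness (t : X * real_seq R) : Prop :=
  \esum_(m in [set: nat]) (wgt m t.2)%:E = 1%E /\
  (forall n, exists l : seq nat, (forall m, m \in l -> 0 < wgt m t.2) /\
    iso_prod l t.1 = iso_enum n t.1) /\
  (forall n, val_at n t.2 <= 1) /\
  (forall n m, iso_enum n t.1 = iso_enum m t.1 -> val_at n t.2 = val_at m t.2) /\
  (forall n, \esum_(m in [set: nat])
     (wgt m t.2 * val_at (mul_index n m t.1) t.2)%:E = (val_at n t.2)%:E) /\
  exists n m, val_at n t.2 <> val_at m t.2.

Lemma measurable_coord_prod m : measurable_fun setT (fun t : X * real_seq R => t.2 m : R).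
Proof. exact: measurableT_comp (measurable_coord m) measurable_snd. Qed.

Lemma measurable_wgt m : measurable_fun setT (fun t : X * real_seq R => wgt m t.2).
Proof.
by apply: (measurableT_comp (f := @Num.norm R R));
  [exact: normr_measurable|exact: measurable_coord_prod].
Qed.

Lemma measurable_val_at m : measurable_fun setT (fun t : X * real_seq R => val_at m t.2).
Proof.
by apply: (measurableT_comp (f := @Num.norm R R));
  [exact: normr_measurable|exact: measurable_coord_prod].
Qed.

Lemma measurable_witness : measurable [set t | witness t].
Proof.
have mfst (A : set X) : measurable A -> measurable [set t : X * real_seq R | A t.1].
  by move=> mA; apply: mset_preim mA; exact: measurable_fst.
apply: mset_and.
  apply: mset_eqe; last exact: measurable_cst.
  by apply: measurable_esum_nat => [n t|n]; [exact: normr_ge0|exact: measurable_wgt].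
apply: mset_and.
  apply: mset_all => n; apply: mset_countex => l; apply: mset_and.
    apply: mset_all => m; apply: mset_imp; first exact: mset_const.
    by apply: mset_ltr; [exact: measurable_cst|exact: measurable_wgt].
  apply: (mfst [set y | iso_prod l y = iso_enum n y]); apply: (mset_eqG BG).
    exact: measurable_iso_prod.
  exact: measurable_iso_enum.
apply: mset_and.
  apply: mset_all => n; apply: mset_ler; last exact: measurable_cst.
  exact: measurable_val_at.
apply: mset_and.
  apply: mset_all => n; apply: mset_all => m; apply: mset_imp.
    apply: (mfst [set y | iso_enum n y = iso_enum m y]).
    by apply: (mset_eqG BG); exact: measurable_iso_enum.
  by apply: mset_eqr; exact: measurable_val_at.
apply: mset_and.
  apply: mset_all => n; apply: mset_eqe; last by apply/measurable_EFinP; exact: measurable_val_at.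
  apply: measurable_esum_nat => [m t|m]; first by rewrite mulr_ge0// normr_ge0.
  apply: measurable_funM; first exact: measurable_wgt.
  have := @measurable_fun_countable _ _ _ _ (fun t : X * real_seq R => mul_index n m t.1)
    (fun k t => val_at k t.2); apply => k; last exact: measurable_val_at.
  exact: (mfst [set y | mul_index n m y = k] (measurable_mul_index _ _ _)).
apply: mset_ex => n; apply: mset_ex => m; apply: mset_not.
by apply: mset_eqr; exact: measurable_val_at.
Qed.

Lemma witness_exists y : ~ choquet_deny_group R (isotropy GG y) ->
  exists z, witness (y, z).
Proof.
have cG : countable [set: isotropy GG y].
  have /countable_injP[e einj] := countable_tgt_fiber BG y.
  apply/countable_injP; exists (fun c => e (sval c)) => c c' _ _ /einj.
  rewrite !inE => H; apply: val_inj; apply: H; exact: isotropy_tgt.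
rewrite choquet_deny_groupP => /not_andP[//|].
move=> /existsNP[nu] /not_implyP[[nu0 nu1]] /not_implyP[gen].
move=> /existsNP[F] /not_implyP[F01] /not_implyP[hF ncst].
have /choice[e eP] : forall m, exists c : isotropy GG y, sval c = iso_enum m y.
  by move=> m; apply: isotropyP; [exact: src_iso_enum|exact: tgt_iso_enum].
have ex c : exists m, e m = c.
  have [m mc] := iso_enumP (isotropy_src c) (isotropy_tgt c).
  by exists m; apply: val_inj; rewrite /= eP mc.
(* The enumeration has repetitions; the whole mass of an element is put on its first index, so that
   the weights still sum to 1. *)
pose first := [set m | forall k, (k < m)%N -> e k <> e m].
have first_surj c : exists2 m, first m & e m = c.
  have exb : exists m, `[< e m = c >] by have [m mc] := ex c; exists m; apply/asboolP.
  case: (ex_minnP exb) => m /asboolP mc mmin; exists m => // k km ekm.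
  have := mmin k; rewrite leqNgt km => H.
  by have /H : `[< e k = c >] by apply/asboolP; rewrite ekm.
have first_bij : set_bij first [set: isotropy GG y] e.
  split=> [//|m n|c _]; last by have [m fm mc] := first_surj c; exists m.
  rewrite !inE => fm fn emn.
  by have [mn|nm|//] := ltngtP m n; [case: (fn m mn)|case: (fm n nm)].
pose w m := if `[< first m >] then nu (e m) else 0.
pose z n := if odd n then F (e n./2) else w n./2.
have w0 m : 0 <= w m by rewrite /w; case: asboolP.
have wE m : wgt m z = w m by rewrite /wgt /z odd_double doubleK ger0_norm.
have vE m : val_at m z = F (e m).
  by rewrite /val_at /z /= odd_double /= uphalf_double ger0_norm//; have /andP[] := F01 (e m).
have sumE (u : isotropy GG y -> R) : \esum_(m in [set: nat]) (w m * u (e m))%:E =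
    \esum_(c in [set: isotropy GG y]) (nu c * u c)%:E.
  rewrite (reindex_esum _ _ _ _ first_bij) [RHS]esum_mkcond; apply: eq_esum => m _.
  rewrite /w; case: asboolP => [fm|nfm]; first by rewrite mem_set.
  by rewrite memNset// mul0r.
exists z; split=> /=.
  under eq_esum do rewrite wE -[w _]mulr1.
  by rewrite (sumE (fun=> 1)); under eq_esum do rewrite mulr1.
split=> [n|].
  have : [set: isotropy GG y] (e n) by [].
  rewrite -gen => /(_ [set c | exists l : seq nat, (forall m, m \in l -> 0 < w m) /\
     iso_prod l y = sval c]).
  rewrite /= eP => H; have [| l [lw lE]] := H.
    split=> [c c' [l [lw lc]] [l' [lw' lc']]|c nc].
      exists (l ++ l'); split; last by rewrite iso_prod_cat lc lc'.
      by move=> m; rewrite mem_cat => /orP[/lw|/lw'].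
    have [m fm mc] := first_surj c; exists [:: m]; split.
      by move=> k; rewrite inE => /eqP ->; rewrite /w; case: asboolP => // _; rewrite mc.
    rewrite /= -mc eP -[in X in gmul _ _ X](src_iso_enum m y); exact: gmul1r.
  by exists l; split => // m /lw; rewrite wE.
split=> [n|]; first by rewrite vE; have /andP[] := F01 (e n).
split=> [n m nm|]; first by rewrite !vE; congr F; apply: val_inj; rewrite /= !eP.
split=> [n|].
  rewrite vE -hF -sumE; apply: eq_esum => m _; rewrite wE vE.
  by congr (_ * F _)%:E; apply: val_inj; rewrite /= !eP mul_indexP.
apply: contrapT => H; apply: ncst; exists (F (e 0%N)) => c _.
have [m <-] := ex c; apply: contrapT => mF; apply: H; exists m, 0%N.
by rewrite !vE.
Qed.

End Witness.

Section PositivePaths.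
Context (R : realType) (dX dG : measure_display).
Context (X : measurableType dX) (G : measurableType dG) (GG : groupoid X G).
Context (p : G -> R) (p0 : forall g, 0 <= p g).

Definition reached g := exists n, (0 < markov_pow GG p n g)%E.

Lemma reached1 g : 0 < p g -> reached g.
Proof. by move=> pg; exists 0%N; rewrite /= lte_fin. Qed.

Lemma reached_mul h g : src GG h = tgt GG g -> 0 < p h -> reached g ->
  reached (gmul GG h g).
Proof.
move=> hg ph [n ng]; exists n.+1.
apply: (@lt_le_trans _ _ ((p h)%:E * markov_pow GG p n g)%E).
  by rewrite mule_gt0// lte_fin.
have -> : markov_pow GG p n g =
    markov_pow GG p n (gmul GG (ginv GG h) (gmul GG h g)) by rewrite mulKV.
apply: (@esum_ge1 _ _ _ _ h); first by rewrite /tgt_fiber /= tgt_mul.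
move=> k _; rewrite mule_ge0 ?lee_fin//.
exact: markov_pow_ge0.
Qed.

End PositivePaths.

(** * A kernel that is not Liouville on orbits with a witness *)

Section IsotropyKernel.
Context (R : realType) (dX dG : measure_display).
Context (X : measurableType dX) (G : measurableType dG) (GG : groupoid X G).
Context (BG : discrete_borel_groupoid R GG) (sg : nat -> X -> G).
Context (msg : forall n, measurable_fun setT (sg n)).
Context (tsg : forall n x, tgt GG (sg n x) = x).
Context (sgP : forall g, exists n, sg n (tgt GG g) = g).
Context (V : nat -> set X) (sV : separating (range V)) (mV : forall k, measurable (V k)).
Context (B : set X) (mB : measurable B) (zs : X -> nat -> R).
Context (wB : forall x, B x -> witness GG sg (x, zs x)).

(** Off [B] there is no witness, and the geometric weights keep the total mass equal to 1 at every
    point. *)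
Definition base_weight m x := if `[< B x >] then wgt m (zs x) else half_weight R m.

Context (mw : forall m, measurable_fun setT (base_weight m)).
Local Notation orbit := (orbit GG).
Local Notation ssg := (ssg GG sg).
Local Notation is_base := (is_base GG V).
Local Notation has_base := (has_base GG sg V).
Local Notation to_base := (to_base GG sg V).
Local Notation base := (base GG sg V).
Local Notation iso_enum := (iso_enum GG sg).
Local Notation "g ** h" := (gmul GG g h) (at level 40, left associativity).

Definition good x := has_base x /\ B (base x).

Lemma measurable_good : measurable [set x | good x].
Proof.
apply: mset_and; first exact: (measurable_has_base BG).
by apply: mset_preim => //; exact: (measurable_base BG).
Qed.

(* Away from the base point of a good orbit the chain returns to it
   deterministically; at the base point [y], half of the mass makes an isotropy
   step distributed as the witness, the other half visits a point of the orbit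
   along the inverse of its arrow to [y], so that the first return to [y] is a
   lazy version of the isotropy step. *)
Definition iso_step n x := if `[< good x /\ is_base x >] then iso_enum n x
  else if `[< good x >] then to_base x else sg n x.

Definition visit_step n x := if `[< good x /\ is_base x >] then ginv GG (to_base (ssg n x))
  else if `[< good x >] then to_base x else sg n x.

Lemma good_orbit x y : orbit x y -> good x -> good y.
Proof.
move=> xy [hx Bx]; split; first exact: has_base_orbit xy hx.
by rewrite (base_orbit tsg sgP sV xy hx).
Qed.

Lemma tgt_iso_step n x : tgt GG (iso_step n x) = x.
Proof.
rewrite /iso_step; case: asboolP => _; first exact: tgt_iso_enum.
by case: asboolP => _ //; exact: tgt_to_base.
Qed.

Lemma tgt_visit_step n x : tgt GG (visit_step n x) = x.
Proof.
rewrite /visit_step; case: asboolP => [[[hx _] bx]|_]; last first.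
  by case: asboolP => _ //; exact: tgt_to_base.
rewrite tgt_inv -/(base _) (base_orbit tsg sgP sV _ hx); first exact: base_id.
exact: orbit_ssg.
Qed.

Lemma measurable_good_base : measurable [set x | good x /\ is_base x].
Proof. by apply: mset_and; [exact: measurable_good|exact: (measurable_is_base BG)]. Qed.

Lemma measurable_iso_step n : measurable_fun setT (iso_step n).
Proof.
apply: measurable_fun_cond; first exact: measurable_good_base.
  exact: (measurable_iso_enum BG).
apply: measurable_fun_cond => //; first exact: measurable_good.
exact: (measurable_to_base BG).
Qed.

Lemma measurable_visit_step n : measurable_fun setT (visit_step n).
Proof.
apply: measurable_fun_cond; first exact: measurable_good_base.
  apply: (measurable_ginv_comp BG).
  by apply: (measurableT_comp (f := to_base));
    [exact: (measurable_to_base BG)|exact: (measurable_ssg BG)].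
apply: measurable_fun_cond => //; first exact: measurable_good.
exact: (measurable_to_base BG).
Qed.

Lemma base_weight_ge0 m x : 0 <= base_weight m x.
Proof.
rewrite /base_weight; case: asboolP => _; first exact: normr_ge0.
exact/ltW/half_weight_gt0.
Qed.

Lemma base_weight_sum x : \esum_(m in [set: nat]) (base_weight m x)%:E = 1%E.
Proof.
rewrite /base_weight; case: asboolP => [/wB[]//|_]; exact: half_weight_sum.
Qed.

Let hw0 n (x : X) : 0 <= half_weight R n. Proof. exact/ltW/half_weight_gt0. Qed.

Let hw1 (x : X) : \esum_(n in [set: nat]) (half_weight R n)%:E = 1%E.
Proof. exact: half_weight_sum. Qed.

Let half01 (x : X) : 0 <= (1 / 2 : R) <= 1. Proof. by apply/andP; split; lra. Qed.

Definition iso_kernel : G -> R := mix GG (fun=> 1 / 2)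
  (push GG iso_step base_weight) (push GG visit_step (fun n _ => half_weight R n)).

Lemma iso_kernel_invariant : invariant_markov GG iso_kernel.
Proof.
apply: (mix_invariant BG) => //.
  apply: push_invariant => //; first exact: tgt_iso_step.
  - exact: base_weight_ge0.
  - exact: base_weight_sum.
  - exact: measurable_iso_step.
by apply: push_invariant => //; [exact: tgt_visit_step|exact: measurable_visit_step].
Qed.

Lemma iso_kernel_gt0_iso n x : 0 < base_weight n x -> 0 < iso_kernel (iso_step n x).
Proof.
move=> wn; rewrite /iso_kernel /mix ltr_pwDl//.
  apply: mulr_gt0; first lra.
  exact: (push_gt0 tgt_iso_step base_weight_ge0 base_weight_sum).
by rewrite mulr_ge0 ?push_ge0//; lra.
Qed.

Lemma iso_kernel_gt0_visit n x : 0 < iso_kernel (visit_step n x).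
Proof.
rewrite /iso_kernel /mix ltr_wpDl//.
  by rewrite mulr_ge0 ?push_ge0//; [lra|exact: base_weight_ge0].
apply: mulr_gt0; first lra.
by apply: (push_gt0 tgt_visit_step hw0 hw1); exact: half_weight_gt0.
Qed.

Lemma to_base_src_base g : good (tgt GG g) -> src GG (to_base (src GG g)) = base (tgt GG g).
Proof. by move=> [hx _]; apply: (base_orbit tsg sgP sV _ hx); exact: orbit_src. Qed.

(** Carries an arrow of a good orbit to the isotropy group at the base point by composing with the
    return arrows at both ends. *)
Definition to_iso g := (ginv GG (to_base (tgt GG g)) ** g) ** to_base (src GG g).

Lemma to_isoP g : good (tgt GG g) ->
  [/\ src GG (to_iso g) = base (tgt GG g), tgt GG (to_iso g) = base (tgt GG g) &
      g = to_base (tgt GG g) ** (to_iso g ** ginv GG (to_base (src GG g)))].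
Proof.
move=> gg; have tb := to_base_src_base gg.
have h1 : src GG (ginv GG (to_base (tgt GG g))) = tgt GG g by rewrite src_inv tgt_to_base.
have h2 : src GG (ginv GG (to_base (tgt GG g)) ** g) = tgt GG (to_base (src GG g)).
  by rewrite src_mul// tgt_to_base.
split; rewrite /to_iso; first by rewrite src_mul.
  by rewrite tgt_mul// tgt_mul// tgt_inv.
by rewrite mulgKV// mulVK// tgt_to_base.
Qed.

(** In a good orbit an arrow factors as a return arrow, an isotropy element at the base point and
    the inverse of a return arrow. The first is a forced step, absent when the target is the base
    point; the second is a product of elements charged by the witness; the third is a visit step. *)
Lemma iso_kernel_nondegenerate : nondegenerate_markov GG iso_kernel.
Proof.
have [p0 _ _] := iso_kernel_invariant.
move=> x; apply/seteqP; split => [g [n _ []]//|g gx].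
suff : reached GG iso_kernel g by move=> [n ng]; exists n.
rewrite /tgt_fiber /= in gx; have [gx'|ngx] := pselect (good x); last first.
  apply: reached1; have [n gn] := sgP g; rewrite gx in gn.
  have <- : visit_step n x = g; last exact: iso_kernel_gt0_visit.
  by rewrite /visit_step; case: asboolP => [[]//|_]; case: asboolP.
rewrite -gx in gx'; have [st tt ->] := to_isoP gx'.
set y := base (tgt GG g) in st tt *.
have by_ : is_base y by apply: is_base_base => //; case: gx'.
have gy : good y by apply: good_orbit gx'; exact: orbit_base.
have By : B y by have [_] := gx'.
have [k kE] := iso_enumP sgP st tt.
have [_ [/(_ k)[l [lw lE]] _]] := wB By.
rewrite -kE -lE /=; set e := ginv GG (to_base (src GG g)).
have re : reached GG iso_kernel e.
  apply: reached1; have : orbit y (src GG g).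
    rewrite (orbit_eq (orbit_base tsg V (tgt GG g))); exact: orbit_src.
  move=> /(orbitP tsg sgP)[n nE].
  have <- : visit_step n y = e; last exact: iso_kernel_gt0_visit.
  by rewrite /visit_step; case: asboolP => [_|[]//]; rewrite nE.
have te : tgt GG e = y by rewrite tgt_inv; exact: to_base_src_base.
have rl : reached GG iso_kernel (iso_prod GG sg l y ** e).
  elim: l lw {lE} => [|m l IH] lw /=; first by rewrite -te gmul1l.
  have sm : src GG (iso_enum m y) = y by exact: src_iso_enum.
  rewrite -gmulA ?sm ?tgt_iso_prod// ?src_iso_prod//.
  apply: reached_mul => //; first by rewrite sm tgt_mul ?tgt_iso_prod ?src_iso_prod.
    have -> : iso_enum m y = iso_step m y.
      by rewrite /iso_step; case: asboolP => // -[].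
    apply: iso_kernel_gt0_iso; rewrite /base_weight; case: asboolP => // _.
    by apply: lw; rewrite mem_head.
  by apply: IH => j jl; apply: lw; rewrite inE jl orbT.
have tl : tgt GG (iso_prod GG sg l y ** e) = y.
  by rewrite tgt_mul ?tgt_iso_prod ?src_iso_prod.
have [bx|nbx] := pselect (is_base (tgt GG g)).
  rewrite to_base_id//.
  have -> : unit_at GG (tgt GG g) = unit_at GG (tgt GG (iso_prod GG sg l y ** e)).
    by rewrite tl /y base_id.
  by rewrite gmul1l.
apply: reached_mul => //.
have -> : to_base (tgt GG g) = visit_step 0 (tgt GG g); last exact: iso_kernel_gt0_visit.
by rewrite /visit_step; case: asboolP => [[]//|_]; case: asboolP.
Qed.

Lemma to_iso_mul_base g h : good (tgt GG g) -> is_base (src GG g) ->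
  tgt GG h = src GG g -> to_iso (g ** h) = to_iso g ** (h ** to_base (src GG h)).
Proof.
move=> gg bs hg.
have h1 : src GG (ginv GG (to_base (tgt GG g))) = tgt GG g by rewrite src_inv tgt_to_base.
have h2 : src GG h = tgt GG (to_base (src GG h)) by rewrite tgt_to_base.
rewrite /to_iso tgt_mul// src_mul// (to_base_id _ bs).
rewrite -[_ ** unit_at _ _](_ : ginv GG (to_base (tgt GG g)) ** g = _); last first.
  by have := gmul1r GG (ginv GG (to_base (tgt GG g)) ** g); rewrite src_mul.
by rewrite gmulA// ?src_mul// -gmulA// ?src_mul.
Qed.

(** The harmonic function is the function of the witness evaluated at [to_iso]. Return and visit
    steps do not change [to_iso], and an isotropy step at the base point multiplies it on the right
    by the chosen element, so harmonicity reduces to that of the witness. The arrows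
    [to_base x ** iso_enum n y] show that it is not constant. *)
Lemma iso_kernel_not_liouville x : good x -> ~ liouville_at GG iso_kernel x.
Proof.
move=> gx; have [p0 p1 _] := iso_kernel_invariant.
move=> /(liouville_atP _ p0 p1) L.
set y := base x.
have by_ : is_base y by apply: is_base_base => //; case: gx.
have gy : good y by apply: good_orbit gx; exact: orbit_base.
have By : B y by have [_] := gx.
have [_ [_ [W3 [W4 [W5 [n1 [n2 n12]]]]]]] := wB By.
have /choice[kk kkP] : forall c, exists k, src GG c = y -> tgt GG c = y -> iso_enum k y = c.
  move=> c; have [sc|] := pselect (src GG c = y); last by exists 0%N.
  have [tc|] := pselect (tgt GG c = y); last by exists 0%N.
  by have [k kE] := iso_enumP sgP sc tc; exists k.
pose Fv c := val_at (kk c) (zs y).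
have FvE k : Fv (iso_enum k y) = val_at k (zs y).
  by apply: W4; apply: kkP; [exact: src_iso_enum|exact: tgt_iso_enum].
have Fv01 c : 0 <= Fv c <= 1 by rewrite normr_ge0 W3.
have Fv0 c : 0 <= Fv c by have /andP[] := Fv01 c.
have unit_iso n : unit_at GG y = unit_at GG (src GG (iso_enum n y)).
  by rewrite src_iso_enum.
have sum_const (w : nat -> R) (c : R) : 0 <= c -> (forall n, 0 <= w n) ->
    \esum_(n in [set: nat]) (w n)%:E = 1%E -> \esum_(n in [set: nat]) (w n * c)%:E = c%:E.
  move=> c0 w0 w1; under eq_esum do rewrite mulrC EFinM.
  by rewrite esumZl ?w1 ?mule1// => n _; rewrite lee_fin.
have tb g : tgt GG g = x -> base (src GG g) = y.
  by move=> gE; apply: (base_orbit tsg sgP sV); [rewrite -gE; exact: orbit_src|case: gx].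
have harm : harmonic_on GG iso_kernel x (fun g => Fv (to_iso g)).
  move=> g gE; rewrite /tgt_fiber /= in gE.
  have gg : good (tgt GG g) by rewrite gE.
  have gs : good (src GG g) by apply: good_orbit gg; exact: orbit_src.
  rewrite (mix_sum GG half01 _ (F := fun h => Fv (to_iso (g ** h))))//; last 2 first.
  - by apply: push_ge0; exact: base_weight_ge0.
  - by apply: push_ge0.
  rewrite (push_sum tgt_iso_step base_weight_ge0 base_weight_sum _
    (F := fun h => Fv (to_iso (g ** h))))//.
  rewrite (push_sum tgt_visit_step hw0 hw1 _ (F := fun h => Fv (to_iso (g ** h))))//.
  suff [-> ->] :
      \esum_(n in [set: nat]) (base_weight n (src GG g) *
         Fv (to_iso (g ** iso_step n (src GG g))))%:E = (Fv (to_iso g))%:E /\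
      \esum_(n in [set: nat]) (half_weight R n *
         Fv (to_iso (g ** visit_step n (src GG g))))%:E = (Fv (to_iso g))%:E.
    by rewrite -!EFinM -EFinD; congr EFin; lra.
  have [bs|nbs] := pselect (is_base (src GG g)).
    have sy : src GG g = y by rewrite -(tb _ gE) base_id.
    have [st tt _] := to_isoP gg; rewrite gE -/y in st tt.
    have [k kE] := iso_enumP sgP st tt.
    split.
      rewrite -kE FvE -(W5 k) sy; apply: eq_esum => n _.
      rewrite /base_weight; case: asboolP => // _; congr (_ * _)%:E.
      have -> : iso_step n y = iso_enum n y by rewrite /iso_step; case: asboolP => // -[].
      rewrite to_iso_mul_base//; last by rewrite tgt_iso_enum.
      rewrite src_iso_enum to_base_id// (unit_iso n) gmul1r.
      by rewrite -kE -/(iso_mul GG sg k n y) -mul_indexP// FvE.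
    rewrite -[RHS](sum_const (half_weight R))//; last 2 first.
    - by move=> n; exact/ltW/half_weight_gt0.
    - exact: half_weight_sum.
    apply: eq_esum => n _; congr (_ * Fv _)%:E.
    have -> : visit_step n (src GG g) = ginv GG (to_base (ssg n (src GG g))).
      by rewrite /visit_step; case: asboolP => // -[].
    have te : tgt GG (ginv GG (to_base (ssg n (src GG g)))) = src GG g.
      by have := tgt_visit_step n (src GG g); rewrite /visit_step; case: asboolP => // -[].
    rewrite to_iso_mul_base// src_inv tgt_to_base// gmulVl.
    have -> : unit_at GG (src GG (to_base (ssg n (src GG g)))) = unit_at GG (src GG (to_iso g)).
      by rewrite st -[src GG (to_base _)](tgt_inv GG) te sy.
    exact: gmul1r.
  have E : to_iso (g ** to_base (src GG g)) = to_iso g.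
    have h1 : src GG (ginv GG (to_base (tgt GG g))) = tgt GG g by rewrite src_inv tgt_to_base.
    have h2 : src GG g = tgt GG (to_base (src GG g)) by rewrite tgt_to_base.
    have bb : is_base (src GG (to_base (src GG g))).
      by rewrite -/(base _) tb.
    rewrite /to_iso tgt_mul// src_mul// (to_base_id _ bb) gmulA//.
    by rewrite -[X in unit_at _ X](src_mul (g := ginv GG (to_base (tgt GG g)) ** g))
      ?gmul1r// src_mul.
  split.
    rewrite -[RHS](sum_const (base_weight^~ (src GG g)))//; last 2 first.
    - by move=> n; exact: base_weight_ge0.
    - exact: base_weight_sum.
    apply: eq_esum => n _; rewrite -[in RHS]E /iso_step.
    by case: asboolP => [[]//|_]; case: asboolP.
  rewrite -[RHS](sum_const (half_weight R))//; last 2 first.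
  - by move=> n; exact/ltW/half_weight_gt0.
  - exact: half_weight_sum.
  apply: eq_esum => n _; rewrite -[in RHS]E /visit_step.
  by case: asboolP => [[]//|_]; case: asboolP.
have [c cP] := L _ (fun g _ => Fv01 _) harm.
have val_c n : val_at n (zs y) = c.
  rewrite -FvE; have tx : src GG (to_base x) = tgt GG (iso_enum n y) by rewrite tgt_iso_enum.
  have tg : tgt GG (to_base x ** iso_enum n y) = x by rewrite tgt_mul// tgt_to_base.
  rewrite -(cP _ tg); congr Fv.
  rewrite /to_iso tg src_mul// mulKV// src_iso_enum to_base_id//.
  by rewrite (unit_iso n) gmul1r.
by apply: n12; rewrite !val_c.
Qed.

End IsotropyKernel.

(** * The two necessary conditions and the equivalence *)

Section Assembly.
Context (R : realType) (dX dG : measure_display).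
Context (X : measurableType dX) (G : measurableType dG) (GG : groupoid X G).
Context (mu : probability X R) (BG : discrete_borel_groupoid R GG).

Lemma choquet_deny_finite_orbits : choquet_deny_groupoid GG mu ->
  {ae mu, forall x, finite_set [set y | orbit_relation GG (x, y)]}.
Proof.
move=> CD; have [V [sV mV _ _]] := unit_base BG.
have [sg [msg tsg sgP]] := target_enumeration BG.
have := CD _ (drift_invariant BG msg tsg sgP mV) 
  (nondegenerate_pos GG (drift_gt0 R tsg sgP V)).
apply: negligibleS => x infx; exact: (drift_not_liouville BG msg tsg sgP sV mV).
Qed.

(** Isotropy groups along an orbit are conjugate, so a bad group at [x] yields a witness at the base
    point of [x]. If selection succeeds there, the kernel built from it fails to be Liouville at
    [x], which happens only on a null set. *)
Lemma choquet_deny_isotropy : choquet_deny_groupoid GG mu ->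
  {ae mu, forall x, choquet_deny_group R (isotropy GG x)}.
Proof.
move=> CD; have finO := choquet_deny_finite_orbits CD.
have [V bV] := unit_base BG; have [sV mV _ _] := bV.
have [sg [msg tsg sgP]] := target_enumeration BG.
have [W bW] := resolving_base_product R bV.
have mb : measurable_fun setT (base GG sg V) := measurable_base BG msg tsg sgP mV.
pose bm := isMeasurableFun.Build _ _ _ _ _ mb.
pose b : {mfun X >-> X} := HB.pack (base GG sg V) bm.
pose t0 (x : X) : X * real_seq R := (x, fun=> 0).
(* Selection is made for the law of [base] under [mu]: the exceptional set [N] of base points then
   has a [mu]-null preimage under [base], as is used for [nN]. *)
have [B [N [sel [mB mN N0 AB [selP mE]]]]] :=
  measurable_selection (distribution mu b) bW sV mV measurable_fst t0
    (measurable_witness BG msg tsg).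
pose zs x : nat -> R := (sel x).2.
have wB x : B x -> witness GG sg (x, zs x).
  by move=> /selP[]; rewrite /zs; case: (sel x) => y z /= ? <-.
have mw m : measurable_fun setT (base_weight B zs m).
  apply: measurable_fun_mset => E mEE.
  have -> : [set x | E (base_weight B zs m x)] =
      [set x | (B x /\ E (wgt m (sel x).2)) \/ (~ B x /\ E (half_weight R m))].
    apply/seteqP; split => x /=; rewrite /base_weight; case: asboolP => Bx.
    - by left.
    - by right.
    - by move=> [[]|[]].
    - by move=> [[]|[]].
  apply: mset_or; last by apply: mset_and; [exact: mset_not|exact: mset_const].
  apply: (mE [set t | E (wgt m t.2)]); apply: mset_preim mEE.
  exact: measurable_wgt.
have := CD _ (iso_kernel_invariant BG msg tsg sgP sV mV mB wB mw)
  (iso_kernel_nondegenerate BG msg tsg sgP sV mV mB wB mw).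
have nN : mu.-negligible (base GG sg V @^-1` N).
  by exists (base GG sg V @^-1` N); split => //; exact: mset_preim mb mN.
move=> nL; apply: negligibleS (negligibleU finO (negligibleU nL nN)).
move=> x /= nCD; apply: contrapT => H.
have fx : finite_set [set y | orbit_relation GG (x, y)].
  by apply: contrapT => infx; apply: H; left.
have hx := finite_orbit_base tsg sgP V fx.
have [z zw] : exists z : real_seq R, witness GG sg (base GG sg V x, z).
  apply: (witness_exists BG tsg sgP) => CDb; apply: nCD.
  by rewrite -[x](tgt_to_base tsg V); exact: choquet_deny_conjugate.
have [|Bx|Nx] := AB (base GG sg V x); first by exists (base GG sg V x, z).
  apply: H; right; left => L.
  exact: (iso_kernel_not_liouville BG msg tsg sgP sV mV mB wB mw (conj hx Bx)).
by apply: H; right; right.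
Qed.

End Assembly.

Theorem theoremA (R : realType) (dX dG : measure_display)
    (X : measurableType dX) (G : measurableType dG) (GG : groupoid X G)
    (mu : probability X R) (Gmu : discrete_measured_groupoid GG mu) :
  choquet_deny_groupoid GG mu <->
  {ae mu, forall x, finite_set [set y | orbit_relation GG (x, y)]} /\
  {ae mu, forall x, choquet_deny_group R (isotropy GG x)}.
Proof.
have [BG _] := Gmu; split=> [CD|[finO CD] p [p0 p1 _] nd].
  by split; [exact: choquet_deny_finite_orbits|exact: choquet_deny_isotropy].
apply: negligibleS (negligibleU finO CD) => x /= nL; apply: contrapT => H.
apply: nL; apply: finite_orbit_liouville => //; apply: contrapT => ?; apply: H.
  by left.
by right.
Qed.
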